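(* Let $(\phi_t)_{t\ge 0}$ be a non-elliptic semigroup of holomorphic functions in the unit disk $\mathbb{D}$, let $\Delta$ be a degenerate petal of $(\phi_t)$, and let $K$ be a compact non-polar subset of $\Delta$. Then: (i) $\lim_{t\to-\infty}\omega(\phi_t(z),\phi_t(K),\mathbb{D})=0$ for all $z\in\Delta\setminus K$; (ii) $\lim_{t\to-\infty}\lambda_{\mathbb{D}}(\phi_t(z))=+\infty$ for all $z\in\Delta$; (iii) $\lim_{t\to-\infty}d_{\mathbb{D}}(\phi_t(z),\phi_t(w))=+\infty$ for all $z,w\in\Delta$ with $z\ne w$; (iv) $\lim_{t\to-\infty}g_{\mathbb{D}}(\phi_t(z),\phi_t(w))=0$ for all $z,w\in\Delta$ with $z\ne w$; (v) $\lim_{t\to-\infty}\mathrm{A}_h^{\mathbb{D}}(\phi_t(K))=0$; (vi) $\lim_{t\to-\infty}d_{n,h}^{\mathbb{D}}(\phi_t(K))=+\infty$ for every integer $n\ge2$; (vii) $\lim_{t\to-\infty}\operatorname{cap}(\mathbb{D},\phi_t(K))=+\infty$.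
   Context: $\mathbb{D}$ is the open unit disk. A (one-parameter) semigroup of holomorphic functions in $\mathbb{D}$ is a family $(\phi_t)_{t\ge0}$ of holomorphic maps $\phi_t:\mathbb{D}\to\mathbb{D}$ such that $\phi_0$ is the identity, $\phi_{t+s}=\phi_t\circ\phi_s$ for all $s,t\ge0$, and $\phi_t(z)\to z$ as $t\to0^+$ uniformly on compact subsets of $\mathbb{D}$. It is called non-elliptic if there is a point $\tau\in\partial\mathbb{D}$ (the Denjoy–Wolff point) with $\lim_{t\to+\infty}\phi_t(z)=\tau$ for every $z\in\mathbb{D}$. Every non-elliptic semigroup has a Koenigs function: a univalent holomorphic function $h:\mathbb{D}\to\mathbb{C}$, $h(0)=0$, with $h(\phi_t(z))=h(z)+t$ for all $z\in\mathbb{D}$, $t\ge0$; the simply connected domain $\Omega=h(\mathbb{D})$ is convex in the positive direction, i.e. $w+s\in\Omega$ for all $w\in\Omega$, $s\ge0$. The hyperbolic density of $\mathbb{D}$ is $\lambda_{\mathbb{D}}(z)=\frac{1}{1-|z|^2}$ and the hyperbolic distance is $d_{\mathbb{D}}(z,w)=\operatorname{arctanh}\left|\frac{z-w}{1-\bar z w}\right|$. A backward orbit of $(\phi_t)$ is a continuous curve $\gamma:[0,+\infty)\to\mathbb{D}$ with $\phi_s(\gamma(t))=\gamma(t-s)$ for all $t\ge0$, $s\in[0,t]$; it is regular if $\limsup_{t\to+\infty}d_{\mathbb{D}}(\gamma(t),\gamma(t+1))<+\infty$ and non-regular otherwise. If $\gamma$ is a non-regular backward orbit, the corresponding degenerate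 petal is the set $\Delta\subset\mathbb{D}$ with $h(\Delta)=\{h(\gamma(0))+t:t\in\mathbb{R}\}$ (this horizontal line is contained in $\Omega$). For $z\in\Delta$ and $t<0$, $\phi_t(z):=\phi_{-t}^{-1}(z)=h^{-1}(h(z)+t)$. A compact set is polar if its logarithmic capacity is zero. For a compact non-polar $E\subset\mathbb{D}$, $\omega(z,E,\mathbb{D})$ denotes the harmonic measure $\omega(z,\partial E,\mathbb{D}\setminus E)$, i.e. the Perron solution, evaluated at $z\in\mathbb{D}\setminus E$, of the Dirichlet problem on $\mathbb{D}\setminus E$ with boundary values $1$ on $\partial E$ and $0$ on $\partial\mathbb{D}$. The hyperbolic area is $\mathrm{A}_h^{\mathbb{D}}(E)=\int_E\lambda_{\mathbb{D}}(z)^2\,dA(z)$ with $A$ the Lebesgue area measure. For an integer $n\ge2$, the hyperbolic $n$-th diameter is $$d_{n,h}^{\mathbb{D}}(E)=\sup_{w_1,\dots,w_n\in E}\ \prod_{1\le\mu<\nu\le n}\left|\frac{w_\mu-w_\nu}{1-\overline{w_\mu}w_\nu}\right|^{\frac{2}{n(n-1)}}.$$ $g_{\mathbb{D}}(z,w)=\log\left|\frac{1-\bar z w}{z-w}\right|$ is the (positive) Green function of $\mathbb{D}$. The Green energy is $V(E,\mathbb{D})=\inf_\mu\iint g_{\mathbb{D}}(x,y)\,d\mu(x)\,d\mu(y)$, the infimum over Borel probability measures $\mu$ supported in $E$, and the capacity of the condenser $(\mathbb{D},E)$ is $\operatorname{cap}(\mathbb{D},E)=\frac{2\pi}{V(E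,\mathbb{D})}$.
   Formalization: In (vi) the limit of the hyperbolic n-th diameter is stated as 1 instead of +∞: with the given definition every factor of the product is less than 1 in the disk, so the diameter never exceeds 1 and the printed limit +∞ is impossible. *)

(* Defs.v *)
From HB Require Import structures.
From mathcomp Require Import all_boot all_order all_algebra.
From mathcomp Require Import all_classical all_reals all_analysis.
From mathcomp Require Export complex.

Set Implicit Arguments.
Unset Strict Implicit.
Unset Printing Implicit Defensive.

Import Order.TTheory GRing.Theory Num.Theory.
Import numFieldNormedType.Exports.
Local Open Scope classical_set_scope.
Local Open Scope complex_scope.
Local Open Scope ring_scope.

(* The regular algebra [R[i]^o] carries the topology and the normed-module
   structure over [R[i]], so that [derivable f z 1] is complex
   differentiability.  Its canonical norm is [R[i]]-valued; [normc] is the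
   [R]-valued modulus. *)
Notation Cplx R := ((complex R)^o).
Notation normc := ComplexField.Normc.normc.

Section Disk.
Context {R : realType}.
Local Notation C := (Cplx R).

Definition disk : set C := [set z | normc z < 1].

Definition holo_on (U : set C) (f : C -> C) : Prop :=
  forall z, U z -> derivable f z 1.

(* Only the values [phi t z] for [0 <= t] and [z] in the disk are relevant. *)
Definition holo_semigroup (phi : R -> C -> C) : Prop :=
  [/\ forall t : R, 0 <= t -> holo_on disk (phi t) /\ phi t @` disk `<=` disk,
      forall z, disk z -> phi 0 z = z,
      forall s t : R, 0 <= s -> 0 <= t ->
        forall z, disk z -> phi (t + s) z = phi t (phi s z) &
      forall K : set C, compact K -> K `<=` disk ->
        {uniform K, phi @ 0^'+ --> (id : C -> C)}].

Definition non_elliptic (phi : R -> C -> C) : Prop :=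
  exists2 tau : C, normc tau = 1 &
    forall z, disk z -> phi t z @[t --> +oo] --> tau.

(* These properties determine [h] uniquely from a non-elliptic [phi]. *)
Definition koenigs (phi : R -> C -> C) (h : C -> C) : Prop :=
  [/\ holo_on disk h, {in disk &, injective h}, h 0 = 0 &
      forall (t : R) (z : C), 0 <= t -> disk z -> h (phi t z) = h z + t%:C].

Definition artanh (x : R) : R := ln ((1 + x) / (1 - x)) / 2.

Definition pseudo_hyp_dist (z w : C) : R :=
  normc ((z - w) / (1 - z^* * w)).

Definition hyp_dist (z w : C) : R := artanh (pseudo_hyp_dist z w).

Definition backward_orbit (phi : R -> C -> C) (gamma : R -> C) : Prop :=
  [/\ {within `[0, +oo[, continuous gamma},
      forall t : R, 0 <= t -> disk (gamma t) &
      forall t s : R, 0 <= s <= t -> phi s (gamma t) = gamma (t - s)].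

Definition regular_orbit (gamma : R -> C) : Prop :=
  (limf_esup (fun t => (hyp_dist (gamma t) (gamma (t + 1)))%:E) +oo%R
     < +oo)%E.

Definition degenerate_petal (phi : R -> C -> C) (h : C -> C)
    (Delta : set C) : Prop :=
  exists gamma : R -> C,
    [/\ backward_orbit phi gamma, ~ regular_orbit gamma, Delta `<=` disk &
        h @` Delta = [set h (gamma 0) + t%:C | t in [set: R]]].

(* For [t < 0] this is the preimage of [z] under [phi (- t)], which exists and
   is unique when [z] lies in a petal, and is an arbitrary value otherwise. *)
Definition flow (phi : R -> C -> C) (t : R) (z : C) : C :=
  if 0 <= t then phi t z
  else xget (0 : C) [set w | disk w /\ phi (- t) w = z].

Local Notation plane := (measurableTypeR R * measurableTypeR R)%type.

Definition pt (p : plane) : C := (p.1 : R) +i* (p.2 : R).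

(* For compact [E], having support in [E] amounts to giving mass 1 to [E]. *)
Definition probability_on (E : set C) : set (probability plane R) :=
  [set mu | mu (pt @^-1` E) = 1%E].

Definition energy (k : C -> C -> \bar R) (mu : probability plane R) : \bar R :=
  (\int[mu]_p \int[mu]_q k (pt p) (pt q))%E.

Definition log_kernel (z w : C) : \bar R :=
  if z == w then +oo%E else (- ln (normc (z - w)))%:E.

(* The value 0 is adjoined only so that the empty set has capacity 0. *)
Definition log_capacity (E : set C) : \bar R :=
  ereal_sup (0%E |` [set expeR (- energy log_kernel mu)%E
                    | mu in probability_on E]).

Definition polar (E : set C) : Prop := log_capacity E = 0%E.

Definition circle_mean (u : C -> \bar R) (z : C) (r : R) : \bar R :=
  let arc : set R := `[0, 2 * pi]%classic in
  (((2 * pi)^-1)%:E * \int[lebesgue_measure]_(theta in arc)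
     u (z + ((r * cos theta) +i* (r * sin theta))%R)%R)%E.

(* [-oo] is an allowed value; the integral may be [-oo]. *)
Definition subharmonic_on (U : set C) (u : C -> \bar R) : Prop :=
  [/\ forall z, U z -> (u z < +oo)%E,
      forall z a, U z -> (u z < a%:E)%E -> \forall w \near z, (u w < a%:E)%E &
      forall z, U z -> exists2 rho : R, 0 < rho &
        forall r : R, 0 < r < rho ->
          (u z <= circle_mean u z r)%E].

Definition boundary (A : set C) : set C := closure A `\` A°.

Definition perron (U : set C) (f : C -> \bar R) (z : C) : \bar R :=
  ereal_sup [set u z | u in [set u : C -> \bar R | subharmonic_on U u /\
    forall xi, boundary U xi -> (limf_esup u (within U (nbhs xi)) <= f xi)%E]].

Definition harmonic_measure (z : C) (E : set C) : \bar R :=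
  perron (disk `\` E) (fun xi => (\1_(boundary E) xi)%:E) z.

Definition hyp_density (z : C) : R := (1 - normc z ^+ 2)^-1.

Definition hyp_area (E : set C) : \bar R :=
  (\int[lebesgue_measure \x lebesgue_measure]_(p in pt @^-1` E)
     (hyp_density (pt p) ^+ 2)%:E)%E.

(* For nonempty [E] inside the disk all factors lie in [0, 1], hence so does
   this diameter: the largest limit it can have is 1, not [+oo]. *)
Definition hyp_diameter (n : nat) (E : set C) : \bar R :=
  ereal_sup [set (\prod_(mu < n) \prod_(nu < n | (mu < nu)%N)
      pseudo_hyp_dist (w mu) (w nu) `^ (2 / (n * (n - 1))%:R))%:E
    | w in [set w : 'I_n -> C | forall i, E (w i)]].

Definition green (z w : C) : \bar R :=
  if z == w then +oo%E
  else (ln (normc ((1 - z^* * w) / (z - w))))%:E.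

Definition green_energy (E : set C) : \bar R :=
  ereal_inf [set energy green mu | mu in probability_on E].

(* In [\bar R], [0^-1 = +oo] and [+oo^-1 = 0]. *)
Definition condenser_capacity (E : set C) : \bar R :=
  ((2 * pi)%:E * (green_energy E)^-1)%E.

End Disk.

(* Main.v *)
Require Import Defs.
From HB Require Import structures.
From mathcomp Require Import all_boot all_order all_algebra.
From mathcomp Require Import all_classical all_reals all_analysis.
From mathcomp Require Import ring lra measurable_realfun.
Import Order.TTheory GRing.Theory Num.Theory.
Import numFieldNormedType.Exports.
Local Open Scope classical_set_scope.
Local Open Scope complex_scope.
Local Open Scope ring_scope.

Set Implicit Arguments.
Unset Strict Implicit.
Unset Printing Implicit Defensive.

(** Write [h] for the Koenigs function and let [trajectory s] be the point of the
petal with [h (trajectory s) = h (gamma 0) + s].  The flow acts on the petal by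
[s |-> s + t], so every claim is about the points [trajectory (a + t)] as [t]
goes to minus infinity.

The key is what non-regularity says about the domain [Omega = h(disk)].  If a
disk of fixed radius around [h (trajectory t)] were contained in [Omega] for
arbitrarily negative [t], then it would be so for every [t], because [Omega] is
stable under translations to the right; the Schwarz lemma for the inverse of
[h] would then bound the hyperbolic length of the steps of [gamma].  Hence
there are points [p] outside [Omega] as close to [h (trajectory t)] as desired
([trajectory_near_complement]).  With [p], the whole half-line to the left of
[p] is outside [Omega], so [q = (h - p)^(1/4)] is a holomorphic function on the
disk with values in the sector [|Im| <= Re] ([slit_root]), and [|q|] is tiny at
[trajectory (a + t)] while it stays bounded below at the points
[trajectory (b + t)] with [b] away from [a].

This function gives the two main estimates.  The Schwarz-Pick lemma for [q] as
a map into the right half-plane shows that the pseudo-hyperbolic distance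
between [trajectory (a + t)] and [trajectory (b + t)] tends to 1
([pseudo_trajectory_cvg1]); the limits of the hyperbolic distance, of the Green
function and of the hyperbolic diameter follow.  A multiple of [Re q] is a
harmonic majorant, near [trajectory (a + t)], of the subharmonic functions whose
supremum is the harmonic measure ([harmonic_measure_le]).

The density tends to infinity because [h] is bounded on compact subsets of the
disk.  The area vanishes for every [t]: hyperbolic distances along the
trajectory decrease with the flow, so the trajectory is Lipschitz on half-lines
([trajectory_lipschitz]) and its compact pieces are Lebesgue null.  For the
capacity, a compact non-polar set carries a probability of finite logarithmic,
hence finite Green, energy; when this measure is transported by the flow, the
Green kernel decreases to 0 off the diagonal, and dominated convergence gives
measures of arbitrarily small energy ([flow_energy_cvg]).  Finite energy also
excludes atoms, which provides the distinct points used for the diameter.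

The function theory rests on the maximum principle alone.  Subdivision of
squares shows that a divergence free planar field, merely differentiable at each
point, has no flux through the boundary of a square ([flux_zero]); in
logarithmic polar coordinates this is the mean value property ([mean_value]).
The maximum principle compares subharmonic functions with real parts of
holomorphic ones; a version with one puncture ([maximum_modulus_punctured])
replaces the theorem on removable singularities and yields the Schwarz lemmas
and the local behaviour of univalent functions. *)

Local Notation cRe := (@complex.Re _).
Local Notation cIm := (@complex.Im _).

(** * Modulus and complex differentiability *)

Section ComplexModulus.
Context {R : realType}.
Local Notation C := (Cplx R).
Implicit Types (f g : C -> C) (z w a : C).
(** The canonical norm on the complex numbers is complex valued; the lemmas below
restate the algebra of the real valued modulus for the type that carries the
topology, and [nbhs_cmodP] and [cderivableP] turn the topological notions into
estimates between real numbers. *)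
Lemma normr_cmodE (z : C) : `|z| = (normc z)%:C.
Proof. by []. Qed.
Lemma cmodM z w : normc (z * w) = normc z * normc w.
Proof. exact: ComplexField.Normc.normcM. Qed.
Lemma cmodV z : normc z^-1 = (normc z)^-1.
Proof. exact: ComplexField.Normc.normcV. Qed.
Lemma cmod0 : normc (0 : C) = 0.
Proof. exact: ComplexField.Normc.normc0. Qed.
Lemma cmod1 : normc (1 : C) = 1.
Proof. exact: ComplexField.Normc.normc1. Qed.
Lemma cmodN z : normc (- z) = normc z.
Proof. exact: normcN. Qed.
Lemma cmodD z w : normc (z + w) <= normc z + normc w.
Proof. exact: le_normcD. Qed.
Lemma cmodX z n : normc (z ^+ n) = normc z ^+ n.
Proof. by elim: n => [|n ih]; rewrite ?expr0 ?cmod1 // !exprS cmodM ih. Qed.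
Lemma cmod_ge0 z : 0 <= normc z.
Proof. by have : 0 <= `|z| by []; rewrite normr_cmodE ler0c. Qed.
Lemma cmod_eq0 z : (normc z == 0) = (z == 0).
Proof.
by apply/eqP/eqP => [/ComplexField.Normc.eq0_normc|->]; rewrite ?cmod0.
Qed.
Lemma cmod_gt0 z : (0 < normc z) = (z != 0).
Proof. by rewrite lt_neqAle cmod_ge0 andbT eq_sym cmod_eq0. Qed.
Lemma cmod_distC z w : normc (z - w) = normc (w - z).
Proof. by rewrite -cmodN opprB. Qed.
Lemma cmod_triangle z w v : normc (z - w) <= normc (z - v) + normc (v - w).
Proof. by have := cmodD (z - v) (v - w); rewrite addrA subrK. Qed.
Lemma cmod_sqr z : normc z ^+ 2 = cRe z ^+ 2 + cIm z ^+ 2.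
Proof. by case: z => a b /=; rewrite sqr_sqrtr // addr_ge0 ?sqr_ge0. Qed.
Lemma cmod_real (x : R) : normc x%:C = `|x|.
Proof. by rewrite /= expr0n /= addr0 sqrtr_sqr. Qed.
Lemma cmod_conj z : normc z^* = normc z.
Proof. by case: z => a b /=; rewrite sqrrN. Qed.
Lemma ReD z w : cRe (z + w) = cRe z + cRe w.
Proof. by case: z w => [? ?] [? ?]. Qed.
Lemma ReB z w : cRe (z - w) = cRe z - cRe w.
Proof. by case: z w => [? ?] [? ?]. Qed.
Lemma ImB z w : cIm (z - w) = cIm z - cIm w.
Proof. by case: z w => [? ?] [? ?]. Qed.
Lemma ReM z w : cRe (z * w) = cRe z * cRe w - cIm z * cIm w.
Proof. by case: z w => [? ?] [? ?]. Qed.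
Lemma normRe_le z : `|cRe z| <= normc z.
Proof. by case: z => a b /=; rewrite -sqrtr_sqr ler_sqrt ?lerDl ?addr_ge0 ?sqr_ge0. Qed.
Lemma normIm_le z : `|cIm z| <= normc z.
Proof. by case: z => a b /=; rewrite -sqrtr_sqr ler_sqrt ?lerDr ?addr_ge0 ?sqr_ge0. Qed.
Lemma cmod_le_ReIm z : normc z <= `|cRe z| + `|cIm z|.
Proof.
rewrite -(ler_pXn2r (n:=2)) ?nnegrE ?cmod_ge0 ?addr_ge0//.
rewrite cmod_sqr -(real_normK (num_real (cRe z))) -(real_normK (num_real (cIm z))).
by rewrite sqrrD lerD2r lerDl mulrn_wge0 // mulr_ge0.
Qed.
Lemma nbhs_cmodP (z : C) (A : set C) :
  nbhs z A <-> exists2 r : R, 0 < r & forall w, normc (w - z) < r -> A w.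
Proof.
split.
  rewrite -nbhs_ballE => -[e /= e0 H].
  have e0' := e0; rewrite ltcE /= in e0'. move/andP : e0' => [/eqP im re].
  exists (cRe e) => // w wz. apply: H. rewrite /ball /= distrC normr_cmodE. 
  rewrite ltcE /= im eqxx /=.  exact: wz.
move=> [r r0 H]. rewrite -nbhs_ballE. exists r%:C; first by rewrite /= ltcR.
by move=> w; rewrite /ball /= distrC normr_cmodE ltcR => /H.
Qed.
Lemma cderivableP f z : derivable f z 1 <->
  exists A : C, forall e : R, 0 < e -> exists2 r : R, 0 < r &
    forall w, normc (w - z) < r -> normc (f w - f z - A * (w - z)) <= e * normc (w - z).
Proof.
split.
- move=> /cvg_ex [l /cvgrPdist_le H]. exists l => e e0.
  have /H : 0 < e%:C by rewrite ltcR.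
  rewrite near_withinE => /nbhs_cmodP [r r0 {}H]; exists r => // w wz.
  have [->|wz0] := eqVneq w z.
    by rewrite !subrr mulr0 subrr !cmod0 mulr0.
  have {}H := H (w - z). 
  have : w - z != 0 by rewrite subr_eq0.
  move=> wz1. 
  have := H _ wz1. rewrite subr0 => /(_ wz).
  rewrite normr_cmodE lecR /= => K.
  rewrite -ler_pdivrMr ?cmod_gt0 //.
  rewrite -cmodV -cmodM. apply: le_trans K. rewrite -cmodN.
  rewrite le_eqVlt; apply/orP; left; apply/eqP; congr normc.
  rewrite /= scaler1 subrK. rewrite /GRing.scale /=. field.
  exact: wz1.
- move=> [A H]. apply/cvg_ex. exists A. apply/cvgrPdist_le => e e0.
  have [/eqP im re] : (cIm e == 0) /\ 0 < cRe e.
    by move: e0; rewrite ltcE => /andP [].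
  have [r r0 K] := H _ re. rewrite near_withinE. apply/nbhs_cmodP. exists r => // w.
  rewrite subr0 => wr w0. have := K (w + z). rewrite addrK => /(_ wr).
  rewrite -ler_pdivrMr ?cmod_gt0 // -cmodV -cmodM => {}K.
  rewrite normr_cmodE lecE /= im eqxx. apply: le_trans K. rewrite -cmodN.
  rewrite le_eqVlt; apply/orP; left; apply/eqP; congr normc.
  rewrite /= scaler1. rewrite /GRing.scale /=. field.
  exact: w0.
Qed.
Lemma cderivable_comp f g z : derivable f z 1 -> derivable g (f z) 1 -> derivable (g \o f) z 1.
Proof. 
move=> /derivable1_diffP df /derivable1_diffP dg; apply/derivable1_diffP.
exact: (differentiable_comp df dg).
Qed.
Lemma cderivable_continuous f z : derivable f z 1 -> {for z, continuous f}.
Proof. by move/derivable1_diffP/differentiable_continuous. Qed.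
Lemma cderivable_cst a z : derivable (fun _ => a : C) z 1.
Proof. exact: derivable_cst. Qed.
Lemma cderivable_id z : derivable (fun w => w : C) z 1.
Proof. exact: derivable_id. Qed.
Lemma cderivableD f g z : derivable f z 1 -> derivable g z 1 ->
  derivable (fun w => f w + g w : C) z 1.
Proof. exact: derivableD. Qed.
Lemma cderivableB f g z : derivable f z 1 -> derivable g z 1 ->
  derivable (fun w => f w - g w : C) z 1.
Proof. exact: derivableB. Qed.
Lemma cderivableM f g z : derivable f z 1 -> derivable g z 1 ->
  derivable (fun w => f w * g w : C) z 1.
Proof. exact: derivableM. Qed.
Lemma cderivableV f z : f z != 0 -> derivable f z 1 -> derivable (fun w => (f w)^-1 : C) z 1.
Proof. exact: derivableV. Qed.
End ComplexModulus.

(** * Flux of a divergence free field through a square *)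

Section Goursat.
Context {R : realType}.
Implicit Types (P Q : R -> R -> R) (f : R -> R).

Local Notation leb := (@lebesgue_measure R).

Definition itv_int (a b : R) f : R := \int[leb]_(t in `[a, b]) f t.

(** Two-sided continuity at the endpoints as well: the functions integrated below
are continuous on a neighbourhood of the segment. *)
Definition itv_continuous (a b : R) f := forall t, a <= t <= b -> {for t, continuous f}.

Lemma itv_continuous_integrable a b f : itv_continuous a b f ->
  leb.-integrable `[a, b] (EFin \o f).
Proof.
move=> cf; apply: continuous_compact_integrable; first exact: segment_compact.
apply: continuous_in_subspaceT => t.
by rewrite inE /= in_itv /= => /cf.
Qed.

Lemma itv_int_add a b c f : a <= b <= c -> itv_continuous a c f ->
  itv_int a c f = itv_int a b f + itv_int b c f.
Proof.
move=> /andP[ab bc] /itv_continuous_integrable cf.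
have := @Rintegral_itvB R f (BLeft a) (BRight c) b cf.
rewrite !bnd_simp => /(_ ab bc).
rewrite Rintegral_itv_obnd_cbnd; last first.
  apply: integrableS cf => //= t /=; rewrite !in_itv /= => /andP[bt ->].
  by rewrite andbT (le_trans ab)// ltW.
by rewrite /itv_int => <-; rewrite addrC subrK.
Qed.

Lemma itv_int_cst a b k : a <= b -> itv_int a b (fun=> k) = k * (b - a).
Proof.
move=> ab; rewrite /itv_int Rintegral_cst//; have := @lebesgue_measure_itv R `[a, b]%R => /= ->.
rewrite lte_fin; move: ab; rewrite le_eqVlt => /orP[/eqP ->|->//].
by rewrite ltxx subrr.
Qed.

Lemma itv_continuous_cst a b k : itv_continuous a b (fun=> k).
Proof. by move=> t _; exact: cst_continuous. Qed.

Lemma itv_continuousB a b f g : itv_continuous a b f -> itv_continuous a b g ->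
  itv_continuous a b (fun t => f t - g t).
Proof. by move=> cf cg t tab; apply: cvgB; [exact: cf|exact: cg]. Qed.

Lemma itv_intB a b f g : itv_continuous a b f -> itv_continuous a b g ->
  itv_int a b (fun t => f t - g t) = itv_int a b f - itv_int a b g.
Proof.
move=> cf cg; rewrite /itv_int RintegralB//; exact: itv_continuous_integrable.
Qed.

Lemma itv_int_dist a b f k e : a <= b -> itv_continuous a b f ->
  (forall t, a <= t <= b -> `|f t - k| <= e) ->
  `|itv_int a b f - k * (b - a)| <= e * (b - a).
Proof.
move=> ab cf fk.
have up : itv_int a b f <= itv_int a b (fun=> k + e).
  apply: le_Rintegral => //; try exact: itv_continuous_integrable.
    exact/itv_continuous_integrable/itv_continuous_cst.
  move=> t; rewrite /= in_itv /= => /fk.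
  by rewrite ler_norml => /andP[]; lra.
have lo : itv_int a b (fun=> k - e) <= itv_int a b f.
  apply: le_Rintegral => //; try exact: itv_continuous_integrable.
    exact/itv_continuous_integrable/itv_continuous_cst.
  move=> t; rewrite /= in_itv /= => /fk.
  by rewrite ler_norml => /andP[]; lra.
move: up lo; rewrite !itv_int_cst// ler_norml => up lo.
by apply/andP; split; lra.
Qed.

(** Total differentiability, with partial derivatives [p1] and [p2] that need not
be continuous. *)
Definition has_differential P (s t p1 p2 : R) := forall e : R, 0 < e -> exists2 r : R, 0 < r &
  forall s' t', `|s' - s| < r -> `|t' - t| < r ->
  `|P s' t' - P s t - p1 * (s' - s) - p2 * (t' - t)| <= e * (`|s' - s| + `|t' - t|).

Definition divergence_free_at P Q s t :=
  exists p1 p2 q1, has_differential P s t p1 p2 /\ has_differential Q s t q1 (- p1).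

Lemma differential_continuous2 P s t p1 p2 : has_differential P s t p1 p2 ->
  {for t, continuous (P s)}.
Proof.
move=> /(_ 1 ltr01)[r r0 H]; apply/cvgrPdist_le => e e0.
have k0 : 0 < `|p2| + 1 by rewrite ltr_pwDr.
have : 0 < Num.min r (e / (`|p2| + 1)) by rewrite lt_min r0 divr_gt0.
move=> d0; apply/nbhs_ballP; exists (Num.min r (e / (`|p2| + 1))) => // t'.
rewrite /ball /= lt_min => /andP[tr te].
have := H s t'; rewrite subrr normr0 mulr0 subr0 add0r mul1r distrC tr r0 => /(_ isT isT).
move: te; rewrite ltr_pdivlMr// => te K.
rewrite distrC (le_trans _ (ltW te))// mulrDr mulr1.
rewrite -[P s t' - _](subrK (p2 * (t' - t))) (le_trans (ler_normD _ _))//.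
by rewrite addrC normrM distrC mulrC lerD// distrC.
Qed.

Lemma differential_continuous1 P s t p1 p2 : has_differential P s t p1 p2 ->
  {for s, continuous (P^~ t)}.
Proof.
move=> H; apply: (@differential_continuous2 (fun x y => P y x) t s p2 p1) => e /H[r r0 K].
exists r => // s' t' sr tr; have := K _ _ tr sr.
by rewrite [`|t' - s| + _]addrC addrAC.
Qed.

Definition in_square (x y l s t : R) := (x <= s <= x + l) && (y <= t <= y + l).

(** Outgoing flux of the field [(P, Q)] through the boundary of a square. *)
Definition flux P Q (x y l : R) :=
  itv_int y (y + l) (P (x + l)) - itv_int y (y + l) (P x) +
  (itv_int x (x + l) (Q^~ (y + l)) - itv_int x (x + l) (Q^~ y)).

(** The contributions of the inner edges cancel in pairs. *)
Lemma flux_add P Q x y m : 0 <= m ->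
  (forall s t, in_square x y (m + m) s t -> divergence_free_at P Q s t) ->
  flux P Q x y (m + m) = flux P Q x y m + flux P Q (x + m) y m
    + flux P Q x (y + m) m + flux P Q (x + m) (y + m) m.
Proof.
move=> m0 H.
have cP s : x <= s <= x + (m + m) -> itv_continuous y (y + (m + m)) (P s).
  move=> sx t ty; have [|p1 [p2 [q1 [/differential_continuous2 //]]]] := H s t.
  by rewrite /in_square sx ty.
have cQ t : y <= t <= y + (m + m) -> itv_continuous x (x + (m + m)) (Q^~ t).
  move=> ty s sx; have [|p1 [p2 [q1 [_ /differential_continuous1 //]]]] := H s t.
  by rewrite /in_square sx ty.
rewrite /flux -!addrA.
rewrite (@itv_int_add y (y + m) _ (P (x + (m + m)))); [|lra|apply: cP; lra].
rewrite (@itv_int_add y (y + m) _ (P x)); [|lra|apply: cP; lra].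
rewrite (@itv_int_add x (x + m) _ (Q^~ (y + (m + m)))); [|lra|apply: cQ; lra].
rewrite (@itv_int_add x (x + m) _ (Q^~ y)); [|lra|apply: cQ; lra].
ring.
Qed.

(** An affine field has flux equal to its divergence times the area, here 0; only
the remainder of the first order expansion at [(s, t)] is left, and it is
small compared with the area because [(s, t)] lies in the square. *)
Lemma flux_small P Q x y l s t p1 p2 q1 e : 0 <= l -> 0 < e ->
  (forall s t, in_square x y l s t -> divergence_free_at P Q s t) ->
  in_square x y l s t ->
  (forall s' t', in_square x y l s' t' ->
    `|P s' t' - P s t - p1 * (s' - s) - p2 * (t' - t)| <= e * (`|s' - s| + `|t' - t|)) ->
  (forall s' t', in_square x y l s' t' ->
    `|Q s' t' - Q s t - q1 * (s' - s) - (- p1) * (t' - t)| <= e * (`|s' - s| + `|t' - t|)) ->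
  `|flux P Q x y l| <= 8 * e * l ^+ 2.
Proof.
move=> l0 e0 H st HP HQ.
have cP s' : x <= s' <= x + l -> itv_continuous y (y + l) (P s').
  move=> sx t' ty; have [|? [? [? [/differential_continuous2 //]]]] := H s' t'.
  by rewrite /in_square sx ty.
have cQ t' : y <= t' <= y + l -> itv_continuous x (x + l) (Q^~ t').
  move=> ty s' sx; have [|? [? [? [_ /differential_continuous1 //]]]] := H s' t'.
  by rewrite /in_square sx ty.
have x0 : x <= x <= x + l by lra. have x1 : x <= x + l <= x + l by lra.
have y0 : y <= y <= y + l by lra. have y1 : y <= y + l <= y + l by lra.
have near' s' t' : in_square x y l s' t' -> e * (`|s' - s| + `|t' - t|) <= e * (2 * l).
  move: st => /andP[/andP[s1 s2] /andP[t1 t2]] /andP[/andP[s3 s4] /andP[t3 t4]].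
  rewrite ler_wpM2l ?(ltW e0)// mulr_natl mulr2n lerD// ler_norml; apply/andP; split; lra.
have A : `|itv_int y (y + l) (fun t' => P (x + l) t' - P x t') - p1 * l * (y + l - y)|
    <= 4 * e * l * (y + l - y).
  apply: itv_int_dist; [lra|by apply: itv_continuousB; apply: cP|] => t' ty.
  have S1 : in_square x y l (x + l) t' by rewrite /in_square x1 ty.
  have S0 : in_square x y l x t' by rewrite /in_square x0 ty.
  have := le_trans (HP _ _ S1) (near' _ _ S1); have := le_trans (HP _ _ S0) (near' _ _ S0).
  rewrite !ler_norml => /andP[a b] /andP[c d]; apply/andP; split; lra.
have B : `|itv_int x (x + l) (fun s' => Q s' (y + l) - Q s' y) - (- p1) * l * (x + l - x)|
    <= 4 * e * l * (x + l - x).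
  apply: itv_int_dist; [lra|by apply: itv_continuousB; apply: cQ|] => s' sx.
  have S1 : in_square x y l s' (y + l) by rewrite /in_square sx y1.
  have S0 : in_square x y l s' y by rewrite /in_square sx y0.
  have := le_trans (HQ _ _ S1) (near' _ _ S1); have := le_trans (HQ _ _ S0) (near' _ _ S0).
  rewrite !ler_norml => /andP[a b] /andP[c d]; apply/andP; split; lra.
rewrite /flux -itv_intB; [|exact: cP|exact: cP].
rewrite -itv_intB; [|exact: cQ|exact: cQ].
move: A B; rewrite !ler_norml => /andP[a b] /andP[c d]; apply/andP; split; lra.
Qed.

(** The supremum of the left endpoints lies in every interval. *)
Lemma nested_point (a b : nat -> R) : (forall n, a n <= a n.+1) ->
  (forall n, b n.+1 <= b n) -> (forall n, a n <= b n) ->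
  exists s, forall n, a n <= s <= b n.
Proof.
move=> /nondecreasing_seqP aS /nonincreasing_seqP bS ab.
have abmn m n : a m <= b n.
  by rewrite (le_trans (aS _ _ (leq_maxl m n)))// (le_trans (ab _))// bS// leq_maxr.
exists (sup (range a)) => n; apply/andP; split.
  apply: ub_le_sup; last by exists n.
  by exists (b 0%N) => _ [m _ <-].
by apply: ge_sup; [by exists (a 0%N), 0%N|move=> _ [m _ <-]].
Qed.

(** Bisection: were the property false for the large square, it would be false for
a nested sequence of squares, and then near their common point. *)
Lemma square_induction (G : R -> R -> R -> Prop) (X Y L : R) : 0 < L ->
  (forall x y m, 0 < m -> X <= x -> x + (m + m) <= X + L -> Y <= y -> y + (m + m) <= Y + L ->
     G x y m -> G (x + m) y m -> G x (y + m) m -> G (x + m) (y + m) m -> G x y (m + m)) ->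
  (forall s t, in_square X Y L s t -> exists2 d : R, 0 < d &
     forall x y l, X <= x -> x + l <= X + L -> Y <= y -> y + l <= Y + L ->
     0 < l < d -> in_square x y l s t -> G x y l) ->
  G X Y L.
Proof.
move=> L0 Gsplit Gloc; apply: contrapT => nG.
pose len n : R := L / 2 ^+ n.
have len0 n : 0 < len n by rewrite divr_gt0// exprn_gt0.
have lenS n : len n = len n.+1 + len n.+1.
  by rewrite /len exprS; field; rewrite expf_neq0.
pose bad n (c : R * R) := [/\ X <= c.1, c.1 + len n <= X + L, Y <= c.2,
  c.2 + len n <= Y + L & ~ G c.1 c.2 (len n)].
have step n (c : R * R) : exists c' : R * R, bad n c -> [/\ bad n.+1 c',
    c.1 <= c'.1, c'.1 + len n.+1 <= c.1 + len n, c.2 <= c'.2 &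
    c'.2 + len n.+1 <= c.2 + len n].
  case: c => x y; have m0 := len0 n.+1; rewrite /bad (lenS n) /=; move: (len n.+1) m0 => m m0.
  have [G1|?] := pselect (G x y m); last by exists (x, y) => /= -[? ? ? ? _]; split;
    first split; by [|lra].
  have [G2|?] := pselect (G (x + m) y m); last first.
    by exists (x + m, y) => /= -[? ? ? ? _]; split; first split; by [|lra].
  have [G3|?] := pselect (G x (y + m) m); last first.
    by exists (x, y + m) => /= -[? ? ? ? _]; split; first split; by [|lra].
  have [G4|?] := pselect (G (x + m) (y + m) m); last first.
    by exists (x + m, y + m) => /= -[? ? ? ? _]; split; first split; by [|lra].
  by exists (x, y) => /= -[? ? ? ?]; case; exact: Gsplit.
pose next n c := projT1 (cid (step n c)).
have nextP n c := projT2 (cid (step n c)).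
pose c := fix c n := if n is n'.+1 then next n' (c n') else (X, Y).
have cbad n : bad n (c n).
  elim: n => [|n ih]; last by have [] := nextP n (c n) ih.
  by rewrite /bad /= /len expr0 divr1; split.
have cS n : [/\ (c n).1 <= (c n.+1).1, (c n.+1).1 + len n.+1 <= (c n).1 + len n,
    (c n).2 <= (c n.+1).2 & (c n.+1).2 + len n.+1 <= (c n).2 + len n].
  by have [] := nextP n (c n) (cbad n).
have [s sP] : exists s, forall n, (c n).1 <= s <= (c n).1 + len n.
  apply: (@nested_point (fun n => (c n).1) (fun n => (c n).1 + len n)) => n.
  - by case: (cS n). - by case: (cS n). - by rewrite lerDl ltW.
have [t tP] : exists t, forall n, (c n).2 <= t <= (c n).2 + len n.
  apply: (@nested_point (fun n => (c n).2) (fun n => (c n).2 + len n)) => n.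
  - by case: (cS n). - by case: (cS n). - by rewrite lerDl ltW.
have [|d d0 Gd] := Gloc s t.
  rewrite /in_square; have := sP 0%N; have := tP 0%N.
  by rewrite /= /len expr0 divr1 => -> ->.
have [n Ln] : exists n, len n < d.
  exists (Num.truncn (L / d)).+1; rewrite /len ltr_pdivrMr ?exprn_gt0//.
  rewrite mulrC -ltr_pdivrMr// (lt_trans (truncnS_gt _))//.
  by rewrite -natrX ltr_nat ltn_expl.
have [b1 b2 b3 b4] := cbad n; apply; apply: Gd => //.
  by rewrite len0.
by rewrite /in_square sP tP.
Qed.

(** Goursat's argument.  The bound [8 e l^2] is additive under the division of a
square in four and holds for small squares around each point, so it holds for
the large square, with [e] arbitrary. *)
Theorem flux_zero P Q (X Y L : R) : 0 < L ->
  (forall s t, in_square X Y L s t -> divergence_free_at P Q s t) -> flux P Q X Y L = 0.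
Proof.
move=> L0 H; apply/eqP; rewrite -normr_le0; apply/ler_addgt0Pl => e e0.
rewrite addr0; pose e' := e / (8 * L ^+ 2).
have e'0 : 0 < e' by rewrite divr_gt0// mulr_gt0// exprn_gt0.
have -> : e = 8 * e' * L ^+ 2.
  by rewrite /e'; field; rewrite gt_eqF.
have sub x y l s t : X <= x -> x + l <= X + L -> Y <= y -> y + l <= Y + L ->
    in_square x y l s t -> in_square X Y L s t.
  move=> ? ? ? ? /andP[/andP[? ?] /andP[? ?]]; rewrite /in_square.
  by apply/andP; split; apply/andP; split; lra.
apply: (@square_induction (fun x y l => `|flux P Q x y l| <= 8 * e' * l ^+ 2)) => //.
  move=> x y m m0 xX xL yY yL G1 G2 G3 G4.
  rewrite flux_add; [|lra|by move=> s t st; apply: H; apply: sub st].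
  have -> : 8 * e' * (m + m) ^+ 2 = 8 * e' * m ^+ 2 + 8 * e' * m ^+ 2 + 8 * e' * m ^+ 2
    + 8 * e' * m ^+ 2 by ring.
  rewrite (le_trans (ler_normD _ _))// lerD//.
  rewrite (le_trans (ler_normD _ _))// lerD//.
  by rewrite (le_trans (ler_normD _ _))// lerD.
move=> s t st; have [p1 [p2 [q1 [/(_ _ e'0)[r1 r10 HP] /(_ _ e'0)[r2 r20 HQ]]]]] := H s t st.
exists (Num.min r1 r2); first by rewrite lt_min r10.
move=> x y l xX xL yY yL; rewrite lt_min => /and3P[l0 l1 l2] sq.
apply: (@flux_small P Q x y l s t p1 p2 q1) => //; first exact: ltW.
- by move=> s' t' st'; apply: H; apply: sub st'.
- move=> s' t' st'; move: sq st' => /andP[/andP[? ?] /andP[? ?]] /andP[/andP[? ?] /andP[? ?]].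
  by apply: HP; rewrite ltr_norml; apply/andP; split; lra.
- move=> s' t' st'; move: sq st' => /andP[/andP[? ?] /andP[? ?]] /andP[/andP[? ?] /andP[? ?]].
  by apply: HQ; rewrite ltr_norml; apply/andP; split; lra.
Qed.
End Goursat.

(** * The mean value property *)

Section MeanValue.
Context {R : realType}.
Local Notation C := (Cplx R).

Lemma is_derive_eps (f : R -> R) (x l : R) : is_derive x 1 f l -> forall e : R, 0 < e ->
  exists2 r : R, 0 < r & forall y, `|y - x| < r ->
    `|f y - f x - l * (y - x)| <= e * `|y - x|.
Proof.
move=> [df dl] e e0.
have /cvgrPdist_le/(_ _ e0) : h^-1 *: ((f \o shift x) (h *: 1) - f x) @[h --> 0^'] --> l.
  by rewrite -dl; exact: df.
rewrite near_withinE => /nbhs_ballP[r r0 H]; exists r => // y yx.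
have [->|yx0] := eqVneq y x; first by rewrite !subrr mulr0 subr0 normr0 mulr0.
have y0 : y - x != 0 by rewrite subr_eq0.
have := H (y - x); rewrite /ball /= sub0r normrN => /(_ yx y0).
rewrite /GRing.scale /= mulr1 subrK => K.
have n0 : 0 < `|y - x| by rewrite normr_gt0.
rewrite -ler_pdivrMr// -normfV -normrM -normrN; apply: le_trans K.
rewrite le_eqVlt; apply/orP; left; apply/eqP; congr `|_|.
by field.
Qed.

(** The bound on [b] makes the remainder estimate uniform in the second variable;
it holds for the sine and cosine factors of the exponential. *)
Lemma differential_mul (a b : R -> R) (s t a' b' : R) : is_derive s 1 a a' ->
  is_derive t 1 b b' ->
  (forall x, `|b x| <= 1) ->
  has_differential (fun x y => a x * b y) s t (a' * b t) (a s * b').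
Proof.
move=> da db b1 e e0.
pose k := 1 + `|a'| + `|a s|.
have k0 : 0 < k by rewrite /k -addrA ltr_pwDl// addr_ge0.
have ek0 : 0 < e / k by rewrite divr_gt0.
have [r1 r10 H1] := is_derive_eps da ek0.
have [r2 r20 H2] := is_derive_eps db ek0.
pose r3 := Num.min 1 (e / k / (`|b'| + e / k)).
have r30 : 0 < r3 by rewrite lt_min ltr01 /= divr_gt0// ltr_wpDl.
exists (Num.min r1 (Num.min r2 r3)); first by rewrite !lt_min r10 r20 ltr01 divr_gt0// ltr_wpDl.
move=> s' t'; rewrite !lt_min => /and3P[/H1 {}H1 _ _] /and3P[_ /H2 {}H2 tr].
have bt : `|b t' - b t| <= e / k.
  have -> : b t' - b t = (b t' - b t - b' * (t' - t)) + b' * (t' - t) by ring.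
  have /andP[_] := tr; rewrite ltr_pdivlMr ?ltr_wpDl// => {}tr.
  rewrite (le_trans (ler_normD _ _))// (le_trans _ (ltW tr))//.
  by rewrite addrC [leRHS]mulrDr; apply: lerD; [rewrite normrM mulrC|rewrite [leRHS]mulrC].
have -> : a s' * b t' - a s * b t - a' * b t * (s' - s) - a s * b' * (t' - t)
  = (a s' - a s - a' * (s' - s)) * b t' + a' * (s' - s) * (b t' - b t)
  + a s * (b t' - b t - b' * (t' - t)) by ring.
have -> : e * (`|s' - s| + `|t' - t|) = e / k * `|s' - s| + `|a'| * `|s' - s| * (e / k)
   + `|a s| * (e / k * `|t' - t|) + (e / k * `|s' - s| * `|a s|
   + e / k * `|t' - t| * (1 + `|a'|)) by rewrite /k; field; rewrite gt_eqF.
rewrite -[X in X <= _]addr0; apply: lerD; last first.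
  by apply: addr_ge0; apply: mulr_ge0 => //; apply: mulr_ge0 => //; exact: ltW.
rewrite (le_trans (ler_normD _ _))// lerD//; last by rewrite normrM ler_wpM2l.
rewrite (le_trans (ler_normD _ _))// lerD//.
  by rewrite normrM -[leRHS]mulr1 ler_pM.
by rewrite !normrM ler_wpM2l// mulr_ge0.
Qed.

(** Differentiability at [s + i t], written in real coordinates. *)
Definition has_cdifferential (F : R -> R -> C) s t (B : C) := forall e : R, 0 < e ->
  exists2 r : R, 0 < r &
  forall s' t', `|s' - s| < r -> `|t' - t| < r ->
  normc (F s' t' - F s t - B * ((s' - s) +i* (t' - t))) <= e * (`|s' - s| + `|t' - t|).

(** These are the Cauchy-Riemann equations. *)
Lemma cdifferential_divergence_free F s t B : has_cdifferential F s t B ->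
  divergence_free_at (fun x y => cRe (F x y)) (fun x y => - cIm (F x y)) s t.
Proof.
case: B => al be H; exists al, (- be), (- be); split=> e /H[r r0 K]; exists r => // s' t' sr tr.
  apply: le_trans (K _ _ sr tr); apply: le_trans (normRe_le _).
  case: (F s' t') => ? ?; case: (F s t) => ? ? /=.
  by rewrite le_eqVlt; apply/orP; left; apply/eqP; congr `|_|; ring.
apply: le_trans (K _ _ sr tr); apply: le_trans (normIm_le _).
case: (F s' t') => ? ?; case: (F s t) => ? ? /=; rewrite -normrN.
by rewrite le_eqVlt; apply/orP; left; apply/eqP; congr `|_|; ring.
Qed.

Lemma cdifferential_continuous F s t B : has_cdifferential F s t B ->
  {for t, continuous (fun y => cRe (F s y))}.
Proof. by move/cdifferential_divergence_free => [p1 [p2 [q1 [/differential_continuous2]]]]. Qed.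

(** The point [z + exp(s + i t)]. *)
Definition log_polar (z : C) (s t : R) : C :=
  z + ((expR s * cos t) +i* (expR s * sin t)).

Lemma norm_cos_le1 (x : R) : `|cos x| <= 1.
Proof. by rewrite ler_norml cos_geN1 cos_le1. Qed.
Lemma norm_sin_le1 (x : R) : `|sin x| <= 1.
Proof. by rewrite ler_norml sin_geN1 sin_le1. Qed.

Lemma log_polar_cdifferential z s t : has_cdifferential (log_polar z) s t ((expR s * cos t) +i* (expR s * sin t)).
Proof.
move=> e e0; have e20 : 0 < e / 2 by rewrite divr_gt0.
have [r1 r10 H1] := @differential_mul _ _ s t _ _ (is_derive_expR s) (is_derive_cos t) norm_cos_le1 _ e20.
have [r2 r20 H2] := @differential_mul _ _ s t _ _ (is_derive_expR s) (is_derive_sin t) norm_sin_le1 _ e20.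
exists (Num.min r1 r2); first by rewrite lt_min r10.
move=> s' t'; rewrite !lt_min => /andP[s1 s2] /andP[t1 t2].
have := H1 _ _ s1 t1; have := H2 _ _ s2 t2 => A B.
apply: le_trans (cmod_le_ReIm _) _; rewrite [e](splitr) mulrDl; apply: lerD.
  apply: le_trans B; rewrite /log_polar; case: z => z1 z2 /=.
  by rewrite le_eqVlt; apply/orP; left; apply/eqP; congr `|_|; ring.
apply: le_trans A; rewrite /log_polar; case: z => z1 z2 /=.
by rewrite le_eqVlt; apply/orP; left; apply/eqP; congr `|_|; ring.
Qed.

Lemma comp_cdifferential (f : C -> C) F s t B : derivable f (F s t) 1 ->
  has_cdifferential F s t B ->
  exists B', has_cdifferential (fun x y => f (F x y)) s t B'.
Proof.
move=> /cderivableP[A HA] HF; exists (A * B) => e e0.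
pose M := normc B + 1; have M0 : 0 < M by rewrite ltr_wpDl// cmod_ge0.
have [r1 r10 H1] := HA _ (divr_gt0 e0 (mulr_gt0 (ltr0n _ 2) M0)).
pose k := Num.min 1 (e / (2 * (normc A + 1))).
have A0 : 0 < normc A + 1 by rewrite ltr_wpDl// cmod_ge0.
have k0 : 0 < k by rewrite lt_min ltr01 divr_gt0// mulr_gt0.
have [r2 r20 H2] := HF _ k0.
pose r3 := r1 / (2 * M).
have r30 : 0 < r3 by rewrite divr_gt0// mulr_gt0.
exists (Num.min r2 r3); first by rewrite lt_min r20.
move=> s' t'; rewrite !lt_min => /andP[s2 s3] /andP[t2 t3].
set w := (_ +i* _); set N := `|s' - s| + `|t' - t|.
have := H2 _ _ s2 t2; rewrite -/w -/N; set err := (_ - B * w) => Herr.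
have N0 : 0 <= N by rewrite addr_ge0.
have wN : normc w <= N by exact: cmod_le_ReIm.
have dF : F s' t' - F s t = B * w + err by rewrite /err; ring.
have FM : normc (F s' t' - F s t) <= M * N.
  rewrite dF (le_trans (cmodD _ _))// mulrDl cmodM lerD//; first by rewrite ler_wpM2l ?cmod_ge0.
  by rewrite (le_trans Herr)// ler_wpM2r// ge_min lexx.
have Fr : normc (F s' t' - F s t) < r1.
  apply: le_lt_trans FM _; have -> : r1 = M * (r3 + r3) by rewrite /r3; field; rewrite gt_eqF.
  by rewrite ltr_pM2l// ltrD.
have -> : f (F s' t') - f (F s t) - A * B * w =
   (f (F s' t') - f (F s t) - A * (F s' t' - F s t)) + A * err by rewrite dF; ring.
rewrite (le_trans (cmodD _ _))// [e]splitr mulrDl lerD//.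
  apply: le_trans (H1 _ Fr) _.
  have -> : e / 2 * N = e / (2 * M) * (M * N) by field; rewrite gt_eqF.
  by rewrite ler_wpM2l// divr_ge0 ?(ltW e0)// mulr_ge0// ltW.
rewrite cmodM; have -> : e / 2 * N = (normc A + 1) * (e / (2 * (normc A + 1)) * N).
  by field; rewrite gt_eqF.
apply: ler_pM; rewrite ?cmod_ge0 ?lerDl//.
by apply: le_trans Herr _; rewrite ler_wpM2r// ge_min lexx orbT.
Qed.

Lemma cmod_polar (r t : R) : 0 <= r -> normc ((r * cos t) +i* (r * sin t) : C) = r.
Proof.
move=> r0; apply: (@pexpIrn _ 2) => //; rewrite ?nnegrE ?cmod_ge0//.
by rewrite cmod_sqr /= !exprMn -mulrDr cos2Dsin2 mulr1.
Qed.

Definition circle (z : C) (r t : R) : C := z + ((r * cos t) +i* (r * sin t)).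

Lemma cmod_circle z r t : 0 <= r -> normc (circle z r t - z) = r.
Proof. by move=> r0; rewrite /circle addrC addKr cmod_polar. Qed.

Section fixed.
Context (f : C -> C) (z : C) (rho : R).
Context (hf : forall w, normc (w - z) < rho -> derivable f w 1).

Let log_polar_in s t : expR s < rho -> normc (log_polar z s t - z) < rho.
Proof. by rewrite -[log_polar z s t]/(circle z (expR s) t) cmod_circle// expR_ge0. Qed.

Let F_cdifferential s t : expR s < rho ->
  exists B, has_cdifferential (fun x y => f (log_polar z x y)) s t B.
Proof. by move=> /(log_polar_in t) /hf /comp_cdifferential/(_ (log_polar_cdifferential z s t)). Qed.

Let cF s t : expR s < rho -> {for t, continuous (fun y => cRe (f (log_polar z s y)))}.
Proof. by move=> /F_cdifferential-/(_ t)[B /cdifferential_continuous]. Qed.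

Lemma Re_circle_continuous r : 0 < r < rho ->
  itv_continuous 0 (2 * pi) (fun t => cRe (f (circle z r t))).
Proof.
move=> /andP[r0 rrho] t _.
by have := @cF (ln r) t; rewrite /log_polar lnK//; apply.
Qed.

Let M s := itv_int 0 (2 * pi) (fun t => cRe (f (log_polar z s t))).

Let pi20 : 0 < 2 * pi :> R.
Proof. by rewrite mulr_gt0// pi_gt0. Qed.

Let M_periodic s : expR s < rho -> M (s - 2 * pi) = M s.
Proof.
move=> srho.
have := @flux_zero R (fun x y => cRe (f (log_polar z x y))) (fun x y =>
  - cIm (f (log_polar z x y)))
  (s - 2 * pi) 0 (2 * pi) pi20.
rewrite /flux subrK !add0r.
have per x : log_polar z x (2 * pi) = log_polar z x 0.
  by rewrite /log_polar [2 * pi]mulr_natl cos2pi sin2pi cos0 sin0.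
rewrite (_ : (fun x => - cIm (f (log_polar z x (2 * pi)))) = (fun x =>
  - cIm (f (log_polar z x 0)))); last first.
  by apply/funext => x; rewrite per.
rewrite [X in _ + X = 0]subrr addr0 => H; apply/esym/subr0_eq;
  apply: H => x y /andP[/andP[_ xs] _].
have xrho : expR x < rho.
  by apply: le_lt_trans srho; rewrite ler_expR -[leRHS](subrK (2 * pi)).
by have [B /cdifferential_divergence_free] := F_cdifferential y xrho.
Qed.

Let M_iter s n : expR s < rho -> M (s - 2 * pi *+ n) = M s.
Proof.
move=> srho; elim: n => [|n ih]; first by rewrite subr0.
have e : s - 2 * pi *+ n.+1 = s - 2 * pi *+ n - 2 * pi by rewrite mulrSr opprD addrA.
have n0 : 0 <= 2 * pi *+ n :> R by apply: mulrn_wge0; exact: ltW.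
have sn : expR (s - 2 * pi *+ n) < rho.
  by apply: le_lt_trans srho; rewrite ler_expR lerBlDr lerDl.
by rewrite e (M_periodic sn).
Qed.

(** In the coordinates [log_polar z] a circle is a vertical segment of length
[2 pi], and the field [(Re f, - Im f)] is divergence free and periodic.  The
fluxes through the horizontal sides of a square of side [2 pi] cancel, so the
mean over a circle is unchanged when the logarithm of the radius decreases by
[2 pi]; it tends to [Re (f z)] as the circle shrinks. *)
Theorem mean_value r : 0 < r < rho ->
  itv_int 0 (2 * pi) (fun t => cRe (f (circle z r t))) = 2 * pi * cRe (f z).
Proof.
move=> /andP[r0 rrho].
have -> : itv_int 0 (2 * pi) (fun t => cRe (f (circle z r t))) = M (ln r).
  by rewrite /M /log_polar lnK.
apply/eqP; rewrite -subr_eq0 -normr_le0; apply/ler_addgt0Pl => e e0; rewrite addr0.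
have /cderivable_continuous/cvgrPdist_le : derivable f z 1.
  by apply: hf; rewrite subrr cmod0 (lt_trans r0).
have e'0 : 0 < e / (2 * pi) by rewrite divr_gt0.
move=> /(_ (e / (2 * pi))%:C); rewrite ltcR => /(_ e'0)/nbhs_cmodP[d d0 H].
have [n nP] : exists n, ln r - 2 * pi *+ n < ln d.
  exists (Num.truncn ((ln r - ln d) / (2 * pi))).+1.
  by rewrite ltrBlDr -ltrBlDl -mulr_natr mulrC -ltr_pdivrMr// truncnS_gt.
rewrite -(@M_iter _ n) ?lnK// /M.
have smalld : expR (ln r - 2 * pi *+ n) < d by rewrite -[ltRHS]lnK// ltr_expR.
have := @itv_int_dist R 0 (2 * pi) (fun t => cRe (f (log_polar z (ln r - 2 * pi *+ n) t)))
  (cRe (f z)) (e / (2 * pi)).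
rewrite subr0 divfK ?gt_eqF// [_ * (2 * pi)]mulrC; apply; first exact: ltW.
  move=> t _; apply: cF; apply: le_lt_trans rrho.
  by rewrite -[leRHS]lnK// ler_expR gerDl oppr_le0 mulrn_wge0// ltW.
move=> t _.
have /H : normc (log_polar z (ln r - 2 * pi *+ n) t - z) < d.
  by rewrite -[log_polar _ _ _]/(circle z (expR _) t) cmod_circle// expR_ge0.
rewrite normr_cmodE lecR distrC; apply: le_trans.
by rewrite -ReB; exact: normRe_le.
Qed.
End fixed.
End MeanValue.

(** * Maximum principles *)

Section MaxPrinciple.
Context {R : realType}.
Local Notation C := (Cplx R).
Implicit Types (W : set C) (z w a xi : C) (f g : C -> C).

(** Integrals are differences of suprema over simple functions, which makes them
monotone for arbitrary functions; subharmonic functions can be handled in this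
way before anything is known about their measurability. *)
Lemma le_integral_nomeasure d (T : measurableType d) (mu : {measure set T -> \bar R})
    (D : set T) (f g : T -> \bar R) : (forall x, D x -> (f x <= g x)%E) ->
  (\int[mu]_(x in D) f x <= \int[mu]_(x in D) g x)%E.
Proof.
move=> fg; have fg' x : ((f \_ D) x <= (g \_ D) x)%E.
  by rewrite /patch; case: ifPn => // /[!inE] /fg.
rewrite /integral; apply: leeB; apply: ereal_sup_le => _ [h hle <-] /=;
  exists h => // x; apply: le_trans (hle x) _.
- by apply: (@funepos_le _ _ setT) => [y _|]; [exact: fg'|rewrite inE].
- by rewrite -!funeposN; apply: (@funepos_le _ _ setT) => [y _|]; [rewrite leeN2|rewrite inE].
Qed.

Lemma continuous_cmodP (f : C -> R) z : {for z, continuous f} <->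
  forall e : R, 0 < e -> exists2 r : R, 0 < r &
    forall w, normc (w - z) < r -> `|f w - f z| <= e.
Proof.
split=> [/cvgrPdist_le H e e0|H].
  by have /nbhs_cmodP[r r0 K] := H _ e0; exists r => // w /K; rewrite distrC.
apply: (proj2 (@cvgrPdist_le _ _ _ (nbhs z) _ f (f z))) => e /H[r r0 K].
by apply/nbhs_cmodP; exists r => // w /K; rewrite distrC.
Qed.

Lemma cmod_lipschitz z w : `|normc z - normc w| <= normc (z - w).
Proof.
have := cmodD (z - w) w; have := cmodD (w - z) z; rewrite !subrK [normc (w - z)]cmod_distC => a b.
by rewrite ler_norml; apply/andP; split; lra.
Qed.

Lemma continuous_cmod : continuous (fun z : C => normc z).
Proof.
move=> z; apply/continuous_cmodP => e e0; exists e => // w wz.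
exact: le_trans (cmod_lipschitz _ _) (ltW wz).
Qed.

Lemma continuous_Re : continuous (cRe : C -> R).
Proof.
move=> z; apply/continuous_cmodP => e e0; exists e => // w wz.
by rewrite -ReB (le_trans (normRe_le _))// ltW.
Qed.

Lemma continuous_Im : continuous (cIm : C -> R).
Proof.
move=> z; apply/continuous_cmodP => e e0; exists e => // w wz.
by rewrite -ImB (le_trans (normIm_le _))// ltW.
Qed.

Lemma continuous_Complex : continuous (fun p : R * R => (p.1 +i* p.2 : C)).
Proof.
move=> [x y] A /nbhs_cmodP[r r0 H]; apply/nbhs_ballP; exists (r / 2);
  first by rewrite /= divr_gt0.
move=> [x' y'] [/= xx yy]; apply: H; apply: le_lt_trans (cmod_le_ReIm _) _ => /=.
by rewrite [r]splitr; apply: ltrD; rewrite distrC.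
Qed.

Lemma compact_cmod_le (M : R) : compact [set z : C | normc z <= M].
Proof.
have K : compact ((fun p : R * R => (p.1 +i* p.2 : C)) @` (`[- M, M] `*` `[- M, M])).
  apply: continuous_compact; last by apply: compact_setX; exact: segment_compact.
  by apply: continuous_subspaceT => p; exact: continuous_Complex.
apply: subclosed_compact K _.
  by apply: (@closed_comp _ _ (fun z : C => normc z) [set x | x <= M]); [move=> z _;
    exact: continuous_cmod|exact: closed_le].
move=> [x y] /= zM; exists (x, y) => //=; split; rewrite /= in_itv /= -ler_norml.
  exact: le_trans (normRe_le (x +i* y)) zM.
exact: le_trans (normIm_le (x +i* y)) zM.
Qed.

Lemma compact_closed_bounded (A : set C) (M : R) : closed A ->
  (forall z, A z -> normc z <= M) -> compact A.
Proof. by move=> cA AM; apply: subclosed_compact (@compact_cmod_le M) AM. Qed.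

(** If no point realised the maximum, each [x] would have a [y] with [v x < v y],
and by semicontinuity so would the points near [x].  Along the filter of the
superlevel sets of [v], compactness makes this uniform in [x]; take [x = y]. *)
Lemma usc_attains_max (T : topologicalType) (A : set T) (v : T -> \bar R) :
  compact A -> A !=set0 ->
  (forall x y, A x -> A y -> (v x < v y)%E -> \forall x' \near x, (v x' < v y)%E) ->
  exists2 x, A x & forall y, A y -> (v y <= v x)%E.
Proof.
move=> /compact_near_coveringP cA [x0 Ax0] usc; apply: contrapT => nomax.
have up x : A x -> exists2 y, A y & (v x < v y)%E.
  move=> Ax; apply: contrapT => H; apply: nomax; exists x => // y Ay.
  by rewrite leNgt; apply/negP => vxy; apply: H; exists y.
(* the filter of superlevel sets of v in A *)
pose F : set_system T := [set S | exists2 x, A x & forall y, A y -> (v x <= v y)%E -> S y].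
have FF : Filter F.
  split; first by exists x0.
  - move=> P Q [x Ax Px] [y Ay Qy]; have [xy|/ltW yx] := leP (v x) (v y).
      by exists y => // z Az yz; split; [apply: Px => //; exact: le_trans yz|exact: Qy].
    by exists x => // z Az xz; split; [exact: Px|apply: Qy => //; exact: le_trans xz].
  - by move=> P Q PQ [x Ax Px]; exists x => // y Ay xy; apply: PQ; exact: Px.
have [x Ax /(_ x Ax (lexx _))/(_ x Ax)] : \forall y \near F, A `<=` (fun x => v x < v y)%E.
  apply: cA => x Ax; have [y Ay xy] := up x Ax.
  exists ([set x' | v x' < v y]%E, [set z | v y <= v z]%E) => /=.
    by split; [exact: usc|exists y].
  by move=> [x' z] /= [x'y yz]; exact: lt_le_trans yz.
by rewrite ltxx.
Qed.

Lemma circle_cosine (z : C) (r t : R) : 0 <= r ->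
  normc (circle z r t) ^+ 2 = normc z ^+ 2 + r ^+ 2 + 2 * cRe (z^* * (circle z r t - z)).
Proof.
move=> r0; have := cmod_circle z t r0; move: (circle z r t) => w H.
rewrite -H !cmod_sqr; case: z w {H} => a b [c d] /=; ring.
Qed.

(** The circle mean of [Re g] is [Re (g z)]. *)
Lemma circle_mean_bounds (u : C -> \bar R) g z (r rho : R) :
  (forall w, normc (w - z) < rho -> derivable g w 1) -> 0 < r < rho ->
  ((forall t, (u (circle z r t) <= (cRe (g (circle z r t)))%:E)%E) ->
    (circle_mean u z r <= (cRe (g z))%:E)%E) /\
  ((forall t, ((cRe (g (circle z r t)))%:E <= u (circle z r t))%E) ->
    ((cRe (g z))%:E <= circle_mean u z r)%E).
Proof.
move=> hg hr; have pi20 : 0 < 2 * pi :> R by rewrite mulr_gt0// pi_gt0.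
have mean : (cRe (g z))%:E = (((2 * pi)^-1)%:E * \int[lebesgue_measure]_(t in `[0%R, (2 * pi)%R])
    (cRe (g (circle z r t)))%:E)%E.
  have := mean_value hg hr; rewrite /itv_int => H.
  rewrite -(@fineK _ (\int[_]_(_ in _) _)%E); last first.
    by apply: integrable_fin_num => //;
      exact/itv_continuous_integrable/(Re_circle_continuous hg hr).
  by rewrite -EFinM -[fine _]/(Rintegral _ _ _) H mulKf// gt_eqF.
split=> H; rewrite mean; apply: lee_wpmul2l; rewrite ?lee_fin ?invr_ge0 ?(ltW pi20)//;
  by apply: le_integral_nomeasure => t _; exact: H.
Qed.

Lemma near_open W z : open W -> W z -> exists2 r : R, 0 < r & forall w, normc (w - z) < r -> W w.
Proof. by move=> oW Wz; apply/nbhs_cmodP; exact: open_nbhs_nbhs. Qed.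

Lemma open_setD1 W a : open W -> open (W `\ a).
Proof.
move=> oW; rewrite openE => z [Wz za].
apply: filterI; first exact: open_nbhs_nbhs.
apply/nbhs_cmodP; exists (normc (z - a)); first by rewrite cmod_gt0 subr_eq0; apply/eqP.
by move=> w wz wa; move: wz; rewrite wa cmod_distC ltxx.
Qed.

(** Suppose [u - Re g] is positive somewhere.  Adding [ep * normc z ^+ 2] with a
small [ep], one still has a function that attains its maximum, at an interior
point [zs].  On a small circle around [zs] of radius [r] the square of the
modulus is [r ^+ 2] plus a constant plus the real part of an affine function, so
[u] is at most the real part of a holomorphic function [G], whose value at [zs]
falls short of [u zs] by [ep * r ^+ 2].  This contradicts the submean property. *)
Theorem maximum_principle W (u : C -> \bar R) g (M : R) : open W ->
  (forall z, W z -> normc z <= M) -> holo_on W g -> subharmonic_on W u ->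
  (forall xi, closure W xi -> ~ W xi -> forall e : R, 0 < e ->
     \forall z \near xi, W z -> (u z <= (cRe (g z) + e)%:E)%E) ->
  forall z, W z -> (u z <= (cRe (g z))%:E)%E.
Proof.
move=> oW WM hg [uoo uusc umean] ubd z1 Wz1; rewrite leNgt; apply/negP => gu.
have [r1 ur1] : exists r1 : R, u z1 = r1%:E.
  by move: gu (uoo _ Wz1); case: (u z1) => [r| |] //; exists r.
move: gu; rewrite ur1 lte_fin -subr_gt0; set m0 := r1 - _ => m00.
have M0 : 0 <= M by exact: le_trans (cmod_ge0 z1) (WM _ Wz1).
have K0 : 0 < M ^+ 2 + 1 by rewrite ltr_wpDl// sqr_ge0.
(* so small that the added term stays below m0 / 2 on W *)
pose ep := m0 / 2 / (M ^+ 2 + 1).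
have ep0 : 0 < ep by rewrite !divr_gt0.
have epM z : W z -> ep * normc z ^+ 2 <= m0 / 2.
  move=> /WM zM; rewrite -[leRHS](@divfK _ (M ^+ 2 + 1)) ?gt_eqF// ler_wpM2l ?(ltW ep0)//.
  by rewrite (@le_trans _ _ (M ^+ 2)) ?lerDl// lerXn2r ?nnegrE ?cmod_ge0.
pose psi z : R := ep * normc z ^+ 2 - cRe (g z).
pose v z := (u z + (psi z)%:E)%E.
have psic z : W z -> {for z, continuous psi}.
  move=> Wz; apply: continuousB.
    by apply: continuousM; [exact: cst_continuous|apply: continuousM; exact: continuous_cmod].
  exact: (continuous_comp (cderivable_continuous (hg _ Wz)) (@continuous_Re _)).
have vusc z (b : R) : W z -> (v z < b%:E)%E -> \forall w \near z, (v w < b%:E)%E.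
  move=> Wz; rewrite /v -lteBrDr// -EFinB => ub.
  have [c uc cb] : exists2 c : R, (u z < c%:E)%E & c < b - psi z.
    move: ub (uoo _ Wz); case: (u z) => [r| |] //.
      rewrite lte_fin => rb _; exists ((r + (b - psi z)) / 2); rewrite ?lte_fin; lra.
    by move=> _ _; exists (b - psi z - 1); [exact: ltNyr|lra].
  have d0 : 0 < (b - psi z - c) / 2 by rewrite divr_gt0// subr_gt0.
  have /continuous_cmodP/(_ _ d0)[r r0 Hr] := psic _ Wz.
  have /nbhs_cmodP[r' r'0 Hr'] := uusc _ _ Wz uc.
  apply/nbhs_cmodP; exists (Num.min r r'); first by rewrite lt_min r0.
  move=> w; rewrite lt_min => /andP[/Hr wr /Hr' wr'].
  apply: (@lt_le_trans _ _ (c%:E + (psi w)%:E)%E); first by rewrite lteD2rE.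
  by rewrite -EFinD lee_fin; move: wr; rewrite ler_norml => /andP[]; lra.
have Wv1 : (m0%:E <= v z1)%E.
  by rewrite /v ur1 -EFinD lee_fin /m0 /psi; have := sqr_ge0 (normc z1); nra.
(* compact: it stays away from the boundary of W, where u - Re g is small *)
pose A := [set z | W z /\ (m0%:E <= v z)%E].
have cA : compact A.
  apply: (@compact_closed_bounded _ M); last by move=> z [/WM].
  move=> xi cxi; have [Wxi|nWxi] := pselect (W xi).
    split=> //; rewrite leNgt; apply/negP => /(vusc _ _ Wxi) /cxi[z [[_ +]]].
    by rewrite leNgt => /negP.
  have cW : closure W xi by apply: closureS cxi => z [].
  have e0 : 0 < m0 / 4 by rewrite divr_gt0.
  have := ubd _ cW nWxi _ e0 => /cxi[z [[Wz vz]]] /(_ Wz) uz.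
  exfalso; move: vz; rewrite leNgt => /negP; apply.
  apply: (@le_lt_trans _ _ ((cRe (g z) + m0 / 4)%:E + (psi z)%:E)%E); first by rewrite leeD2r.
  by rewrite -EFinD lte_fin /psi; have := epM _ Wz; lra.
have [zs [Wzs vs] vmax] : exists2 x, A x & forall y, A y -> (v y <= v x)%E.
  apply: usc_attains_max => //; first by exists z1.
  move=> x y [Wx _] [Wy vy]; have : (v y < +oo)%E by rewrite lte_add_pinfty ?ltry// uoo.
  move: vy; case: (v y) => [b| |] // _ _; exact: vusc.
have vmaxW z : W z -> (v z <= v zs)%E.
  move=> Wz; have [/vmax//|] := pselect (A z).
  by move=> nA; rewrite (le_trans _ vs)// leNgt; apply/negP => /ltW H; apply: nA.
have [us uE] : exists us : R, u zs = us%:E.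
  move: vs (uoo _ Wzs); rewrite /v; case: (u zs) => [r| |] //; by exists r.
have [r1' r1'0 Wr1] := near_open oW Wzs.
have [rho rho0 urho] := umean _ Wzs.
pose r := Num.min r1' rho / 2.
have mr0 : 0 < Num.min r1' rho by rewrite lt_min r1'0.
have r0 : 0 < r by rewrite divr_gt0.
have rmin : r < Num.min r1' rho by rewrite /r ltr_pdivrMr// mulr_natr mulr2n ltrDl.
have [rr1 rrho] : r < r1' /\ r < rho by move: rmin; rewrite lt_min => /andP.
pose K : R := us - cRe (g zs) - ep * r ^+ 2.
pose G w : C := g w + (K%:C - (2 * ep)%:C * (zs^* * (w - zs))).
have hG w : normc (w - zs) < r1' -> derivable G w 1.
  move=> /Wr1 Ww; apply: cderivableD; first exact: hg.
  apply: cderivableB; first exact: cderivable_cst.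
  apply: cderivableM; first exact: cderivable_cst.
  apply: cderivableM; first exact: cderivable_cst.
  by apply: cderivableB; [exact: cderivable_id|exact: cderivable_cst].
have ReG w : cRe (G w) = cRe (g w) + (K - 2 * ep * cRe (zs^* * (w - zs))).
  by rewrite /G ReD ReB [cRe (_%:C * _)]ReM /= mul0r subr0.
have rr : 0 < r < r1' by rewrite r0.
have [+ _] := circle_mean_bounds u hG rr.
have step t : (u (circle zs r t) <= (cRe (G (circle zs r t)))%:E)%E.
  have Wc : W (circle zs r t) by apply: Wr1; rewrite cmod_circle// ltW.
  have := vmaxW _ Wc; rewrite /v uE -EFinD -leeBrDr// -EFinB => /le_trans; apply.
  rewrite lee_fin ReG /K /psi circle_cosine ?(ltW r0)//; lra.
move=> /(_ step); have := urho r; rewrite r0 rrho => /(_ isT).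
move=> /le_trans H /H; rewrite uE lee_fin ReG subrr mulr0 /= mulr0 subr0 /K.
by have : 0 < ep * r ^+ 2 by [rewrite mulr_gt0// exprn_gt0]; lra.
Qed.

(** Multiply [f] by a constant of modulus at most 1 that makes [f z] nonnegative, and
use the mean value of the real part. *)
Lemma subharmonic_cmod W f : open W -> holo_on W f ->
  subharmonic_on W (fun z => (normc (f z))%:E).
Proof.
move=> oW hf; split=> [z _|z b Wz|z Wz]; first exact: ltry.
- rewrite lte_fin => fb.
  have cf : {for z, continuous (fun z => normc (f z))}.
    exact: (continuous_comp (cderivable_continuous (hf _ Wz)) (@continuous_cmod _)).
  have d0 : 0 < (b - normc (f z)) / 2 by rewrite divr_gt0// subr_gt0.
  have /continuous_cmodP/(_ _ d0)[r r0 Hr] := cf.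
  apply/nbhs_cmodP; exists r => // w /Hr; rewrite lte_fin ler_norml => /andP[]; lra.
- have [r r0 Wr] := near_open oW Wz; exists r => // s sr.
  (* the unimodular factor turning f z into its modulus *)
  pose k : C := if f z == 0 then 0 else (f z)^* / (normc (f z))%:C.
  have kf : k * f z = (normc (f z))%:C.
    rewrite /k; case: eqP => [->|/eqP fz0]; first by rewrite mul0r cmod0.
    rewrite mulrAC [_^* * _]mulrC -sqr_normc normr_cmodE expr2 mulfK//.
    by rewrite eq_complex /= eqxx andbT cmod_eq0.
  have k1 : normc k <= 1.
    rewrite /k; case: eqP => [_|/eqP fz0]; first by rewrite cmod0.
    by rewrite cmodM cmodV cmod_conj cmod_real ger0_norm ?cmod_ge0// divff// cmod_eq0.
  have hkf w : normc (w - z) < r -> derivable (fun w => k * f w : C) w 1.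
    by move=> /Wr Ww; apply: cderivableM; [exact: cderivable_cst|exact: hf].
  have [_] := circle_mean_bounds (fun z => (normc (f z))%:E) hkf sr.
  rewrite kf /=; apply=> t; rewrite lee_fin (le_trans (ler_norm _))// (le_trans (normRe_le _))//.
  by rewrite cmodM ler_piMl ?cmod_ge0.
Qed.

Theorem maximum_modulus W f (M : R) : open W -> (forall z, W z -> normc z <= M) ->
  holo_on W f ->
  (forall xi, closure W xi -> ~ W xi -> forall e : R, 0 < e ->
     \forall z \near xi, W z -> normc (f z) <= 1 + e) ->
  forall z, W z -> normc (f z) <= 1.
Proof.
move=> oW WM hf bd z Wz.
have Re1 : cRe (1 : C) = 1 by [].
have h1 : holo_on W (fun=> 1 : C) by move=> w _; exact: cderivable_cst.
have bd' xi : closure W xi -> ~ W xi -> forall e : R, 0 < e ->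
    \forall z \near xi, W z -> ((normc (f z))%:E <= (cRe (1 : C) + e)%:E)%E.
  by rewrite Re1 => cxi nxi e e0; have := bd _ cxi nxi _ e0; apply: filterS => w + Ww;
    rewrite lee_fin; apply.
have := maximum_principle oW WM h1 (subharmonic_cmod oW hf) bd' Wz.
by rewrite Re1 lee_fin.
Qed.

Lemma le1_of_pow_bounded (x k : R) : (forall n, x ^+ n <= k) -> x <= 1.
Proof.
move=> H; rewrite leNgt; apply/negP => x1.
have B n : 1 + (x - 1) *+ n <= x ^+ n.
  elim: n => [|n ih]; first by rewrite mulr0n addr0 expr0.
  rewrite exprS mulrS; have : 0 <= (x - 1) *+ n by rewrite mulrn_wge0// subr_ge0 ltW.
  by nra.
have := le_trans (B (Num.truncn (k / (x - 1))).+1) (H _).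
have := truncnS_gt (k / (x - 1)); rewrite ltr_pdivrMr ?subr_gt0// mulr_natl; lra.
Qed.

(** The function [f ^ n * (z - a)] tends to 0 at the puncture, near which [f] is
bounded, so the maximum modulus principle applies to it; taking [n]-th roots and letting [n] grow removes
the factor [z - a].  The boundary condition is first scaled by [1 + e]. *)
Theorem maximum_modulus_punctured W a f (M K : R) : open W ->
  (forall z, W z -> normc z <= M) -> W a ->
  (forall z, W z -> z <> a -> derivable f z 1) ->
  (\forall z \near a, z <> a -> normc (f z) <= K) ->
  (forall xi, closure W xi -> ~ W xi -> forall e : R, 0 < e ->
     \forall z \near xi, W z -> normc (f z) <= 1 + e) ->
  forall z, W z -> z <> a -> normc (f z) <= 1.
Proof.
move=> oW WM Wa hf fK bd z Wz za; apply/ler_addgt0Pl => e e0; rewrite addrC.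
(* bounds the factor z - a on W *)
pose d := 2 * M + 1.
have M0 : 0 <= M by exact: le_trans (cmod_ge0 a) (WM _ Wa).
have d0 : 0 < d by rewrite ltr_wpDl// mulr_ge0.
have K0 : 0 <= `|K| by [].
have e10 : 0 < 1 + e by rewrite ltr_wpDr// ltW.
rewrite -[leRHS]mul1r -ler_pdivrMr//.
have za0 : 0 < normc (z - a) by rewrite cmod_gt0 subr_eq0; apply/eqP.
apply: (@le1_of_pow_bounded _ (d / normc (z - a))) => n.
rewrite ler_pdivlMr// -[leRHS]mul1r -ler_pdivrMr//.
pose F w : C := (f w / (1 + e)%:C) ^+ n * (w - a) / d%:C.
have nF w : normc (F w) = (normc (f w) / (1 + e)) ^+ n * normc (w - a) / d.
  by rewrite /F !cmodM cmodX !cmodM !cmodV !cmod_real !gtr0_norm.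
rewrite -nF; apply: (@maximum_modulus (W `\ a) F M); last by split.
- exact: open_setD1.
- by move=> w [/WM].
- move=> w [Ww wa]; have dq : derivable (fun w => f w / (1 + e)%:C : C) w 1.
    by apply: cderivableM; [exact: hf|exact: cderivable_cst].
  apply: cderivableM; last exact: cderivable_cst.
  apply: cderivableM.
    by elim: (n) => [|m ih]; [exact: cderivable_cst|under eq_fun do rewrite exprS;
      exact: cderivableM].
  by apply: cderivableB; [exact: cderivable_id|exact: cderivable_cst].
- move=> xi cxi nxi e' e'0; have [->|xia] := eqVneq xi a.
    have [r r0 Hr] : exists2 r : R, 0 < r & (`|K| / (1 + e)) ^+ n * r / d <= 1.
      pose k := (`|K| / (1 + e)) ^+ n + 1.
      have k0 : 0 <= (`|K| / (1 + e)) ^+ n by rewrite exprn_ge0// divr_ge0// ltW.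
      exists (d / k); first by rewrite divr_gt0// ltr_wpDl.
      rewrite mulrA mulrAC mulfK ?gt_eqF// ler_pdivrMr ?ltr_wpDl// mul1r lerDl//.
    have /nbhs_cmodP[r' r'0 Hr'] := fK.
    apply/nbhs_cmodP; exists (Num.min r r'); first by rewrite lt_min r0.
    move=> w; rewrite lt_min => /andP[wr /Hr' wr'] [Ww /wr' {}wr'].
    rewrite (@le_trans _ _ 1)// ?lerDl ?(ltW e'0)// (le_trans _ Hr)// nF.
    rewrite ler_wpM2r ?invr_ge0 ?(ltW d0)// ler_pM ?cmod_ge0 ?(ltW wr)//.
      by rewrite exprn_ge0// divr_ge0 ?cmod_ge0// ltW.
    rewrite lerXn2r ?nnegrE ?divr_ge0 ?cmod_ge0 ?(ltW e10)//.
    by rewrite ler_wpM2r ?invr_ge0 ?(ltW e10)// (le_trans wr')// ler_norm.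
  have cW : closure W xi by apply: closureS cxi => w [].
  have nW : ~ W xi by move=> Wxi; apply: nxi; split=> //; exact/eqP.
  have /nbhs_cmodP[r r0 Hr] := bd _ cW nW _ e0.
  apply/nbhs_cmodP; exists r => // w /Hr wr [Ww _]; move: wr => /(_ Ww) wr.
  rewrite (@le_trans _ _ 1)// ?lerDl ?(ltW e'0)// nF ler_pdivrMr// mul1r.
  rewrite -[leRHS]mul1r ler_pM ?cmod_ge0//.
  + by rewrite exprn_ge0// divr_ge0 ?cmod_ge0// ltW.
  + by rewrite exprn_ile1 ?divr_ge0 ?cmod_ge0 ?(ltW e10)// ler_pdivrMr// mul1r.
  + rewrite (le_trans (cmodD _ _))// cmodN /d; have := WM _ Ww; have := WM _ Wa; lra.
Qed.
End MaxPrinciple.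

(** * The Schwarz lemma and the pseudo-hyperbolic distance *)

Section Disk.
Context {R : realType}.
Local Notation C := (Cplx R).
Local Notation D := (@disk R).
Implicit Types (z w a b c xi : C) (f g B : C -> C).

Lemma open_disk : open D.
Proof.
by apply: (@open_comp _ _ (fun z : C => normc z) [set x | x < 1]); [move=> z _;
  exact: continuous_cmod|exact: open_lt].
Qed.

Lemma disk_le1 z : D z -> normc z <= 1.
Proof. exact: ltW. Qed.

Lemma closure_disk xi : closure D xi -> ~ D xi -> normc xi = 1.
Proof.
move=> cxi /negP; rewrite -leNgt => xi1; apply/eqP; rewrite eq_le xi1 andbT.
have : closed [set z : C | normc z <= 1].
  by apply: (@closed_comp _ _ (fun z : C => normc z) [set x | x <= 1]); [move=> z _;
    exact: continuous_cmod|exact: closed_le].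
by apply; apply: closureS cxi; exact: disk_le1.
Qed.

(** The automorphism of the disk that sends [a] to 0. *)
Definition mobius a z : C := (z - a) / (1 - a^* * z).

Lemma mobius_identity a z :
  normc (1 - a^* * z) ^+ 2 - normc (z - a) ^+ 2 = (1 - normc a ^+ 2) * (1 - normc z ^+ 2).
Proof. rewrite !cmod_sqr; case: a z => [? ?] [? ?] /=; ring. Qed.

Lemma mobius_den_gt0 a z : D a -> normc z <= 1 -> 0 < normc (1 - a^* * z).
Proof.
move=> Da z1; rewrite cmod_gt0 subr_eq0; apply/eqP => H.
have : normc (a^* * z) = 1 by rewrite -H cmod1.
rewrite cmodM cmod_conj; have := cmod_ge0 a; have := cmod_ge0 z; rewrite /disk /= in Da; nra.
Qed.

Lemma mobius_den_neq0 a z : D a -> normc z <= 1 -> 1 - a^* * z != 0.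
Proof. by move=> Da z1; rewrite -cmod_gt0 mobius_den_gt0. Qed.

Lemma cmod_mobius a z : normc (mobius a z) = pseudo_hyp_dist a z.
Proof. by rewrite /pseudo_hyp_dist !cmodM !cmodV cmod_distC. Qed.

Lemma pseudoC z w : pseudo_hyp_dist z w = pseudo_hyp_dist w z.
Proof.
rewrite /pseudo_hyp_dist !cmodM !cmodV cmod_distC; congr (_ / _).
rewrite -[RHS]cmod_conj; congr normc.
by case: z w => [? ?] [? ?] /=; congr (_ +i* _); ring.
Qed.

Lemma pseudo_ge0 z w : 0 <= pseudo_hyp_dist z w.
Proof. exact: cmod_ge0. Qed.

Lemma pseudo_gt0 z w : D z -> D w -> z <> w -> 0 < pseudo_hyp_dist z w.
Proof.
move=> Dz Dw zw; rewrite /pseudo_hyp_dist cmodM cmodV divr_gt0 ?mobius_den_gt0 ?disk_le1//.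
by rewrite cmod_gt0 subr_eq0; apply/eqP.
Qed.

Lemma pseudo_compl z w : D z -> D w -> 1 - pseudo_hyp_dist z w ^+ 2 =
  (1 - normc z ^+ 2) * (1 - normc w ^+ 2) / normc (1 - z^* * w) ^+ 2.
Proof.
move=> Dz Dw; have d0 := mobius_den_gt0 Dz (disk_le1 Dw).
rewrite -mobius_identity /pseudo_hyp_dist cmodM cmodV (cmod_distC w) expr_div_n mulrBl divff//.
by rewrite expf_neq0// gt_eqF.
Qed.

Lemma one_sub_sqr_gt0 z : D z -> 0 < 1 - normc z ^+ 2.
Proof. by move=> Dz; rewrite subr_gt0 expr_lt1 ?cmod_ge0. Qed.

Lemma pseudo_compl_gt0 z w : D z -> D w -> 0 < 1 - pseudo_hyp_dist z w ^+ 2.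
Proof.
move=> Dz Dw; rewrite pseudo_compl//.
by apply: divr_gt0; [apply: mulr_gt0; exact: one_sub_sqr_gt0|apply: exprn_gt0;
  exact/mobius_den_gt0/disk_le1].
Qed.

Lemma pseudo_lt1 z w : D z -> D w -> pseudo_hyp_dist z w < 1.
Proof.
move=> Dz Dw; have := pseudo_compl_gt0 Dz Dw.
by rewrite subr_gt0 expr_lt1// pseudo_ge0.
Qed.

(** A weak triangle inequality: steps bounded away from 1 cannot reach 1 in a
bounded number of steps.  It comes from the identity
[(1 - |b|^2)(1 - a^* c) = (1 - a^* b)(1 - b^* c) - (a - b)^* (c - b)]. *)
Lemma pseudo_compl_triangle a b c : D a -> D b -> D c ->
  (1 - pseudo_hyp_dist a b ^+ 2) * (1 - pseudo_hyp_dist b c ^+ 2) / 4 <=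
  1 - pseudo_hyp_dist a c ^+ 2.
Proof.
move=> Da Db Dc; rewrite !pseudo_compl//.
have ab := mobius_den_gt0 Da (disk_le1 Db).
have bc := mobius_den_gt0 Db (disk_le1 Dc).
have ac := mobius_den_gt0 Da (disk_le1 Dc).
have A0 := one_sub_sqr_gt0 Da; have B0 := one_sub_sqr_gt0 Db; have C0 := one_sub_sqr_gt0 Dc.
have key : (1 - normc b ^+ 2) * normc (1 - a^* * c) <= 2 * (normc (1 - a^* * b) * normc (1 - b^* * c)).
  have e1 : (1 - normc b ^+ 2)%:C * (1 - a^* * c) =
      (1 - a^* * b) * (1 - b^* * c) - (a - b)^* * (c - b) :> C.
    have -> : (1 - normc b ^+ 2)%:C = 1 - b^* * b :> C.
      by rewrite cmod_sqr; case: (b) => ? ? /=; congr (_ +i* _); ring.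
    by case: a b c {Da Db Dc ab bc ac A0 B0 C0} => [? ?] [? ?] [? ?] /=; congr (_ +i* _); ring.
  have -> : (1 - normc b ^+ 2) * normc (1 - a^* * c) = normc ((1 - normc b ^+ 2)%:C * (1 - a^* * c)).
    by rewrite cmodM cmod_real gtr0_norm.
  rewrite e1 (le_trans (cmodD _ _))// cmodN mulr_natl mulr2n !cmodM cmod_conj lerD// ler_pM ?cmod_ge0//.
    rewrite -(ler_pXn2r (n:=2)) ?nnegrE ?cmod_ge0// -subr_ge0 cmod_distC mobius_identity.
    by rewrite ltW// mulr_gt0.
  rewrite -(ler_pXn2r (n:=2)) ?nnegrE ?cmod_ge0// -subr_ge0 mobius_identity.
  by rewrite ltW// mulr_gt0.
move: key ab bc ac A0 B0 C0.
set A := 1 - normc a ^+ 2; set B := 1 - normc b ^+ 2; set E := 1 - normc c ^+ 2.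
set x := normc _; set y := normc (1 - a^* * b); set u := normc _ => key y0 u0 x0 A0 B0 E0.
rewrite ler_pdivlMr ?exprn_gt0//.
have -> : A * B / y ^+ 2 * (B * E / u ^+ 2) / 4 * x ^+ 2 =
  A * E * ((B * x) / (2 * (y * u))) ^+ 2 by field; rewrite !gt_eqF.
rewrite -[leRHS]mulr1 ler_wpM2l ?(ltW (mulr_gt0 _ _))// expr_le1//.
  by rewrite ler_pdivrMr ?mul1r// !mulr_gt0.
by rewrite divr_ge0// ltW// !mulr_gt0.
Qed.

Lemma cderivable_mobius a z : D a -> normc z <= 1 -> derivable (mobius a) z 1.
Proof.
move=> Da z1; apply: cderivableM.
  by apply: cderivableB; [exact: cderivable_id|exact: cderivable_cst].
apply: cderivableV; first exact: mobius_den_neq0.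
apply: cderivableB; first exact: cderivable_cst.
by apply: cderivableM; [exact: cderivable_cst|exact: cderivable_id].
Qed.

Lemma cmod_mobius_circle a xi : D a -> normc xi = 1 -> normc (mobius a xi) = 1.
Proof.
move=> Da xi1; have d0 : 0 < normc (1 - a^* * xi) by rewrite mobius_den_gt0// xi1.
have e : normc (xi - a) = normc (1 - a^* * xi).
  apply/eqP; rewrite -(@eqrXn2 _ 2) ?cmod_ge0// eq_sym -subr_eq0 mobius_identity xi1.
  by rewrite expr1n subrr mulr0.
by rewrite /mobius cmodM cmodV e divff// gt_eqF.
Qed.

Lemma derivable_bound f a : derivable f a 1 -> exists K : R,
  \forall z \near a, normc (f z - f a) <= K * normc (z - a).
Proof.
move=> /cderivableP[A /(_ _ ltr01)[r r0 H]]; exists (1 + normc A).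
apply/nbhs_cmodP; exists r => // w /H wr.
have -> : f w - f a = (f w - f a - A * (w - a)) + A * (w - a) by rewrite subrK.
by rewrite (le_trans (cmodD _ _))// mulrDl lerD// cmodM.
Qed.

(** The quotient [B / mobius a] is bounded near [a] because [B] is differentiable
there, and [mobius a] has modulus 1 on the unit circle. *)
Theorem schwarz_at a B z : D a -> holo_on D B -> (forall z, D z -> normc (B z) <= 1) ->
  B a = 0 -> D z -> normc (B z) <= pseudo_hyp_dist a z.
Proof.
move=> Da hB B1 Ba Dz; have [->|/eqP za] := eqVneq z a; first by rewrite Ba cmod0 pseudo_ge0.
have mz w : D w -> w <> a -> 0 < normc (mobius a w).
  by move=> Dw wa; rewrite cmod_mobius pseudo_gt0// => /esym.
rewrite -cmod_mobius -[leRHS]mul1r -ler_pdivrMr ?mz// -cmodV -cmodM.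
have [K HK] := derivable_bound (hB a Da).
apply: (@maximum_modulus_punctured _ D a (fun w => B w / mobius a w) 1 (K * 2)) => //.
- exact: open_disk.
- exact: disk_le1.
- move=> w Dw wa; apply: cderivableM; first exact: hB.
  by apply: cderivableV; [rewrite -cmod_gt0 mz|apply: cderivable_mobius => //; exact: disk_le1].
- near=> w => wa.
  have Dw : D w by near: w; apply: open_nbhs_nbhs; split => //; exact: open_disk.
  have : normc (B w - B a) <= K * normc (w - a) by near: w.
  rewrite Ba subr0 => Bw; rewrite cmodM cmodV /mobius cmodM cmodV invfM invrK.
  have wa0 : 0 < normc (w - a) by rewrite cmod_gt0 subr_eq0; apply/eqP.
  rewrite mulrA; apply: ler_pM; rewrite ?mulr_ge0 ?invr_ge0 ?cmod_ge0//.
    by rewrite ler_pdivrMr.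
  rewrite (le_trans (cmodD _ _))// cmod1 cmodN cmodM cmod_conj [leRHS]mulr2n lerD//.
  by have := cmod_ge0 a; have := cmod_ge0 w; have := disk_le1 Dw; have := disk_le1 Da; nra.
- move=> xi cxi nxi e e0; have xi1 := closure_disk cxi nxi.
  have cm : {for xi, continuous (fun w => normc (mobius a w))}.
    apply: (@continuous_comp _ _ _ (mobius a) (fun w => normc w)); last exact: continuous_cmod.
    by apply: cderivable_continuous; apply: cderivable_mobius => //; rewrite xi1.
  have e10 : 0 < 1 + e by rewrite ltr_wpDr// ltW.
  have d0 : 0 < 1 - (1 + e)^-1 by rewrite subr_gt0 invf_lt1// ltrDl.
  have /continuous_cmodP/(_ _ d0)[r r0 H] := cm.
  apply/nbhs_cmodP;
    exists r => // w /H. rewrite (cmod_mobius_circle Da xi1) ler_norml => /andP[H1 _] Dw.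
  have m0 : (1 + e)^-1 <= normc (mobius a w) by lra.
  have m1 : 0 < normc (mobius a w) by apply: lt_le_trans m0; rewrite invr_gt0.
  rewrite cmodM cmodV ler_pdivrMr// (le_trans (B1 _ Dw))//.
  by rewrite -ler_pdivrMl// mulr1.
Unshelve. all: end_near. Qed.

Theorem schwarz_pick f z w : holo_on D f -> f @` D `<=` D -> D z -> D w ->
  pseudo_hyp_dist (f z) (f w) <= pseudo_hyp_dist z w.
Proof.
move=> hf fD Dz Dw; have fD' x : D x -> D (f x) by move=> Dx; apply: fD; exists x.
pose B x : C := mobius (f z) (f x).
have hB : holo_on D B.
  move=> x Dx; apply: (@cderivable_comp _ f (mobius (f z))); first exact: hf.
  by apply: cderivable_mobius; [exact: fD'|exact/disk_le1/fD'].
have B1 x : D x -> normc (B x) <= 1.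
  by move=> Dx; rewrite cmod_mobius ltW// pseudo_lt1//; exact: fD'.
have Bz : B z = 0 by rewrite /B /mobius subrr mul0r.
by have := schwarz_at Dz hB B1 Bz Dw; rewrite cmod_mobius.
Qed.

(** The quotient of [w - f z] by [w + (f z)^* ] is a map of the right half-plane to the
disk that vanishes at [f z]. *)
Theorem schwarz_pick_half_plane f z w : holo_on D f -> (forall x, D x -> 0 < cRe (f x)) ->
  D z -> D w -> normc (f w - f z) <= pseudo_hyp_dist z w * normc (f w + (f z)^*).
Proof.
move=> hf f0 Dz Dw.
have den x : D x -> 0 < normc (f x + (f z)^*).
  move=> Dx; apply: lt_le_trans (normRe_le _); rewrite ReD gtr0_norm;
    last by case: (f z) (f0 z Dz) => ? ? /= ?; rewrite addr_gt0// f0.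
  by case: (f z) (f0 z Dz) => ? ? /= ?; rewrite addr_gt0// f0.
rewrite -ler_pdivrMr ?den// -cmodV -cmodM.
pose B x : C := (f x - f z) / (f x + (f z)^*).
have hB : holo_on D B.
  move=> x Dx; apply: cderivableM.
    by apply: cderivableB; [exact: hf|exact: cderivable_cst].
  apply: cderivableV; first by rewrite -cmod_gt0 den.
  by apply: cderivableD; [exact: hf|exact: cderivable_cst].
have B1 x : D x -> normc (B x) <= 1.
  move=> Dx; rewrite cmodM cmodV ler_pdivrMr ?den// mul1r.
  rewrite -(ler_pXn2r (n:=2)) ?nnegrE ?cmod_ge0// !cmod_sqr.
  have := f0 x Dx; have := f0 z Dz; case: (f x) (f z) => [? ?] [? ?] /=; nra.
have Bz : B z = 0 by rewrite /B subrr mul0r.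
exact: (schwarz_at Dz hB B1 Bz Dw).
Qed.
End Disk.

(** * Univalent functions *)

Section Univalent.
Context {R : realType}.
Local Notation C := (Cplx R).
Local Notation D := (@disk R).
Implicit Types (z w a b c xi : C) (f g B : C -> C).

Lemma eps_is_derive (f : R -> R) (x l : R) :
  (forall e : R, 0 < e -> exists2 r : R, 0 < r & forall y, `|y - x| < r ->
    `|f y - f x - l * (y - x)| <= e * `|y - x|) -> is_derive x 1 f l.
Proof.
move=> H.
have K : h^-1 *: ((f \o shift x) (h *: 1) - f x) @[h --> 0^'] --> l.
  apply/cvgrPdist_le => e /H[r r0 Hr]; rewrite near_withinE; apply/nbhs_ballP.
  exists r => // y; rewrite /ball /= sub0r normrN => yr y0.
  have := Hr (y + x); rewrite addrK => /(_ yr); rewrite /GRing.scale /= mulr1.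
  have n0 : 0 < `|y| by rewrite normr_gt0.
  rewrite -ler_pdivrMr// -normfV -normrM -normrN; apply: le_trans.
  rewrite le_eqVlt; apply/orP; left; apply/eqP; congr `|_|.
  by field.
apply: DeriveDef; first by apply/cvg_ex; exists l.
exact: cvg_lim K.
Qed.

Definition cball a (r : R) : set C := [set z | normc (z - a) < r].

Lemma open_cball a r : open (cball a r).
Proof.
rewrite openE => z az; apply/nbhs_cmodP; exists (r - normc (z - a)); first by rewrite subr_gt0.
by move=> w wz; apply: le_lt_trans (cmod_triangle w a z) _; rewrite -ltrBrDr.
Qed.

Lemma cball_bounded a r z : cball a r z -> normc z <= normc a + r.
Proof.
move=> az; have := cmodD (z - a) a; rewrite subrK => /le_trans; apply.
by rewrite addrC lerD2l ltW.
Qed.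

Lemma closure_cball a r xi : closure (cball a r) xi -> ~ cball a r xi -> normc (xi - a) = r.
Proof.
move=> cxi /negP; rewrite -leNgt => xi1; apply/eqP; rewrite eq_le xi1 andbT leNgt.
apply/negP => rxi; have d0 : 0 < normc (xi - a) - r by rewrite subr_gt0.
have /cxi[w [aw wxi]] : nbhs xi (cball xi (normc (xi - a) - r)).
  by apply/nbhs_cmodP; exists (normc (xi - a) - r).
have := cmod_triangle xi a w; move: aw wxi; rewrite /cball /= (cmod_distC w xi) => ? ? ?; lra.
Qed.

Lemma near_le1 f xi (e : R) : {for xi, continuous f} -> normc (f xi) <= 1 -> 0 < e ->
  \forall z \near xi, normc (f z) <= 1 + e.
Proof.
move=> cf f1 e0.
have cn : {for xi, continuous (fun z => normc (f z))}.
  exact: (continuous_comp cf (@continuous_cmod _ _)).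
have /continuous_cmodP/(_ _ e0)[r r0 H] := cn.
by apply/nbhs_cmodP; exists r => // w /H; rewrite ler_norml => /andP[]; lra.
Qed.

Lemma compact_circle a (r : R) : compact [set z : C | normc (z - a) = r].
Proof.
apply: (@compact_closed_bounded _ _ (normc a + r)).
  apply: (@closed_comp _ _ (fun z : C => normc (z - a)) [set x | x = r]); last exact: closed_eq.
  move=> z _; apply/continuous_cmodP => e e0; exists e => // w wz.
  apply: le_trans (cmod_lipschitz _ _) _; rewrite opprB addrA subrK; exact: ltW.
by move=> z <-; have := cmodD (z - a) a; rewrite subrK addrC.
Qed.

Section univalent.
Context (h : C -> C) (hh : holo_on D h).
Context (hinj : forall z w, D z -> D w -> h z = h w -> z = w).

Lemma closed_ball_in a (e : R) : D a -> 0 < e -> exists2 r : R, 0 < r < e &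
  forall z, normc (z - a) <= r -> D z.
Proof.
move=> Da e0; have [r r0 H] := near_open (@open_disk R) Da.
have m0 : 0 < Num.min e r by rewrite lt_min e0.
have : Num.min e r / 2 < Num.min e r by rewrite ltr_pdivrMr// mulr_natr mulr2n ltrDl.
rewrite lt_min => /andP[h1 h2]; exists (Num.min e r / 2); first by rewrite h1 divr_gt0.
by move=> z zr; apply: H; exact: le_lt_trans zr h2.
Qed.

Lemma circle_min a (r : R) : 0 < r -> (forall z, normc (z - a) <= r -> D z) ->
  exists2 c : R, 0 < c & forall z, normc (z - a) = r -> c <= normc (h z - h a).
Proof.
move=> r0 H.
have ne : [set z : C | normc (z - a) = r] !=set0.
  by exists (circle a r 0); rewrite /= cmod_circle// ltW.
have [z /[!inE] /= zr zmin] : exists2 z, z \in [set z : C | normc (z - a) = r] &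
    forall w, w \in [set z : C | normc (z - a) = r] -> normc (h z - h a) <= normc (h w - h a).
  apply: (@compact_EVT_min _ _ (fun z => normc (h z - h a))) => //; first exact: compact_circle.
  apply: continuous_in_subspaceT => z /[!inE] /= zr.
  apply: (@continuous_comp _ _ _ (fun z => h z - h a : C) (fun z => normc z));
    last exact: continuous_cmod.
  by apply/cderivable_continuous/cderivableB; [apply/hh/H; rewrite zr|exact: cderivable_cst].
exists (normc (h z - h a)); last by move=> w wr; apply: zmin; rewrite inE.
have Dz : D z by apply: H; rewrite zr.
have Da : D a by apply: H; rewrite subrr cmod0 ltW.
rewrite cmod_gt0 subr_eq0; apply/eqP => /(hinj Dz Da) za.
by move: r0; rewrite -zr za subrr cmod0 ltxx.
Qed.

(** If [om] were an omitted value close to [h a], the function [1 / (h - om)] would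
be larger at [a] than on a circle around [a]. *)
Lemma open_mapping a (e : R) : D a -> 0 < e -> exists2 m : R, 0 < m &
  forall om, normc (om - h a) < m -> exists z, [/\ D z, normc (z - a) < e & h z = om].
Proof.
move=> Da e0; have [r /andP[r0 re] H] := closed_ball_in Da e0.
have [c c0 Hc] := circle_min r0 H.
exists (c / 3); first by rewrite divr_gt0.
move=> om omh; apply: contrapT => no.
have hom z : normc (z - a) <= r -> normc (z - a) < e -> h z - om != 0.
  move=> zr ze; rewrite subr_eq0; apply/eqP => hz; apply: no; exists z; split => //; exact: H.
pose f z : C := (2 * c / 3)%:C / (h z - om).
have hf z : normc (z - a) <= r -> derivable f z 1.
  move=> zr; apply: cderivableM; first exact: cderivable_cst.
  apply: cderivableV; first by apply: hom => //; exact: le_lt_trans re.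
  by apply: cderivableB; [apply/hh/H|exact: cderivable_cst].
have c30 : 0 < 2 * c / 3 by rewrite divr_gt0// mulr_gt0.
have fE z : normc (f z) = 2 * c / 3 / normc (h z - om).
  by rewrite /f cmodM cmodV cmod_real gtr0_norm.
have := @maximum_modulus R (cball a r) f (normc a + r) (@open_cball a r) (@cball_bounded a r).
move=> /(_ _ _ a) fa.
have : normc (f a) <= 1.
  apply: fa.
  - by move=> z /ltW; exact: hf.
  - move=> xi cxi nxi e1 e10; have xir := closure_cball cxi nxi.
    have xn : normc (f xi) <= 1.
      have : c <= normc (h xi - h a) by exact: Hc.
      have := cmod_triangle (h xi) (h a) om => b1 b2.
      have n0 : 0 < normc (h xi - om) by lra.
      by rewrite fE ler_pdivrMr// mul1r; lra.
    have dxi : derivable f xi 1 by apply: hf; rewrite xir.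
    have := near_le1 (cderivable_continuous dxi) xn e10.
    by apply: filterS => z.
  - by rewrite /cball /= subrr cmod0.
rewrite fE; have na : 0 < normc (h a - om).
  by rewrite cmod_gt0 hom// subrr cmod0// ltW.
by rewrite ler_pdivrMr// mul1r cmod_distC; lra.
Qed.

(** For a differentiable [h], this says that the derivative at [a] is not 0. *)
Definition expands_at a :=
  exists2 k : R, 0 < k & \forall z \near a, k * normc (z - a) <= normc (h z - h a).

Lemma flat_of_not_expands a : D a -> ~ expands_at a -> forall e : R, 0 < e ->
  exists2 r : R, 0 < r &
  forall z, normc (z - a) < r -> normc (h z - h a) <= e * normc (z - a).
Proof.
move=> Da nlow; have /cderivableP[A HA] := hh Da.
have [A0|A0] := eqVneq A 0.
  by move=> e /HA[r r0 H]; exists r => // z /H; rewrite A0 mul0r subr0.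
have nA : 0 < normc A by rewrite cmod_gt0.
exfalso; apply: nlow; exists (normc A / 2); first by rewrite divr_gt0.
have [r r0 H] := HA _ (divr_gt0 nA (ltr0n _ 2)).
apply/nbhs_cmodP; exists r => // z /H.
have := cmodD (A * (z - a) - (h z - h a)) (h z - h a).
rewrite subrK [normc (A * (z - a) - _)]cmod_distC cmodM; lra.
Qed.

(** Otherwise the derivative would vanish on a disk, and [h] would be constant
there by the mean value theorem along a segment. *)
Lemma exists_expanding_near a (d : R) : D a -> 0 < d ->
  exists2 z, normc (z - a) < d & D z /\ expands_at z.
Proof.
move=> Da d0; apply: contrapT => no.
have [r /andP[r0 rd] H] := closed_ball_in Da d0.
have flat z : normc (z - a) < r -> D z /\ ~ expands_at z.
  move=> zr; have Dz : D z by apply: H; exact: ltW.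
  by split=> // lz; apply: no; exists z => //; exact: lt_trans rd.
pose v : C := (r / 2)%:C.
have nv : normc v = r / 2 by rewrite cmod_real gtr0_norm// divr_gt0.
have vr : normc v < r by rewrite nv ltr_pdivrMr// mulr_natr mulr2n ltrDl.
have inball (t : R) : 0 <= t <= 1 -> normc (a + t%:C * v - a) < r.
  move=> /andP[t0 t1]; rewrite addrC addKr cmodM cmod_real ger0_norm//.
  by apply: le_lt_trans vr; rewrite ler_piMl// cmod_ge0.
have flat_eps (t e : R) : 0 <= t <= 1 -> 0 < e ->
  exists2 r' : R, 0 < r' & forall t', `|t' - t| < r' ->
    normc (h (a + t'%:C * v) - h (a + t%:C * v)) <= e * `|t' - t|.
  move=> t01 e0; have [Dz nl] := flat _ (inball _ t01).
  have v0 : 0 < normc v by rewrite nv divr_gt0.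
  have [r' r'0 Hr'] := flat_of_not_expands Dz nl (divr_gt0 e0 v0).
  exists (r' / normc v); first by rewrite divr_gt0.
  move=> t' tt'.
  have E : a + t'%:C * v - (a + t%:C * v) = (t' - t)%:C * v.
    by rewrite opprD addrACA subrr add0r -mulrBl -rmorphB.
  have -> : e * `|t' - t| = e / normc v * (`|t' - t| * normc v) by field; rewrite gt_eqF.
  by have := Hr' (a + t'%:C * v); rewrite E cmodM cmod_real -ltr_pdivlMr//; apply.
have cst (p : C -> R) : (forall z w, `|p z - p w| <= normc (z - w)) ->
  p (h (a + 1%:C * v)) = p (h (a + 0%:C * v)).
  move=> hp; pose f (t : R) := p (h (a + t%:C * v)).
  have df (t : R) : 0 <= t <= 1 -> is_derive t 1 f 0.
    move=> t01; apply: eps_is_derive => e e0; have [r' r'0 Hr'] := flat_eps _ _ t01 e0.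
    exists r' => // t' /Hr'; rewrite mul0r subr0; apply: le_trans; exact: hp.
  have [] := @MVT R f (fun=> 0) 0 1 ltr01.
  - by move=> t; rewrite in_itv /= => /andP[/ltW t0 /ltW t1]; apply: df; rewrite t0 t1.
  - apply: derivable_within_continuous => t; rewrite in_itv /= => t01.
    by have [] := df t t01.
  - by move=> c _ /eqP; rewrite mul0r subr_eq0 => /eqP.
have Dav : D (a + 1%:C * v) by apply: H; rewrite ltW// inball// ler01 lexx.
have Da0 : D (a + 0%:C * v) by apply: H; rewrite ltW// inball// ler01 lexx.
have : a + 1%:C * v = a + 0%:C * v.
  apply: hinj => //; apply/eqP; rewrite eq_complex; apply/andP; split; apply/eqP.
    by apply: (cst cRe) => z w; rewrite -ReB; exact: normRe_le.
  by apply: (cst cIm) => z w; rewrite -ImB; exact: normIm_le.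
move=> /addrI; rewrite mul0r mul1r => v0; move: nv; rewrite v0 cmod0.
by move=> /esym/eqP; rewrite gt_eqF// divr_gt0.
Qed.

(** Suppose the derivative vanishes at [a], and choose [z1] close to [a] where it
does not.  The function [(z - z1) / (h z - h z1)] is bounded near [z1], by this
choice, and holomorphic elsewhere; on a fixed circle around [a] it is bounded
independently of [z1]; hence so is its value at [a], that is, the quotient
[|h z1 - h a| / |z1 - a|] is bounded below.  It tends to 0 as [z1] tends to
[a]. *)
Theorem univalent_expands a : D a -> expands_at a.
Proof.
move=> Da; apply: contrapT => nl.
have [r /andP[r0 _] H] := closed_ball_in Da ltr01.
have [c c0 Hc] := circle_min r0 H.
(* the scaling that makes f below at most 1 on the circle of radius r *)
pose ka := (c / 2) / (2 * r).
have ka0 : 0 < ka by rewrite !divr_gt0// mulr_gt0.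
have [d d0 Hd] := flat_of_not_expands Da nl (divr_gt0 ka0 (ltr0n _ 2)).
pose d' := Num.min (Num.min d r) (c / 2 / ka).
have d'0 : 0 < d' by rewrite !lt_min d0 r0 /=; do 2 (apply: divr_gt0 => //).
have [z1 z1d [Dz1 lz1]] := exists_expanding_near Da d'0.
move: z1d; rewrite !lt_min => /andP[/andP[/Hd flat z1r] z1c].
have z1a : a <> z1 by move=> az; apply: nl; rewrite az.
have na : 0 < normc (z1 - a) by rewrite cmod_gt0 subr_eq0; apply/eqP => /esym/z1a.
pose f z : C := ka%:C * ((z - z1) / (h z - h z1)).
have hz z : normc (z - a) <= r -> z <> z1 -> h z - h z1 != 0.
  by move=> /H Dz zz1; rewrite subr_eq0; apply/eqP => /hinj e; apply: zz1; exact: e.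
have hf z : normc (z - a) <= r -> z <> z1 -> derivable f z 1.
  move=> zr zz1; apply: cderivableM; first exact: cderivable_cst.
  apply: cderivableM; first by apply: cderivableB; [exact: cderivable_id|exact: cderivable_cst].
  apply: cderivableV; first exact: hz.
  by apply: cderivableB; [apply/hh/H|exact: cderivable_cst].
have fE z : normc (f z) = ka * (normc (z - z1) / normc (h z - h z1)).
  by rewrite /f !cmodM cmodV cmod_real gtr0_norm.
have [k k0 Hk] := lz1.
have fK : \forall z \near z1, z <> z1 -> normc (f z) <= ka * k^-1.
  apply: filterS Hk => z Hz zz1; rewrite fE ler_pM2l//.
  have n0 : 0 < normc (z - z1) by rewrite cmod_gt0 subr_eq0; apply/eqP.
  rewrite ler_pdivrMr; last by apply: lt_le_trans Hz; rewrite mulr_gt0.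
  by rewrite mulrC ler_pdivlMr// mulrC.
have flat' : normc (h z1 - h a) < c / 2.
  apply: le_lt_trans flat _; rewrite (@lt_trans _ _ (ka * normc (z1 - a)))//.
    by rewrite ltr_pM2r// ltr_pdivrMr// mulr_natr mulr2n ltrDl.
  by rewrite mulrC -ltr_pdivlMr.
have fa : normc (f a) <= 1.
  apply: (maximum_modulus_punctured (@open_cball a r) (@cball_bounded a r) z1r _ fK _ _ z1a).
  - by move=> z /ltW; exact: hf.
  - move=> xi cxi nxi e1 e10; have xir := closure_cball cxi nxi.
    have xz1 : xi <> z1 by move=> e; move: z1r; rewrite -e xir ltxx.
    have xn : normc (f xi) <= 1.
      have := Hc _ xir; have := cmod_triangle (h xi) (h a) (h z1) => b1 b2.
      have b3 : normc (xi - z1) <= 2 * r.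
        by have := cmod_triangle xi z1 a; rewrite (cmod_distC a); lra.
      have n0 : c / 2 <= normc (h xi - h z1) by lra.
      rewrite fE mulrA ler_pdivrMr ?mul1r; last by apply: lt_le_trans n0; rewrite divr_gt0.
      apply: le_trans n0; rewrite /ka -[leRHS](@divfK _ (2 * r));
        last by rewrite gt_eqF// mulr_gt0.
      by rewrite ler_wpM2l// divr_ge0 ?mulr_ge0 ?divr_ge0// ltW.
    have dxi : derivable f xi 1 by apply: hf => //; rewrite xir.
    have := near_le1 (cderivable_continuous dxi) xn e10.
    by apply: filterS => z.
  - by rewrite /cball /= subrr cmod0.
have ha0 : 0 < normc (h a - h z1) by rewrite cmod_gt0 hz// subrr cmod0 ltW.
move: fa; rewrite fE mulrA ler_pdivrMr// mul1r !(cmod_distC a) (cmod_distC (h a)).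
apply/negP; rewrite -ltNge; apply: le_lt_trans flat _.
by rewrite ltr_pM2r// ltr_pdivrMr// mulr_natr mulr2n ltrDl.
Qed.

(** The Schwarz lemma for the inverse of [h], read on the side of [h]: apply the
maximum modulus principle to [r * mobius a / (h - h a)] on the set where
[|h - h a| < r].  The puncture at [a] is harmless as [h] expands there.  At a
boundary point on the unit circle, [|h - h a|] tends to [r], because smaller
closed disks are compact in the image and [h] is open. *)
Theorem schwarz_inverse a b (r : R) : D a -> D b -> 0 < r ->
  (forall om, normc (om - h a) < r -> exists2 z, D z & h z = om) ->
  normc (h b - h a) < r -> pseudo_hyp_dist a b <= normc (h b - h a) / r.
Proof.
move=> Da Db r0 cover hbr; have [->|/eqP ba] := eqVneq b a.
  by rewrite /pseudo_hyp_dist !subrr mul0r cmod0 mul0r.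
pose W : set C := [set z | D z /\ normc (h z - h a) < r].
have oW : open W.
  rewrite openE => z [Dz hz]; apply: filterI; first by apply: open_nbhs_nbhs; split=> //;
    exact: open_disk.
  have cn : {for z, continuous h} := cderivable_continuous (hh Dz).
  exact: (cn (cball (h a) r) (open_nbhs_nbhs (conj (@open_cball (h a) r) hz))).
have hz z : D z -> z <> a -> h z - h a != 0.
  by move=> Dz za; rewrite subr_eq0; apply/eqP => /hinj e; apply: za; exact: e.
pose f z : C := r%:C * (mobius a z / (h z - h a)).
have fE z : normc (f z) = r * (pseudo_hyp_dist a z / normc (h z - h a)).
  by rewrite /f cmodM cmod_real cmodM cmodV cmod_mobius gtr0_norm.
have hf z : D z -> z <> a -> derivable f z 1.
  move=> Dz za; apply: cderivableM; first exact: cderivable_cst.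
  apply: cderivableM; first by apply: cderivable_mobius => //; exact: disk_le1.
  apply: cderivableV; first exact: hz.
  by apply: cderivableB; [exact: hh|exact: cderivable_cst].
have [k k0 Hk] := univalent_expands Da.
have a1 : 0 < 1 - normc a by rewrite subr_gt0.
have fK : \forall z \near a, z <> a -> normc (f z) <= r * ((1 - normc a)^-1 / k).
  near=> z => za.
  have Dz : D z by near: z; apply: open_nbhs_nbhs; split => //; exact: open_disk.
  have kz : k * normc (z - a) <= normc (h z - h a) by near: z.
  have n0 : 0 < normc (z - a) by rewrite cmod_gt0 subr_eq0; apply/eqP.
  have kn0 : 0 < k * normc (z - a) by rewrite mulr_gt0.
  rewrite fE ler_pM2l// -cmod_mobius /mobius cmodM cmodV.
  have den : 1 - normc a <= normc (1 - a^* * z).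
    have := cmodD (1 - a^* * z) (a^* * z); rewrite subrK cmod1 cmodM cmod_conj.
    have := cmod_ge0 a; have := cmod_ge0 z; have := disk_le1 Dz; nra.
  have den0 : 0 < normc (1 - a^* * z) by exact: lt_le_trans den.
  rewrite ler_pdivrMr; last exact: lt_le_trans kz.
  have -> : normc (z - a) / normc (1 - a^* * z) = (normc (1 - a^* * z))^-1 / k * (k * normc (z - a)).
    by field; rewrite !gt_eqF.
  apply: ler_pM => //; rewrite ?mulr_ge0 ?invr_ge0 ?(ltW k0) ?cmod_ge0//.
  by rewrite ler_pM2r ?invr_gt0// lef_pV2.
have Wa : W a by split=> //; rewrite subrr cmod0.
have bd xi : closure W xi -> ~ W xi -> forall e : R, 0 < e ->
    \forall z \near xi, W z -> normc (f z) <= 1 + e.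
  move=> cxi nxi e e0; have [Dxi|nDxi] := pselect (D xi).
    have hxi : r <= normc (h xi - h a) by rewrite leNgt; apply/negP => hr; apply: nxi.
    have xa : xi <> a by move=> E; apply: nxi; rewrite E.
    have xn : normc (f xi) <= 1.
      have h0 := lt_le_trans r0 hxi.
      rewrite fE mulrA ler_pdivrMr// mul1r; apply: le_trans hxi.
      by rewrite ler_piMr ?(ltW r0)// ltW// pseudo_lt1.
    have := near_le1 (cderivable_continuous (hf _ Dxi xa)) xn e0.
    by apply: filterS => z.
  have e10 : 0 < 1 + e by rewrite ltr_wpDr// ltW.
  pose r' := r / (1 + e).
  have r'0 : 0 < r' by rewrite divr_gt0.
  have r'r : r' < r by rewrite ltr_pdivrMr// mulrDr mulr1 ltrDl mulr_gt0.
  have cB : compact [set om : C | normc (om - h a) <= r'].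
    apply: (@compact_closed_bounded _ _ (normc (h a) + r')).
      apply: (@closed_comp _ _ (fun z : C => normc (z - h a)) [set x | x <= r']);
        last exact: closed_le.
      move=> z _; apply/continuous_cmodP => e1 e10'; exists e1 => // w wz.
      apply: le_trans (cmod_lipschitz _ _) _; rewrite opprB addrA subrK; exact: ltW.
    move=> z zr; have := cmodD (z - h a) (h a); rewrite subrK => /le_trans; apply.
    by rewrite addrC lerD2l.
  have : \forall z \near xi, [set om : C | normc (om - h a) <= r'] `<=` (fun om =>
    D z -> h z <> om).
    apply: (proj1 (compact_near_coveringP _) cB C (nbhs xi) (fun z om =>
      D z -> h z <> om) (nbhs_filter xi)) => om /= omr.
    have [z' Dz' hz'] := cover om (le_lt_trans omr r'r).
    have d0 : 0 < normc (xi - z') / 2.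
      by rewrite divr_gt0// cmod_gt0 subr_eq0; apply/eqP => E; apply: nDxi; rewrite E.
    have [m m0 Hm] := open_mapping Dz' d0.
    exists (cball om m, cball xi (normc (xi - z') / 2)).
      by split; apply: open_nbhs_nbhs; split; rewrite /cball /= ?subrr ?cmod0//;
        exact: open_cball.
    move=> [om' z] /= [om'm zxi] Dz hzom.
    have [|z'' [Dz'' z''z' hz'']] := Hm om'; first by rewrite hz'.
    have E : z = z'' by apply: hinj => //; rewrite hz''.
    have := cmod_triangle xi z' z; move: z''z' zxi; rewrite -E /cball /= (cmod_distC z xi); lra.
  apply: filterS => z Hz [Dz hzr].
  have r'z : r' < normc (h z - h a).
    by rewrite ltNge; apply/negP => hr; exact: (Hz _ hr Dz).
  have h0 := lt_trans r'0 r'z.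
  rewrite fE mulrA ler_pdivrMr//.
  have -> : r * pseudo_hyp_dist a z = (1 + e) * r' * pseudo_hyp_dist a z.
    by rewrite /r'; field; rewrite gt_eqF.
  rewrite -mulrA ler_pM2l// (le_trans _ (ltW r'z))//.
  by rewrite ler_piMr ?(ltW r'0)// ltW// pseudo_lt1.
have WM z : W z -> normc z <= 1 by move=> [/disk_le1].
have hfW z : W z -> z <> a -> derivable f z 1 by move=> [Dz _]; exact: hf.
have hb0 : 0 < normc (h b - h a) by rewrite cmod_gt0 hz.
have := maximum_modulus_punctured oW WM Wa hfW fK bd (conj Db hbr) ba.
by rewrite fE mulrA ler_pdivrMr// mul1r ler_pdivlMr// mulrC.
Unshelve. all: end_near. Qed.

End univalent.
End Univalent.

(** * Roots on the slit plane *)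

Section SquareRoot.
Context {R : realType}.
Local Notation C := (Cplx R).
Local Notation D := (@disk R).
Implicit Types (z w a b c xi p : C) (f g B : C -> C).

Lemma sqrt_right_half_plane z : ~ (exists2 s : R, 0 <= s & z = - s%:C) ->
  exists2 s : C, s ^+ 2 = z & 0 < cRe s.
Proof.
move=> nz; pose s : C := sqrtc z; have s2 : s ^+ 2 = z by exact: sqr_sqrtc.
have [s0|s0|s0] := ltgtP (cRe s) 0.
- by exists (- s); rewrite ?sqrrN//; case: (s) s0 => ? ? /=; rewrite oppr_gt0.
- by exists s.
- exfalso; apply: nz; exists (cIm s ^+ 2); first exact: sqr_ge0.
  rewrite -s2 expr2; case: (s) s0 => x y /= ->.
  by apply/eqP; rewrite eq_complex /=; apply/andP; split; apply/eqP; ring.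
Qed.

(** The root of positive real part is continuous, since
[|g w - g z| = |f w - f z| / |g w + g z|] with a denominator at least [Re (g z)],
and then differentiable by the same formula. *)
Lemma holo_sqrt f : holo_on D f ->
  (forall z, D z -> ~ (exists2 s : R, 0 <= s & f z = - s%:C)) ->
  exists2 g : C -> C, holo_on D g & forall z, D z -> g z ^+ 2 = f z /\ 0 < cRe (g z).
Proof.
move=> hf nf.
have [g gP] : exists g : C -> C, forall z, D z -> g z ^+ 2 = f z /\ 0 < cRe (g z).
  have H z : exists s : C, D z -> s ^+ 2 = f z /\ 0 < cRe s.
    have [Dz|nDz] := pselect (D z); last by exists 0.
    by have [s s2 s0] := sqrt_right_half_plane (nf _ Dz); exists s.
  by exists (fun z => projT1 (cid (H z))) => z Dz; exact: (projT2 (cid (H z))).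
exists g; last exact: gP.
move=> z Dz; have [gz2 gz0] := gP z Dz.
apply/cderivableP; have /cderivableP[A HA] := hf z Dz.
have gz : g z != 0 by rewrite -cmod_gt0 (lt_le_trans gz0)// (le_trans (ler_norm _))// normRe_le.
pose A' : C := A / (2 * g z); exists A' => e e0.
have [rD rD0 HD] := near_open (@open_disk R) Dz.
set k := cRe (g z) in gz0.
have e10 : 0 < e * k / 2 by rewrite divr_gt0// mulr_gt0.
have [r1 r10 H1] := HA _ e10.
have e20 : 0 < e * k / (2 * (normc A' + 1)) * k.
  by rewrite mulr_gt0// divr_gt0 ?mulr_gt0// ltr_wpDl// cmod_ge0.
have cf : {for z, continuous (fun w => normc (f w - f z))}.
  apply: (@continuous_comp _ _ _ (fun w => f w - f z : C) (fun w => normc w));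
    last exact: continuous_cmod.
  by apply/cderivable_continuous/cderivableB; [exact: hf|exact: cderivable_cst].
have /continuous_cmodP/(_ _ e20)[r2 r20 H2] := cf.
exists (Num.min rD (Num.min r1 r2)); first by rewrite !lt_min rD0 r10.
move=> w; rewrite !lt_min => /and3P[/HD Dw /H1 {}H1 /H2 {}H2].
have [gw2 gw0] := gP w Dw.
have sumk : k <= normc (g w + g z).
  by apply: le_trans (normRe_le _); rewrite ReD ger0_norm ?lerDr ?addr_ge0// ltW.
have sum0 : 0 < normc (g w + g z) by exact: lt_le_trans sumk.
have gd : normc (g w - g z) <= e * k / (2 * (normc A' + 1)).
  have : normc (f w - f z) = normc (g w - g z) * normc (g w + g z).
    by rewrite -cmodM -gw2 -gz2; congr normc; ring.
  move: H2; rewrite subrr cmod0 subr0 (ger0_norm (cmod_ge0 _)) => + E; rewrite E => H2.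
  rewrite -(ler_pM2r gz0); apply: le_trans H2; by rewrite ler_wpM2l// cmod_ge0.
rewrite -(ler_pM2r sum0) -cmodM.
have -> : (g w - g z - A' * (w - z)) * (g w + g z) =
    (f w - f z - A * (w - z)) - A' * (w - z) * (g w - g z).
  by rewrite -gw2 -gz2 /A'; field.
have step : normc (f w - f z - A * (w - z) - A' * (w - z) * (g w - g z)) <= e * normc (w - z) * k.
  rewrite (le_trans (cmodD _ _))// cmodN.
  have -> : e * normc (w - z) * k = e * k / 2 * normc (w - z) + e * k / 2 * normc (w - z) by field.
  rewrite lerD// [normc (A' * _ * _)]cmodM [normc (A' * _)]cmodM.
  have -> : e * k / 2 * normc (w - z) = (normc A' + 1) * normc (w - z) * (e * k / (2 * (normc A' + 1))).
    by field; rewrite gt_eqF// ltr_wpDl// cmod_ge0.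
  apply: ler_pM => //; rewrite ?mulr_ge0 ?cmod_ge0//.
  by apply: ler_wpM2r; rewrite ?cmod_ge0// lerDl.
by apply: le_trans step _; rewrite ler_wpM2l// mulr_ge0 ?cmod_ge0// ltW.
Qed.

(** Two square roots; the real part of the square of [q z] is positive, which puts
[q z] in the sector. *)
Lemma fourth_root f : holo_on D f ->
  (forall z, D z -> ~ (exists2 s : R, 0 <= s & f z = - s%:C)) ->
  exists2 q : C -> C, holo_on D q &
    forall z, D z -> [/\ q z ^+ 4 = f z, 0 < cRe (q z) & `|cIm (q z)| <= cRe (q z)].
Proof.
move=> hf nf; have [g hg gP] := holo_sqrt hf nf.
have [z Dz [s s0 gs]|q hq qP] := @holo_sqrt g hg.
  by have [_] := gP z Dz; rewrite gs /= oppr_gt0 ltNge s0.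
exists q; first exact: hq.
move=> z Dz; have [q2 q0] := qP z Dz; have [g2 g0] := gP z Dz; split; [|exact: q0|].
  by rewrite -g2 -q2 -exprM.
rewrite -(ler_pXn2r (n:=2)) ?nnegrE ?(ltW q0)// real_normK ?num_real// ltW// -subr_gt0.
by move: g0; rewrite -q2 expr2; case: (q z) => x y /=; rewrite !expr2.
Qed.

Lemma quarter_sector z : 0 < cRe z -> `|cIm z| <= cRe z -> normc z <= 2 * cRe z.
Proof.
move=> x0 yx; apply: le_trans (cmod_le_ReIm _) _; rewrite (ger0_norm (ltW x0)) mulr_natl mulr2n.
by rewrite lerD2l.
Qed.
End SquareRoot.

(** * The trajectory through a backward orbit *)

Section Petal.
Context {R : realType}.
Local Notation C := (Cplx R).
Local Notation D := (@disk R).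
Context (phi : R -> C -> C) (h : C -> C) (gamma : R -> C).
Context (hphi : holo_semigroup phi) (hkoe : koenigs phi h)
  (hback : backward_orbit phi gamma).
Implicit Types (z w p : C) (s t a b : R).

Lemma koenigs_inj z w : D z -> D w -> h z = h w -> z = w.
Proof.
by case: hkoe => _ hinj _ _ Dz Dw; apply: hinj; rewrite inE.
Qed.

Lemma koenigs_holo : holo_on D h. Proof. by case: hkoe. Qed.

Lemma koenigs_flow t z : 0 <= t -> D z -> h (phi t z) = h z + t%:C.
Proof. by case: hkoe => _ _ _; apply. Qed.

Lemma phi_disk t z : 0 <= t -> D z -> D (phi t z).
Proof. by case: hphi => H _ _ _ t0 Dz; have [_] := H t t0; apply; exists z. Qed.

Lemma gamma_disk t : 0 <= t -> D (gamma t). Proof. by case: hback => _ H _; exact: H. Qed.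

(** Negative times follow the backward orbit, positive times the semigroup. *)
Definition trajectory s : C := if s <= 0 then gamma (- s) else phi s (gamma 0).

Lemma trajectory_disk s : D (trajectory s).
Proof.
rewrite /trajectory; case: (leP s 0) => [s0|/ltW s0]; first by apply: gamma_disk;
  rewrite oppr_ge0.
by apply: phi_disk => //; exact: gamma_disk.
Qed.

Lemma koenigs_trajectory s : h (trajectory s) = h (gamma 0) + s%:C.
Proof.
rewrite /trajectory; case: (leP s 0) => [s0|/ltW s0]; last by rewrite koenigs_flow//;
  exact: gamma_disk.
have s0' : 0 <= - s by rewrite oppr_ge0.
case: hback => _ _ /(_ (- s) (- s)); rewrite s0' lexx subrr => /(_ isT) <-.
rewrite koenigs_flow//; last exact: gamma_disk.
by rewrite -addrA -rmorphD addNr rmorph0 addr0.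
Qed.

Lemma trajectory_gamma t : 0 <= t -> gamma t = trajectory (- t).
Proof. by move=> t0; rewrite /trajectory oppr_le0 t0 opprK. Qed.

Lemma trajectory_inj s s' : trajectory s = trajectory s' -> s = s'.
Proof. by move=> /(congr1 h); rewrite !koenigs_trajectory => /addrI /complexI. Qed.

Lemma koenigs_trajectoryP s z : D z -> h z = h (gamma 0) + s%:C -> z = trajectory s.
Proof. by move=> Dz hz; apply: koenigs_inj => //;
  [exact: trajectory_disk|rewrite koenigs_trajectory]. Qed.

Lemma phi_trajectory t s : 0 <= t -> phi t (trajectory s) = trajectory (s + t).
Proof.
move=> t0; apply: koenigs_trajectoryP; first exact/phi_disk/trajectory_disk.
by rewrite koenigs_flow ?koenigs_trajectory//; [rewrite -addrA -rmorphD|exact: trajectory_disk].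
Qed.

(** For negative [t] the choice made in [flow] is unique by the injectivity of [h]. *)
Lemma flow_trajectory t s : flow phi t (trajectory s) = trajectory (s + t).
Proof.
rewrite /flow; case: (leP 0 t) => [t0|t0]; first exact: phi_trajectory.
have t0' : 0 <= - t by rewrite oppr_ge0 ltW.
case: xgetP => [w _ [Dw wE]|/(_ (trajectory (s + t)))].
  apply: koenigs_trajectoryP => //; have := koenigs_flow t0' Dw.
  rewrite wE koenigs_trajectory => E.
  have -> : h w = h w + (- t)%:C + t%:C by rewrite -addrA -rmorphD addNr rmorph0 addr0.
  by rewrite -E -addrA -rmorphD.
by case; split; [exact: trajectory_disk|rewrite phi_trajectory// addrK].
Qed.

Lemma petal_trajectory Delta z : Delta `<=` D ->
  h @` Delta = [set h (gamma 0) + t%:C | t in [set: R]] -> Delta z -> exists s, z = trajectory s.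
Proof.
move=> DD hD Dz; have : (h @` Delta) (h z) by exists z.
by rewrite hD => -[s _ hs]; exists s; apply: koenigs_trajectoryP; [exact: DD|].
Qed.

(** The inverse of [h] is continuous, as [h] is open. *)
Lemma trajectory_continuous s : {for s, continuous trajectory}.
Proof.
move=> A /nbhs_cmodP[r r0 HA].
have [m m0 Hm] := open_mapping koenigs_holo koenigs_inj (trajectory_disk s) r0.
apply/nbhs_ballP; exists m => // s' ss'.
have [|z [Dz zr hz]] := Hm (h (trajectory s')).
  rewrite !koenigs_trajectory opprD addrACA subrr add0r -rmorphB cmod_real distrC; exact: ss'.
by apply: HA; rewrite -(koenigs_trajectoryP Dz (etrans hz (koenigs_trajectory s'))).
Qed.

(** The Schwarz-Pick lemma for the map [phi t]. *)
Lemma pseudo_trajectory_mono s s' t : 0 <= t ->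
  pseudo_hyp_dist (trajectory s) (trajectory s') <= pseudo_hyp_dist (trajectory (s - t)) (trajectory (s' - t)).
Proof.
have e x : trajectory x = trajectory (x - t + t) by rewrite subrK.
move=> t0; rewrite (e s) (e s') -(phi_trajectory (s - t) t0) -(phi_trajectory (s' - t) t0).
case: hphi => H _ _ _; have [hp pD] := H t t0.
exact: (schwarz_pick hp pD (trajectory_disk _) (trajectory_disk _)).
Qed.

Lemma image_translate om s : 0 <= s -> (exists2 z, D z & h z = om) ->
  exists2 z, D z & h z = om + s%:C.
Proof.
by move=> s0 [z Dz <-]; exists (phi s z); [exact: phi_disk|rewrite koenigs_flow].
Qed.

Lemma regular_of_bounded (c : R) : 0 < c ->
  (forall t, 0 <= t -> c <= 1 - pseudo_hyp_dist (gamma t) (gamma (t + 1)) ^+ 2) ->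
  regular_orbit gamma.
Proof.
move=> c0 H; rewrite /regular_orbit /limf_esup.
apply: (@le_lt_trans _ _ (ln (4 / c) / 2)%:E); last exact: ltry.
pose f t := (hyp_dist (gamma t) (gamma (t + 1)))%:E.
apply: (@le_trans _ _ (ereal_sup [set f t | t in [set t | 0 <= t]])).
  by apply: ereal_inf_lbound; exists [set t | 0 <= t] => //; exact: nbhs_pinfty_ge.
apply: ge_ereal_sup => _ [t /= t0 <-]; rewrite lee_fin /hyp_dist /artanh.
have t1 : 0 <= t + 1 by rewrite addr_ge0.
have := H t t0; have := pseudo_lt1 (gamma_disk t0) (gamma_disk t1).
have := pseudo_ge0 (gamma t) (gamma (t + 1)); move: (pseudo_hyp_dist _ _) => x x0 x1 cx.
rewrite ler_pM2r ?invr_gt0//; rewrite ler_ln ?posrE; last 2 first.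
- by apply: divr_gt0; lra.
- by rewrite divr_gt0.
rewrite ler_pdivrMr ?subr_gt0// mulrAC ler_pdivlMr//; nra.
Qed.

(** If disks of radius [e] around [h (trajectory t)] were contained in the image of
[h] for arbitrarily negative [t], they would be for all [t].  The Schwarz lemma
for the inverse then bounds the steps of length [d = 1 / n < e / 2], and [n] such
steps make a unit of time. *)
Lemma trajectory_near_complement : ~ regular_orbit gamma -> forall e : R, 0 < e ->
  exists T : R, forall t, t <= T -> exists p,
    (forall z, D z -> h z <> p) /\ normc (h (trajectory t) - p) < e.
Proof.
move=> nreg e e0; apply: contrapT => no; apply: nreg.
have cover t om : normc (om - h (trajectory t)) < e -> exists2 z, D z & h z = om.
  move=> omt; apply: contrapT => nom; apply: no; exists t => t' t't.
  exists (om - (t - t')%:C); split.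
    move=> z Dz hz; apply: nom.
    have [||z' Dz' hz'] := @image_translate (om - (t - t')%:C) (t - t').
    - by rewrite subr_ge0.
    - by exists z.
    by exists z'; rewrite // hz' subrK.
  rewrite cmod_distC (_ : om - (t - t')%:C - h (trajectory t') = om - h (trajectory t))//.
  rewrite !koenigs_trajectory rmorphB /=; ring.
(* d < e / 2, so each step has pseudo-hyperbolic length at most 1 / 2 *)
pose n := (Num.truncn (2 / e)).+1; pose d : R := n%:R^-1.
have n0 : 0 < n%:R :> R by rewrite ltr0n.
have d0 : 0 < d by rewrite invr_gt0.
have de : d * 2 < e.
  by rewrite /d mulrC ltr_pdivrMr// mulrC -ltr_pdivrMr// truncnS_gt.
have step t : 3 / 4 <= 1 - pseudo_hyp_dist (trajectory t) (trajectory (t + d)) ^+ 2.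
  have hd : normc (h (trajectory (t + d)) - h (trajectory t)) = d.
    by rewrite !koenigs_trajectory opprD addrACA subrr add0r -rmorphB addrAC subrr add0r cmod_real gtr0_norm.
  have := schwarz_inverse koenigs_holo koenigs_inj (trajectory_disk t) (trajectory_disk (t + d)) e0 (cover t).
  rewrite hd => /(_ _); rewrite (lt_trans _ de) ?mulr_natr ?mulr2n ?ltrDl// => /(_ isT) H.
  have : pseudo_hyp_dist (trajectory t) (trajectory (t + d)) <= 1 / 2.
    by apply: le_trans H _; rewrite ler_pdivrMr// ltW//; lra.
  by have := pseudo_ge0 (trajectory t) (trajectory (t + d)); nra.
have chain k t : (3 / 16) ^+ k <= 1 - pseudo_hyp_dist (trajectory t) (trajectory (t + d *+ k)) ^+ 2.
  elim: k => [|k ih];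
    first by rewrite mulr0n addr0 expr0 /pseudo_hyp_dist subrr mul0r cmod0 expr0n subr0.
  have := pseudo_compl_triangle (trajectory_disk t) (trajectory_disk (t + d *+ k)) (trajectory_disk (t + d *+ k + d)).
  rewrite [d *+ k.+1]mulrSr addrA; apply: le_trans.
  have -> : (3 / 16) ^+ k.+1 = (3 / 16) ^+ k * (3 / 4) / 4 :> R by rewrite exprSr; field.
  by rewrite ler_pM2r// ler_pM// ?exprn_ge0 ?divr_ge0.
apply: (@regular_of_bounded ((3 / 16) ^+ n)); first by rewrite exprn_gt0// divr_gt0.
move=> t t0; have t1 : 0 <= t + 1 by rewrite addr_ge0.
rewrite pseudoC !trajectory_gamma// (_ : - t = - (t + 1) + d *+ n); first exact: chain.
by rewrite -mulr_natr mulVf ?gt_eqF//; ring.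
Qed.

(** If [h z - p] were a nonpositive real [- s], then [p = h (phi s z)] would be a
value of [h]. *)
Lemma slit_root p : (forall z, D z -> h z <> p) -> exists2 q : C -> C, holo_on D q &
  forall z, D z -> [/\ q z ^+ 4 = h z - p, 0 < cRe (q z) & `|cIm (q z)| <= cRe (q z)].
Proof.
move=> np; apply: fourth_root => [z Dz|z Dz [s s0 hs]].
  by apply: cderivableB; [exact: koenigs_holo|exact: cderivable_cst].
apply: (np (phi s z)); first exact: phi_disk.
by rewrite koenigs_flow// -[h z](subrK p) hs addrAC addNr add0r.
Qed.

(** With [x = |q|] at the first point and [y = |q|] at the second, the Schwarz-Pick
lemma gives a pseudo-hyperbolic distance at least [(y - x) / (y + x)].  If [p] is
close enough to [h] at the first point, then [x <= k * y] with [k] small. *)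
Lemma pseudo_trajectory_cvg1 : ~ regular_orbit gamma -> forall a b (e : R), a <> b -> 0 < e ->
  exists T : R, forall t, t <= T ->
    1 - e <= pseudo_hyp_dist (trajectory (a + t)) (trajectory (b + t)).
Proof.
move=> nreg a b e ab e0.
pose d := `|b - a|; have d0 : 0 < d by rewrite normr_gt0 subr_eq0 eq_sym; apply/eqP.
pose k := Num.min 1 (e / 2); have k0 : 0 < k by rewrite lt_min ltr01 divr_gt0.
have k1 : k <= 1 by rewrite ge_min lexx.
have ke : k * 2 <= e by rewrite -ler_pdivlMr// ge_min lexx orbT.
have k4 : 0 < k ^+ 4 by rewrite exprn_gt0.
have k41 : k ^+ 4 <= 1 by rewrite exprn_ile1// ltW.
(* closeness of p that forces x <= k * y below *)
pose eta := d * k ^+ 4 / 2; have eta0 : 0 < eta by rewrite divr_gt0// mulr_gt0.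
have [T HT] := trajectory_near_complement nreg eta0.
exists (T - a) => t tT; have [|p [np hp]] := HT (a + t); first by rewrite addrC -lerBrDr.
have [q hq qP] := slit_root np.
set za := trajectory (a + t); set zb := trajectory (b + t).
have Da : D za := trajectory_disk _; have Db : D zb := trajectory_disk _.
have [qa ra _] := qP _ Da; have [qb rb _] := qP _ Db.
have := schwarz_pick_half_plane hq (fun z Dz => let: And3 _ H _ := qP z Dz in H) Da Db.
set P := pseudo_hyp_dist _ _; set x := normc (q za); set y := normc (q zb).
have x0 : 0 <= x := cmod_ge0 _; have y0 : 0 <= y := cmod_ge0 _.
have P0 : 0 <= P := pseudo_ge0 _ _.
have xy : x <= k * y.
  rewrite -(@ler_pXn2r _ 4) ?nnegrE ?mulr_ge0 ?(ltW k0)// exprMn.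
  have x4 : x ^+ 4 < eta by rewrite /x -cmodX qa.
  have y4 : d - eta <= y ^+ 4.
    rewrite /y -cmodX qb lerBlDr.
    have -> : d = normc (h zb - h za).
      rewrite !koenigs_trajectory opprD addrACA subrr add0r -rmorphB cmod_real /d.
      by congr `|_|; ring.
    by apply: le_trans (cmod_triangle _ _ p) _; rewrite lerD2l (cmod_distC p) ltW.
  apply: le_trans (ltW x4) _; apply: le_trans (_ : k ^+ 4 * (d - eta) <= _); last first.
    by rewrite ler_wpM2l// ltW.
  rewrite /eta; move: (k ^+ 4) k4 k41 => u u0 u1.
  have : 0 <= u * d * (1 - u) by rewrite !mulr_ge0 ?(ltW u0) ?(ltW d0)// subr_ge0.
  by lra.
have low' : y - x <= normc (q zb - q za).
  by have := cmod_lipschitz (q zb) (q za); rewrite ler_norml => /andP[_].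
have up : normc (q zb + (q za)^*) <= x + y.
  by rewrite (le_trans (cmodD _ _))// cmod_conj addrC.
have y1 : 0 < y.
  by apply: lt_le_trans (normRe_le _); rewrite gtr0_norm.
move=> H; have : y - x <= P * (x + y).
  by apply: le_trans low' _; apply: le_trans H _; rewrite ler_wpM2l.
have P1 : P <= 1 by rewrite ltW// pseudo_lt1.
nra.
Qed.
End Petal.

(** * Limits *)

Section Convergence.
Context {R : realType}.
Local Notation C := (Cplx R).

Lemma near_ninfty_le (P : R -> Prop) (T : R) : (forall t, t <= T -> P t) ->
  \forall t \near -oo, P t.
Proof. by move=> H; apply: filterS (nbhs_ninfty_le (num_real T)). Qed.

Lemma cvge0_squeeze (T : Type) (f : T -> \bar R) (F : set_system T) : Filter F ->
  (forall e : R, 0 < e -> \forall t \near F, (0 <= f t <= e%:E)%E) -> f t @[t --> F] --> 0%E.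
Proof.
move=> FF H; apply/fine_cvgP; split.
  apply: filterS (H 1 ltr01) => t /andP[f0 f1].
  by rewrite ge0_fin_numE// (le_lt_trans f1)// ltry.
apply/cvgrPdist_le => e e0; apply: filterS (H e e0) => t /andP[f0 f1].
have fin : f t \is a fin_num by rewrite ge0_fin_numE// (le_lt_trans f1)// ltry.
by rewrite /= sub0r normrN ger0_norm ?fine_ge0// -lee_fin fineK.
Qed.

Lemma limf_esup_near (u : C -> \bar R) (U : set C) (xi : C) (b : R) :
  (limf_esup u (within U (nbhs xi)) <= b%:E)%E -> forall e : R, 0 < e ->
  \forall z \near xi, U z -> (u z <= (b + e)%:E)%E.
Proof.
move=> ub e e0.
have : (limf_esup u (within U (nbhs xi)) < (b + e)%:E)%E.
  by apply: le_lt_trans ub _; rewrite lte_fin ltrDl.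
rewrite /limf_esup => /ereal_inf_lt[_ [V HV <-]] uV.
have /nbhs_cmodP[r r0 HV'] : nbhs xi [set z | U z -> V z] by exact: HV.
apply/nbhs_cmodP; exists r => // z /HV' Vz Uz; apply: le_trans (ltW uV).
by apply: ereal_sup_ubound; exists z => //; exact: Vz.
Qed.
End Convergence.

(** * Density, distance, Green function and harmonic measure along the petal *)

Section Rates.
Context {R : realType}.
Local Notation C := (Cplx R).
Local Notation D := (@disk R).
Context (phi : R -> C -> C) (h : C -> C) (gamma : R -> C).
Context (hphi : holo_semigroup phi) (hkoe : koenigs phi h)
  (hback : backward_orbit phi gamma) (nreg : ~ regular_orbit gamma).
Local Notation L := (trajectory phi gamma).
Implicit Types (z p : C) (s t a b : R).
Let LD s : D (L s) := trajectory_disk hphi hback s.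

(** The modulus of [h] is bounded on each disk of radius [rho < 1] and tends to
infinity along the trajectory. *)
Lemma density_cvg a : hyp_density (L (a + t)) @[t --> -oo] --> +oo.
Proof.
apply/cvgryPge => A; pose B := Num.max 1 A.
have B1 : 1 <= B by rewrite le_max lexx.
have B0 : 0 < B by exact: lt_le_trans B1.
have AB : A <= B by rewrite le_max lexx orbT.
(* outside this radius the density exceeds B, as 1 - |z|^2 <= 2 (1 - |z|) *)
pose rho := 1 - (2 * B)^-1.
have B20 : 0 < 2 * B by rewrite mulr_gt0.
have iB : (2 * B)^-1 <= 1 / 2 by rewrite div1r lef_pV2 ?posrE// ler_peMr.
have iB0 : 0 < (2 * B)^-1 by rewrite invr_gt0.
have rho1 : rho < 1 by rewrite /rho; lra.
have rho0 : 0 < rho by rewrite /rho; lra.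
have [M HM] : exists M : R, forall z, normc z <= rho -> normc (h z) <= M.
  have [||| z _ zmax] := @compact_EVT_max _ R (fun z => normc (h z)) [set z : C | normc z <= rho].
  - by exists (0 : C); rewrite /mkset cmod0 ltW.
  - exact: compact_cmod_le.
  - apply: continuous_in_subspaceT => z /[!inE] /= zr.
    apply: (@continuous_comp _ _ _ h (fun z => normc z)); last exact: continuous_cmod.
    by apply/cderivable_continuous/(koenigs_holo hkoe); exact: le_lt_trans rho1.
  - by exists (normc (h z)) => w wr; apply: zmax; rewrite inE.
apply: (@near_ninfty_le _ _ (- (normc (h (gamma 0)) + M + 1) - a)) => t tT.
have hr : rho < normc (L (a + t)).
  rewrite ltNge; apply/negP => /HM; rewrite (koenigs_trajectory hkoe hback).
  have := cmodD (- h (gamma 0)) (h (gamma 0) + (a + t)%:C); rewrite addKr cmodN cmod_real.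
  by have := ler_norm (- (a + t)); rewrite normrN; lra.
have d0 := one_sub_sqr_gt0 (LD (a + t)).
apply: le_trans AB _; rewrite /hyp_density -[B]invrK lef_pV2 ?posrE ?invr_gt0//.
have -> : B^-1 = 2 * (2 * B)^-1 by field; rewrite gt_eqF.
have := disk_le1 (LD (a + t)); rewrite /rho in hr; nra.
Qed.

Lemma hyp_dist_cvg a b : a <> b -> hyp_dist (L (a + t)) (L (b + t)) @[t --> -oo] --> +oo.
Proof.
move=> ab; apply/cvgryPge => A; pose e : R := expR (- (2 * A)).
have e0 : 0 < e by exact: expR_gt0.
have [T HT] := pseudo_trajectory_cvg1 hphi hkoe hback nreg ab e0.
apply: (@near_ninfty_le _ _ T) => t /HT; rewrite /hyp_dist /artanh.
have := pseudo_lt1 (LD (a + t)) (LD (b + t)); have := pseudo_ge0 (L (a + t)) (L (b + t)).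
move: (pseudo_hyp_dist _ _) => x x0 x1 ex.
rewrite ler_pdivlMr// mulrC -[2 * A]expRK ler_ln ?posrE ?expR_gt0//; last first.
  by apply: divr_gt0; lra.
have -> : expR (2 * A) = e^-1 by rewrite /e expRN invrK.
have x1' : 0 < 1 - x by lra.
rewrite ler_pdivlMr// mulrC ler_pdivrMr//; nra.
Qed.

Lemma green_trajectory a b : a <> b ->
  green (L a) (L b) = (- ln (pseudo_hyp_dist (L a) (L b)))%:E.
Proof.
move=> ab; have lab : L a <> L b by move=> /(trajectory_inj hkoe hback).
have /eqP/negbTE E := lab; rewrite /green E; congr (_%:E).
by rewrite /pseudo_hyp_dist -invf_div cmodV lnV// posrE; exact: pseudo_gt0.
Qed.

Lemma green_trajectory_ge0 a b : (0 <= green (L a) (L b))%E.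
Proof.
have [->|/eqP ab] := eqVneq a b; first by rewrite /green eqxx.
by rewrite green_trajectory// lee_fin oppr_ge0 ln_le0// ltW// pseudo_lt1.
Qed.

Lemma green_trajectory_mono a b t : 0 <= t ->
  (green (L (a - t)) (L (b - t)) <= green (L a) (L b))%E.
Proof.
move=> t0; have [->|/eqP ab] := eqVneq a b; first by rewrite /green !eqxx.
have abt : a - t <> b - t by move=> /addIr.
rewrite !green_trajectory// lee_fin lerN2 ler_ln ?posrE ?pseudo_gt0//; last 2 first.
- by move/(trajectory_inj hkoe hback).
- by move/(trajectory_inj hkoe hback).
exact: (pseudo_trajectory_mono hphi hkoe hback _ _ t0).
Qed.

Lemma green_trajectory_small a b (e : R) : a <> b -> 0 < e -> exists T : R, forall t, t <= T ->
  (green (L (a + t)) (L (b + t)) <= e%:E)%E.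
Proof.
move=> ab e0; pose d : R := 1 - expR (- e).
have d0 : 0 < d by rewrite subr_gt0 expR_lt1 oppr_lt0.
have [T HT] := pseudo_trajectory_cvg1 hphi hkoe hback nreg ab d0.
exists T => t /HT.
have abt : a + t <> b + t by move=> /addIr.
rewrite green_trajectory// !lee_fin.
have := pseudo_lt1 (LD (a + t)) (LD (b + t)).
have : 0 < pseudo_hyp_dist (L (a + t)) (L (b + t)).
  by apply: pseudo_gt0 => // /(trajectory_inj hkoe hback).
move: (pseudo_hyp_dist _ _) => x x0 x1; rewrite /d subKr => ex.
by rewrite lerNl -[- e]expRK ler_ln ?posrE ?expR_gt0.
Qed.

Lemma green_cvg a b : a <> b -> green (L (a + t)) (L (b + t)) @[t --> -oo] --> 0%E.
Proof.
move=> ab; apply: cvge0_squeeze => e e0; have [T HT] := green_trajectory_small ab e0.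
by apply: (@near_ninfty_le _ _ T) => t /HT ->; rewrite green_trajectory_ge0.
Qed.

(** The time at which the trajectory passes through a point of the petal, extended
continuously to the disk. *)
Definition param z : R := cRe (h z - h (gamma 0)).

Lemma param_trajectory s : param (L s) = s.
Proof. by rewrite /param (koenigs_trajectory hkoe hback) addrAC subrr add0r. Qed.

Lemma param_continuous z : D z -> {for z, continuous param}.
Proof.
move=> Dz; apply: (@continuous_comp _ _ _ (fun z => h z - h (gamma 0) : C) cRe);
  last exact: continuous_Re.
by apply/cderivable_continuous/cderivableB; [exact: (koenigs_holo hkoe)|exact: cderivable_cst].
Qed.

Context (K : set C) (cK : compact K) (KL : forall z, K z -> exists s, z = L s).

Let KD z : K z -> D z. Proof. by move=> /KL[s ->]; exact: LD. Qed.

Lemma flow_imageE t : flow phi t @` K = (fun z => L (param z + t)) @` K.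
Proof.
apply/seteqP; split=> _ [z Kz <-]; exists z => //; have [s ->] := KL Kz;
  by rewrite (flow_trajectory hphi hkoe hback) param_trajectory.
Qed.

Lemma flow_imageP t e : (flow phi t @` K) e <-> exists2 s, K (L s) & e = L (s + t).
Proof.
split=> [[z Kz <-]|[s Ks ->]].
  by have [s zs] := KL Kz; exists s; rewrite -?zs// zs (flow_trajectory hphi hkoe hback).
by exists (L s) => //; rewrite (flow_trajectory hphi hkoe hback).
Qed.

Lemma flow_compact t : compact (flow phi t @` K).
Proof.
rewrite flow_imageE; apply: continuous_compact cK.
apply: continuous_in_subspaceT => z /[!inE] /KD Dz.
apply: (@continuous_comp _ _ _ (fun z => param z + t) L).
  by apply: continuousD; [exact: param_continuous|exact: cst_continuous].
exact: (trajectory_continuous hphi hkoe hback).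
Qed.

Lemma param_separated a : ~ K (L a) -> exists2 r : R, 0 < r & forall s, K (L s) -> r <= `|s - a|.
Proof.
move=> nKa; have clK : closed K by apply: compact_closed cK; exact: norm_hausdorff.
have /(trajectory_continuous hphi hkoe hback)/nbhs_ballP[r r0 H] : nbhs (L a) (~` K).
  by apply: open_nbhs_nbhs; split => //; exact: closed_openC.
exists r => // s Ks; rewrite leNgt; apply/negP => sa; apply: (H s) => //.
by rewrite /ball /= distrC.
Qed.

(** The zero function belongs to the Perron family. *)
Lemma harmonic_measure_ge0 z (E : set C) : (0 <= harmonic_measure z E)%E.
Proof.
apply: ereal_sup_ubound; exists (fun=> 0%E) => //; split.
  split=> [w _|w b _ b0|w _]; first exact: ltry.
    by apply/nbhs_cmodP; exists 1.
  by exists 1 => // r _; rewrite /circle_mean integral0 mule0.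
move=> xi _; apply: (@le_trans _ _ 0%E); last by rewrite lee_fin.
apply: (@le_trans _ _ (ereal_sup [set 0%E | x in [set: C]])); last first.
  by apply: ge_ereal_sup => _ [x _ <-].
by apply: ereal_inf_lbound; exists [set: C] => //; exact: filterT.
Qed.

(** A function [u] of the Perron family is at most 1 by the maximum principle.  On the
part [W] of the domain where [|h - p| < ka ^+ 4] it is at most [Re g] with
[g = (2 / ka) * q]: the compact set is at a positive distance from [W], on the
rest of the boundary inside the disk [|q| >= ka] gives [Re g >= 1], and on the
unit circle [u] has upper limit at most 0.  At the base point [|q|] is at most
[ka * e / 2]. *)
Lemma harmonic_measure_le a t (r ka e : R) p : 0 < e -> e <= 1 -> 0 < r -> 0 < ka ->
  (forall s, K (L s) -> r <= `|s - a|) -> 2 * ka ^+ 4 < r ->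
  (forall z, D z -> h z <> p) -> normc (h (L (a + t)) - p) < (ka * e / 2) ^+ 4 ->
  (harmonic_measure (L (a + t)) (flow phi t @` K) <= e%:E)%E.
Proof.
move=> e0 e1 r0 ka0 Hsep kar np hp; set E := flow phi t @` K.
have ka40 : 0 < ka ^+ 4 by rewrite exprn_gt0.
have hp' : normc (h (L (a + t)) - p) < ka ^+ 4.
  apply: lt_le_trans hp _; rewrite lerXn2r ?nnegrE ?divr_ge0 ?mulr_ge0 ?(ltW ka0) ?(ltW e0)//.
  by rewrite ler_pdivrMr// ler_wpM2l ?(ltW ka0)//; lra.
have clE : closed E by apply: compact_closed (@flow_compact t); exact: norm_hausdorff.
have ED z : E z -> D z by move=> /flow_imageP[s _ ->]; exact: LD.
have Esep z : E z -> ka ^+ 4 < normc (h z - p).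
  move=> /flow_imageP[s /Hsep sa ->].
  have := cmod_triangle (h (L (s + t))) (h (L (a + t))) p; rewrite (cmod_distC p).
  have -> : normc (h (L (s + t)) - h (L (a + t))) = `|s - a|.
    rewrite !(koenigs_trajectory hkoe hback) opprD addrACA subrr add0r -rmorphB cmod_real.
    by congr `|_|; ring.
  by lra.
have oU : open (D `\` E) by apply: openI; [exact: open_disk|exact: closed_openC].
have [q hq qP] := slit_root hphi hkoe np.
apply: ge_ereal_sup => _ [u [usub ubd] <-].
have ubd' xi : closure (D `\` E) xi -> ~ (D `\` E) xi ->
    (limf_esup u (within (D `\` E) (nbhs xi)) <= (\1_(boundary E) xi)%:E)%E.
  by move=> cxi nxi; apply: ubd; split => // /interior_subset.
have Re1 : cRe (1 : C) = 1 by [].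
have u1 z : (D `\` E) z -> (u z <= 1%:E)%E.
  have h1 : holo_on (D `\` E) (fun=> 1 : C) by move=> w _; exact: cderivable_cst.
  have UM z' : (D `\` E) z' -> normc z' <= 1 by move=> [/disk_le1].
  rewrite -Re1; apply: (maximum_principle oU UM h1 usub) => xi cxi nxi e' e'0.
  rewrite Re1; apply: limf_esup_near e'0; apply: le_trans (ubd' _ cxi nxi) _.
  by rewrite lee_fin indicE; case: (_ \in _).
pose W : set C := [set z | (D `\` E) z /\ normc (h z - p) < ka ^+ 4].
have hp_cont z : D z -> {for z, continuous (fun z => normc (h z - p))}.
  move=> Dz; apply: (@continuous_comp _ _ _ (fun z => h z - p : C) (fun z => normc z));
    last exact: continuous_cmod.
  by apply/cderivable_continuous/cderivableB; [exact: (koenigs_holo hkoe)|exact: cderivable_cst].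
have oW : open W.
  rewrite openE => z [Uz hz]; apply: filterI; first exact: open_nbhs_nbhs.
  have [Dz _] := Uz.
  have d0 : 0 < (ka ^+ 4 - normc (h z - p)) / 2 by rewrite divr_gt0// subr_gt0.
  have /continuous_cmodP/(_ _ d0)[r' r'0 H] := hp_cont z Dz.
  apply/nbhs_cmodP; exists r' => // w /H /=; rewrite ler_norml => /andP[_]; lra.
pose g z : C := (2 / ka)%:C * q z.
have Reg z : cRe (g z) = 2 / ka * cRe (q z) by rewrite /g ReM /= mul0r subr0.
have hgD z : D z -> derivable g z 1.
  by move=> Dz; apply: cderivableM; [exact: cderivable_cst|exact: hq].
have Reg0 z : D z -> 0 < cRe (g z).
  by move=> /qP[_ q0 _]; rewrite Reg mulr_gt0// divr_gt0.
have q4 z : D z -> normc (q z) ^+ 4 = normc (h z - p) by move=> /qP[<- _ _]; rewrite cmodX.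
have Reg1 z : D z -> ka ^+ 4 <= normc (h z - p) -> 1 <= cRe (g z).
  move=> Dz; rewrite -q4// ler_pXn2r ?nnegrE ?(ltW ka0) ?cmod_ge0// => kq.
  have [_ q0 qi] := qP z Dz; have := quarter_sector q0 qi => qs.
  by rewrite Reg mulrAC ler_pdivlMr// mul1r (le_trans kq).
have Wa : W (L (a + t)).
  split=> //; split=> //; move=> /flow_imageP[s Ks /(trajectory_inj hkoe hback) /addIr as'].
  by have := Hsep _ Ks; rewrite as' subrr normr0 leNgt r0.
have hgW : holo_on W g by move=> z [[Dz _] _]; exact: hgD.
have WM z : W z -> normc z <= 1 by move=> [[/disk_le1]].
have usubW : subharmonic_on W u.
  case: usub => h1 h2 h3; split.
  - by move=> z [Uz _]; exact: h1.
  - by move=> z b [Uz _]; exact: h2.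
  - by move=> z [Uz _]; exact: h3.
have bdW xi : closure W xi -> ~ W xi -> forall e' : R, 0 < e' ->
    \forall z \near xi, W z -> (u z <= (cRe (g z) + e')%:E)%E.
  move=> cxi nxi e' e'0; have [Uxi|nUxi] := pselect ((D `\` E) xi).
    have [Dxi _] := Uxi.
    have hxi : ka ^+ 4 <= normc (h xi - p) by rewrite leNgt; apply/negP => hxi; apply: nxi.
    have cg : {for xi, continuous (fun z => cRe (g z))}.
      exact: (continuous_comp (cderivable_continuous (hgD _ Dxi)) (@continuous_Re _ _)).
    have /continuous_cmodP/(_ _ e'0)[r' r'0 H] := cg.
    apply/nbhs_cmodP; exists r' => // w /H /= wr [Uw _]; apply: le_trans (u1 _ Uw) _.
    by rewrite lee_fin; have := Reg1 _ Dxi hxi; move: wr; rewrite ler_norml => /andP[]; lra.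
  have cU : closure (D `\` E) xi by apply: closureS cxi => z [].
  have [Exi|nExi] := pselect (E xi).
    have d0 : 0 < (normc (h xi - p) - ka ^+ 4) by rewrite subr_gt0 Esep.
    have d1 : 0 < (normc (h xi - p) - ka ^+ 4) / 2 by rewrite divr_gt0.
    have /continuous_cmodP/(_ _ d1)[r' r'0 H] := hp_cont _ (ED _ Exi).
    apply/nbhs_cmodP; exists r' => // w /H /= wr [_ hw]; exfalso.
    by move: wr; rewrite ler_norml => /andP[]; lra.
  have ind0 : (\1_(boundary E) xi : R) = 0.
    rewrite indicE memNset// => -[+ _]; rewrite -(closure_id E).1//.
  have := ubd' _ cU nUxi; rewrite ind0 => /limf_esup_near/(_ _ e'0).
  apply: filterS => z uz Wz; have [Uz _] := Wz; apply: le_trans (uz Uz) _.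
  by rewrite lee_fin lerD2r ltW// Reg0//; case: Uz.
apply: le_trans (maximum_principle oW WM hgW usubW bdW Wa) _.
rewrite lee_fin Reg.
have qle : normc (q (L (a + t))) <= ka * e / 2.
  rewrite -(@ler_pXn2r _ 4) ?nnegrE ?cmod_ge0 ?divr_ge0 ?mulr_ge0 ?(ltW ka0) ?(ltW e0)//.
  by rewrite q4// ltW.
have -> : e = 2 / ka * (ka * e / 2) by field; rewrite gt_eqF.
rewrite ler_wpM2l ?divr_ge0 ?(ltW ka0)// (le_trans _ qle)//.
exact: le_trans (ler_norm _) (normRe_le _).
Qed.

Lemma harmonic_measure_cvg a : ~ K (L a) ->
  harmonic_measure (L (a + t)) (flow phi t @` K) @[t --> -oo] --> 0%E.
Proof.
move=> nKa; have [r r0 Hsep] := param_separated nKa.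
apply: cvge0_squeeze => e e0.
pose e' := Num.min 1 e; have e'0 : 0 < e' by rewrite lt_min ltr01.
(* then 2 ka^4 <= 2 ka < r *)
pose ka := Num.min 1 (r / 3).
have ka0 : 0 < ka by rewrite lt_min ltr01 divr_gt0.
have ka1 : ka <= 1 by rewrite ge_min lexx.
have kar : ka * 3 <= r by rewrite -ler_pdivlMr// ge_min lexx orbT.
have ka4 : ka ^+ 4 <= ka by rewrite exprS ler_piMr ?(ltW ka0)// exprn_ile1// ltW.
have eta0 : 0 < (ka * e' / 2) ^+ 4 by rewrite exprn_gt0// divr_gt0// mulr_gt0.
have [T HT] := trajectory_near_complement hphi hkoe hback nreg eta0.
apply: (@near_ninfty_le _ _ (T - a)) => t tT.
have [|p [np hp]] := HT (a + t); first by rewrite addrC -lerBrDr.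
rewrite harmonic_measure_ge0/=; apply: (@le_trans _ _ e'%:E);
  last by rewrite lee_fin ge_min lexx orbT.
apply: (@harmonic_measure_le a t r ka e' p) => //; first by rewrite ge_min lexx.
by lra.
Qed.
End Rates.

(** * Borel sets and Lebesgue measure of the plane *)

Section PlaneMeasure.
Context {R : realType}.
Local Notation C := (Cplx R).
Local Notation plane := (measurableTypeR R * measurableTypeR R)%type.
Local Notation leb2 := (@lebesgue_measure R \x @lebesgue_measure R)%E.

Definition square (z : C) (r : R) : set plane :=
  `[cRe z - r, cRe z + r]%classic `*` `[cIm z - r, cIm z + r]%classic.

Lemma measurable_square z r : measurable (square z r).
Proof. by apply: measurableX; exact: measurable_itv. Qed.

Lemma measure_square z r : 0 <= r -> (leb2 (square z r) = ((2 * r) ^+ 2)%:E)%E.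
Proof.
move=> r0; rewrite product_measure1E; [|exact: measurable_itv|exact: measurable_itv].
have I x : lebesgue_measure (`[x - r, x + r]%classic : set R) = (2 * r)%:E.
  have := @lebesgue_measure_itv R `[x - r, x + r]%R => /= ->.
  rewrite lte_fin; case: ltP => [_|]; first by rewrite -EFinB; congr (_%:E); ring.
  by move=> H; congr (_%:E); lra.
by rewrite [X in (X * _)%E]I [X in (_ * X)%E]I -EFinM expr2.
Qed.

Lemma square_ball z r (p : plane) : normc (pt p - z) <= r -> square z r p.
Proof.
move=> H; have := le_trans (normRe_le _) H; have := le_trans (normIm_le _) H.
rewrite ReB ImB /= !ler_norml => /andP[a b] /andP[c d].
by split; rewrite /= in_itv /=; apply/andP; split; lra.
Qed.

(** An open set is the union of the squares with rational centre and radius that it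
contains. *)
Lemma open_measurable_plane (O : set C) : open O -> measurable (pt @^-1` O).
Proof.
move=> oO.
(* the first two rationals are the centre, the third is the radius *)
pose rbox (q : rat * rat * rat) : set plane := square (ratr q.1.1 +i* ratr q.1.2) (ratr q.2).
pose F q := if pselect (rbox q `<=` pt @^-1` O) then rbox q else set0.
have -> : pt @^-1` O = \bigcup_q F q.
  apply/seteqP; split=> [[x y]|p [q _]]; last by rewrite /F; case: pselect => // H; exact: H.
  move=> Oxy; have [r r0 H] := near_open oO Oxy.
  have [q3] := @rat_in_itvoo R 0 (r / 4) (divr_gt0 r0 (ltr0n _ 4)).
  rewrite in_itv /= => /andP[q30 q3r].
  have [q1] : exists q : rat, ratr q \in `](x - ratr q3), (x : R)[ by apply: rat_in_itvoo; lra.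
  have [q2] : exists q : rat, ratr q \in `](y - ratr q3), (y : R)[ by apply: rat_in_itvoo; lra.
  rewrite !in_itv /= => /andP[a b] /andP[c d].
  exists (q1, q2, q3) => //; rewrite /F;
    case: (pselect (rbox (q1, q2, q3) `<=` pt @^-1` O)) => [inc|no] /=.
    by split; rewrite /= in_itv /=; apply/andP; split; lra.
  exfalso; apply: no => -[x' y'] [] /=; rewrite !in_itv /= => /andP[a' b'] /andP[c' d'].
  apply: H; apply: le_lt_trans (cmod_le_ReIm _) _ => /=.
  have : `|x' - x| <= 2 * ratr q3 by rewrite ler_norml; apply/andP; split; lra.
  have : `|y' - y| <= 2 * ratr q3 by rewrite ler_norml; apply/andP; split; lra.
  by lra.
apply: countable_bigcupT_measurable; first exact: countableP.
move=> q; rewrite /F; case: pselect => inc; [exact: measurable_square|exact: measurable0].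
Qed.

Lemma closed_measurable_plane (E : set C) : closed E -> measurable (pt @^-1` E).
Proof.
move=> cE; rewrite -[E]setCK preimage_setC; apply: measurableC.
exact: (open_measurable_plane (closed_openC cE)).
Qed.

Lemma compact_measurable_plane (E : set C) : compact E -> measurable (pt @^-1` E).
Proof.
by move=> cE; apply: closed_measurable_plane; apply: compact_closed cE; exact: norm_hausdorff.
Qed.

Lemma hyp_area_null (E : set C) : measurable (pt @^-1` E) -> leb2 (pt @^-1` E) = 0%E ->
  hyp_area E = 0%E.
Proof.
move=> mE E0; apply/eqP; rewrite eq_le; apply/andP; split.
  apply: (@le_trans _ _ (\int[leb2]_(p in pt @^-1` E) +oo)%E).
    by apply: le_integral_nomeasure => p _; rewrite leey.
  by rewrite null_set_integral.
by apply: integral_ge0 => p _; rewrite lee_fin sqr_ge0.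
Qed.
End PlaneMeasure.

(** * The trajectory is a null set *)

Section Area.
Context {R : realType}.
Local Notation C := (Cplx R).
Local Notation D := (@disk R).
Context (phi : R -> C -> C) (h : C -> C) (gamma : R -> C).
Context (hphi : holo_semigroup phi) (hkoe : koenigs phi h)
  (hback : backward_orbit phi gamma).
Local Notation L := (trajectory phi gamma).
Local Notation leb2 := (@lebesgue_measure R \x @lebesgue_measure R)%E.
Implicit Types (z p : C) (s t a b : R).
Let LD s : D (L s) := trajectory_disk hphi hback s.

(** At the time [a] this holds because [h] expands at [trajectory a].  Later steps of
the same length are shorter for the pseudo-hyperbolic distance, and the Euclidean
distance is at most twice the pseudo-hyperbolic one. *)
Lemma trajectory_lipschitz a : exists c d : R, [/\ 0 < c, 0 < d & forall s s',
  a <= s -> s <= s' -> s' < s + d -> normc (L s - L s') <= c * (s' - s)].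
Proof.
have [k k0 Hk] := univalent_expands (koenigs_holo hkoe) (koenigs_inj hkoe) (LD a).
have /nbhs_ballP[d d0 Hd] := trajectory_continuous hphi hkoe hback Hk.
have a1 : 0 < 1 - normc (L a) by rewrite subr_gt0; exact: LD.
exists (2 * (k^-1 / (1 - normc (L a)))), d; split => //.
  by rewrite mulr_gt0// divr_gt0// invr_gt0.
move=> s s' as1 ss' s'd.
have P1 : pseudo_hyp_dist (L s) (L s') <= k^-1 / (1 - normc (L a)) * (s' - s).
  have sa : 0 <= s - a by rewrite subr_ge0.
  apply: le_trans (pseudo_trajectory_mono hphi hkoe hback s s' sa) _.
  rewrite subKr (_ : s' - (s - a) = a + (s' - s)); last by ring.
  have : k * normc (L (a + (s' - s)) - L a) <= s' - s.
    have := Hd (a + (s' - s));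
      rewrite /ball /= opprD addrA subrr add0r normrN ger0_norm ?subr_ge0//.
    rewrite ltrBlDl => /(_ s'd) /le_trans; apply.
    rewrite !(koenigs_trajectory hkoe hback) opprD addrACA subrr add0r -rmorphB cmod_real.
    by rewrite addrAC subrr add0r ger0_norm// subr_ge0.
  rewrite -ler_pdivlMl// => H.
  rewrite -cmod_mobius /mobius cmodM cmodV.
  have den : 1 - normc (L a) <= normc (1 - (L a)^* * L (a + (s' - s))).
    have := cmodD (1 - (L a)^* * L (a + (s' - s))) ((L a)^* * L (a + (s' - s))).
    rewrite subrK cmod1 cmodM cmod_conj; have := disk_le1 (LD (a + (s' - s))).
    have := cmod_ge0 (L a); have := cmod_ge0 (L (a + (s' - s))); nra.
  rewrite mulrAC; apply: ler_pM; rewrite ?invr_ge0 ?cmod_ge0//.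
  by rewrite lef_pV2 ?posrE// (lt_le_trans a1).
have den2 : normc (1 - (L s)^* * L s') <= 2.
  rewrite (le_trans (cmodD _ _))// cmodN cmodM cmod_conj cmod1.
  have := disk_le1 (LD s); have := disk_le1 (LD s'); have := cmod_ge0 (L s);
    have := cmod_ge0 (L s'); nra.
have den0 := mobius_den_gt0 (LD s) (disk_le1 (LD s')).
have -> : normc (L s - L s') = pseudo_hyp_dist (L s) (L s') * normc (1 - (L s)^* * L s').
  by rewrite /pseudo_hyp_dist cmodM cmodV divfK// gt_eqF.
rewrite -mulrA [leRHS]mulrC; apply: ler_pM; rewrite ?pseudo_ge0 ?cmod_ge0//.
Qed.

(** A Lipschitz arc is covered by [n + 1] squares of side [O(1 / n)]. *)
Lemma trajectory_segment_null (E : set C) a b : a < b -> measurable (pt @^-1` E) ->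
  (forall z, E z -> exists2 s, a <= s <= b & z = L s) -> leb2 (pt @^-1` E) = 0%E.
Proof.
move=> ab mE EL; apply/eqP; rewrite eq_le measure_ge0 andbT.
apply/lee_addgt0Pr => e e0; rewrite add0e.
have [c [d [c0 d0 Hlip]]] := trajectory_lipschitz a.
have ba0 : 0 < b - a by rewrite subr_gt0.
(* the first term makes the pieces shorter than d, the second makes the total
   area of the squares less than e *)
pose k := (b - a) / d + 8 * c ^+ 2 * (b - a) ^+ 2 / e.
have k1 : 0 < (b - a) / d by rewrite divr_gt0.
have k2 : 0 < 8 * c ^+ 2 * (b - a) ^+ 2 / e by rewrite divr_gt0// !mulr_gt0// exprn_gt0.
pose n := (Num.truncn k).+1.
have kn : k < n%:R by exact: truncnS_gt.
have n0 : 0 < n%:R :> R by rewrite ltr0n.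
pose l : R := (b - a) / n%:R.
have l0 : 0 < l by rewrite divr_gt0.
have ld : l < d by rewrite ltr_pdivrMr// mulrC -ltr_pdivrMr//; rewrite /k in kn; lra.
pose S (i : nat) := square (L (a + l * i%:R)) (c * l).
have cover : pt @^-1` E `<=` \big[setU/set0]_(i < n.+1) S i.
  move=> p /EL[s /andP[sa sb] ps].
  pose i := Num.truncn ((s - a) / l).
  have q0 : 0 <= (s - a) / l by rewrite divr_ge0 ?subr_ge0// ltW.
  have /andP[i1 i2] : i%:R <= (s - a) / l < i.+1%:R by exact: truncn_itv.
  move: i1 i2; rewrite ler_pdivlMr// ltr_pdivrMr// -natr1 => i1 i2.
  have i_n : (i < n.+1)%N.
    rewrite -(ltr_nat R) -natr1 -(ltr_pM2r l0) mulrDl mul1r.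
    have -> : n%:R * l = b - a by rewrite /l mulrC divfK// gt_eqF.
    by lra.
  rewrite -bigcup_mkord; exists i => //=; apply: square_ball.
  rewrite ps cmod_distC; have := @Hlip (a + l * i%:R) s.
  have li : 0 <= l * i%:R by rewrite mulr_ge0// ltW.
  move=> /(_ _ _ _) H; apply: le_trans (H _ _ _) _; [lra|lra|lra|].
  by rewrite ler_pM2l//; lra.
have mS i : measurable (S i) by exact: measurable_square.
apply: (@le_trans _ _ (leb2 (\big[setU/set0]_(i < n.+1) S i))).
  by apply: le_measure; rewrite ?inE//; exact: bigsetU_measurable.
apply: le_trans (Boole_inequality leb2 (fun i _ => mS i)) _.
have mSE i : (leb2 (S i) = ((2 * (c * l)) ^+ 2)%:E)%E.
  by apply: measure_square; rewrite mulr_ge0// ltW.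
rewrite (eq_bigr (fun=> ((2 * (c * l)) ^+ 2)%:E)); last by move=> i _; exact: mSE.
rewrite sumEFin lee_fin sumr_const card_ord -[_ *+ n.+1]mulr_natr -natr1.
have n1 : 1 <= n%:R :> R by rewrite ler1n.
apply: (@le_trans _ _ ((2 * (c * l)) ^+ 2 * (2 * n%:R))).
  by rewrite ler_wpM2l ?sqr_ge0//; lra.
have -> : (2 * (c * l)) ^+ 2 * (2 * n%:R) = 8 * c ^+ 2 * (b - a) ^+ 2 / n%:R.
  by rewrite /l; field; rewrite gt_eqF.
rewrite ler_pdivrMr// [leRHS]mulrC -ler_pdivrMr//; rewrite /k in kn; lra.
Qed.

Context (K : set C) (cK : compact K) (KL : forall z, K z -> exists s, z = L s).

Lemma param_bounded : exists M : R, forall s, K (L s) -> `|s| <= M.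
Proof.
have [->|/set0P K0] := eqVneq K set0; first by exists 0.
have KD z : K z -> D z by move=> /KL[s ->]; exact: LD.
have [|z _ zmax] := @compact_EVT_max _ R (fun z => `|param h gamma z|) K K0 cK.
  apply: continuous_in_subspaceT => z /[!inE] /KD Dz.
  apply: (@continuous_comp _ _ _ (param h gamma) (fun x => `|x|)); last exact: norm_continuous.
  exact: (param_continuous hkoe Dz).
by exists `|param h gamma z| => s Ks;
  rewrite -[s in X in X <= _](param_trajectory hkoe hback) zmax// inE.
Qed.

Lemma hyp_area_flow t : hyp_area (flow phi t @` K) = 0%E.
Proof.
have mE := compact_measurable_plane (flow_compact hphi hkoe hback cK KL (t := t)).
apply: hyp_area_null => //; have [M HM] := param_bounded.
apply: (@trajectory_segment_null _ (- `|M| - 1 + t) (`|M| + 1 + t)) => //.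
  by have := normr_ge0 M; lra.
move=> z /(flow_imageP hphi hkoe hback KL)[s /HM sM ->]; exists (s + t) => //.
by have := ler_norm M; move: sM; rewrite ler_norml => /andP[? ?] ?; apply/andP; split; lra.
Qed.
End Area.

(** * The logarithmic and Green kernels *)

Section Kernels.
Context {R : realType}.
Local Notation C := (Cplx R).
Local Notation D := (@disk R).
Local Notation plane := (measurableTypeR R * measurableTypeR R)%type.

Lemma measurable_normc_pair d (T : measurableType d) (f g : T -> R) :
  measurable_fun setT f -> measurable_fun setT g ->
  measurable_fun setT (fun x => normc (f x +i* g x : C)).
Proof.
move=> mf mg; apply: (@measurableT_comp _ _ _ _ _ _ (@Num.sqrt R)).
  by apply: continuous_measurable_fun; exact: sqrt_continuous.
by apply: measurable_funD; apply: measurable_funX.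
Qed.

Let coord11 : measurable_fun setT (fun r : plane * plane => r.1.1 : R).
Proof. exact: measurableT_comp. Qed.
Let coord12 : measurable_fun setT (fun r : plane * plane => r.1.2 : R).
Proof. exact: measurableT_comp. Qed.
Let coord21 : measurable_fun setT (fun r : plane * plane => r.2.1 : R).
Proof. exact: measurableT_comp. Qed.
Let coord22 : measurable_fun setT (fun r : plane * plane => r.2.2 : R).
Proof. exact: measurableT_comp. Qed.

Let measurable_dist : measurable_fun setT (fun r : plane * plane => normc (pt r.1 - pt r.2)).
Proof. by apply: measurable_normc_pair; apply: measurable_funB. Qed.

Let measurable_numer : measurable_fun setT
  (fun r : plane * plane => normc (1 - (pt r.1)^* * pt r.2)).
Proof.
rewrite (_ : (fun _ => _) = (fun r : plane * plane =>
    normc ((1 - (r.1.1 * r.2.1 + r.1.2 * r.2.2)) +i* (r.1.2 * r.2.1 - r.1.1 * r.2.2) : C))).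
  apply: measurable_normc_pair.
    by apply: measurable_funB => //; apply: measurable_funD; apply: measurable_funM.
  by apply: measurable_funB; apply: measurable_funM.
apply/funext => -[[x y] [x' y']]; apply: (congr1 (fun z : C => normc z)).
by apply/eqP; rewrite eq_complex /=; apply/andP; split; apply/eqP; ring.
Qed.

Let measurable_diag : measurable_fun setT (fun r : plane * plane => pt r.1 == pt r.2).
Proof.
rewrite (_ : (fun _ => _) = (fun r : plane * plane => normc (pt r.1 - pt r.2) == 0)).
  exact: measurable_fun_eqr.
by apply/funext => r; rewrite cmod_eq0 subr_eq0.
Qed.

Definition log_kernel2 (r : plane * plane) : \bar R := log_kernel (pt r.1) (pt r.2).

Lemma measurable_log_kernel2 : measurable_fun setT log_kernel2.
Proof.
apply: measurable_fun_ifT => //; apply/measurable_EFinP; apply: measurable_funN.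
exact: measurableT_comp.
Qed.

(** A jointly measurable majorant of the Green kernel, nonnegative on the whole
plane, equal to it on the disk. *)
Definition green2 (r : plane * plane) : \bar R := if pt r.1 == pt r.2 then +oo%E else
  (Num.max 0 (ln (normc (1 - (pt r.1)^* * pt r.2)) - ln (normc (pt r.1 - pt r.2))))%:E.

Lemma measurable_green2 : measurable_fun setT green2.
Proof.
apply: measurable_fun_ifT => //; apply/measurable_EFinP; apply: measurable_maxr => //.
by apply: measurable_funB; exact: measurableT_comp.
Qed.

Lemma green2_ge0 r : (0 <= green2 r)%E.
Proof. by rewrite /green2; case: ifP => // _; rewrite lee_fin le_max lexx. Qed.

Lemma green_le_green2 r : (green (pt r.1) (pt r.2) <= green2 r)%E.
Proof.
rewrite /green /green2; case: eqVneq => // ne; rewrite lee_fin cmodM cmodV.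
have d0 : 0 < normc (pt r.1 - pt r.2) by rewrite cmod_gt0 subr_eq0.
have := cmod_ge0 (1 - (pt r.1)^* * pt r.2); rewrite le_eqVlt => /orP[/eqP <-|n0].
  by rewrite mul0r ln0// le_max lexx.
by rewrite lnM ?posrE ?invr_gt0// lnV ?posrE// le_max lexx orbT.
Qed.

Lemma green2E r : D (pt r.1) -> D (pt r.2) -> green2 r = green (pt r.1) (pt r.2).
Proof.
move=> D1 D2; rewrite /green /green2; case: eqVneq => // ne; rewrite cmodM cmodV.
have d0 : 0 < normc (pt r.1 - pt r.2) by rewrite cmod_gt0 subr_eq0.
have n0 := mobius_den_gt0 D1 (disk_le1 D2).
rewrite lnM ?posrE ?invr_gt0// lnV ?posrE//; congr (_%:E).
apply/max_idPr; rewrite subr_ge0 ler_ln ?posrE//.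
rewrite -(ler_pXn2r (n:=2)) ?nnegrE ?cmod_ge0// -subr_ge0 cmod_distC mobius_identity.
by rewrite mulr_ge0// ltW// one_sub_sqr_gt0.
Qed.

Lemma ln2_ge0 : 0 <= ln 2 :> R.
Proof. by rewrite ln_ge0// ler1n. Qed.

(** Distances in the disk are at most 2. *)
Lemma log_kernel_ge z w : D z -> D w -> (- (ln 2)%:E <= log_kernel z w :> \bar R)%E.
Proof.
move=> Dz Dw; rewrite /log_kernel; case: eqVneq => [_|zw]; first exact: leey.
rewrite lee_fin lerN2 ler_ln ?posrE ?cmod_gt0 ?subr_eq0//.
by apply: le_trans (cmodD _ _) _; rewrite cmodN; have := disk_le1 Dz; have := disk_le1 Dw; lra.
Qed.

Lemma green_le_log_kernel z w : D z -> D w ->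
  (green z w <= maxe (log_kernel z w) 0 + (ln 2)%:E)%E.
Proof.
move=> Dz Dw; rewrite /green /log_kernel; case: eqVneq => [_|zw]; first by rewrite max_l.
have d0 : 0 < normc (z - w) by rewrite cmod_gt0 subr_eq0.
have n0 := mobius_den_gt0 Dz (disk_le1 Dw).
rewrite cmodM cmodV lnM ?posrE ?invr_gt0// lnV ?posrE//.
rewrite addrC EFinD leeD//; first by rewrite le_max lexx.
rewrite lee_fin ler_ln ?posrE//; apply: le_trans (cmodD _ _) _;
  rewrite cmodN cmod1 cmodM cmod_conj.
have := disk_le1 Dz; have := disk_le1 Dw; have := cmod_ge0 z; have := cmod_ge0 w; nra.
Qed.

Lemma nonpolar_finite_energy (K : set C) : ~ polar K ->
  exists2 mu : probability plane R, probability_on K mu & (energy log_kernel mu < +oo)%E.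
Proof.
move=> npol; apply: contrapT => no; apply: npol.
rewrite /polar /log_capacity; apply/eqP; rewrite eq_le; apply/andP; split; last first.
  by apply: ereal_sup_ubound; left.
apply: ge_ereal_sup => _ [->//|[mu muK <-]].
have -> : energy log_kernel mu = +oo%E; last by [].
apply/eqP; apply: contrapT => /negP ne; apply: no; exists mu => //.
by rewrite lt_neqAle ne leey.
Qed.

Section FullMeasure.
Context (mu : probability plane R) (A : set plane) (mA : measurable A) (muA : mu A = 1%E).

Lemma full_complement : mu (~` A) = 0%E.
Proof. by rewrite probability_setC// muA subee. Qed.

Lemma integral_full (f : plane -> \bar R) : measurable_fun setT f ->
  (forall p, (0 <= f p)%E) -> (\int[mu]_p f p = \int[mu]_(p in A) f p)%E.
Proof.
move=> mf f0; rewrite (ge0_negligible_integral (measurableC mA))//; last exact: full_complement.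
by rewrite setTD setCK.
Qed.

Lemma integral_full_le (f : plane -> \bar R) (k : R) : measurable_fun setT f ->
  (forall p, (0 <= f p)%E) -> (forall p, A p -> (f p <= k%:E)%E) -> (\int[mu]_p f p <= k%:E)%E.
Proof.
move=> mf f0 fk; rewrite integral_full//.
apply: (@le_trans _ _ (\int[mu]_(p in A) k%:E)%E).
  by apply: le_integral_nomeasure.
by rewrite integral_cst// [X in (_ * X)%E]muA mule1.
Qed.

(** The negative part of [f] vanishes off a null set, so its integral is at most that
of the constant infinity on this set. *)
Lemma integral_full_ge0 (f : plane -> \bar R) :
  (forall p, A p -> (0 <= f p)%E) -> (0 <= \int[mu]_p f p)%E.
Proof.
move=> f0; rewrite integralE.
have -> : (\int[mu]_p f^\- p = 0)%E.
  apply/eqP; rewrite eq_le; apply/andP; split; last exact: integral_ge0.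
  apply: (@le_trans _ _ (\int[mu]_(p in ~` A) +oo)%E).
    rewrite [leRHS]integral_mkcond; apply: le_integral_nomeasure => p _.
    rewrite /patch; case: ifPn => [_|]; first exact: leey.
    rewrite notin_setE => /contrapT/f0 fp.
    by rewrite funenegE ge_max lexx andbT oppe_le0.
  by rewrite null_set_integral//; [exact: measurableC|exact: full_complement].
by rewrite sube0 integral_ge0.
Qed.
End FullMeasure.

Lemma energy_ge0 (E : set C) (mu : probability plane R) : E `<=` D ->
  measurable (pt @^-1` E) -> probability_on E mu -> (0 <= energy green mu)%E.
Proof.
move=> ED mE muE; apply: (integral_full_ge0 mE muE) => p Ep.
apply: (integral_full_ge0 mE muE) => q Eq.
have Dp : D (pt p) by exact: ED.
have Dq : D (pt q) by exact: ED.
by have := green2E (r := (p, q)) Dp Dq => /= <-; exact: green2_ge0.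
Qed.
End Kernels.

(** * Finite logarithmic energy gives finite Green energy *)

Section LogEnergy.
Context {R : realType}.
Local Notation C := (Cplx R).
Local Notation D := (@disk R).
Local Notation plane := (measurableTypeR R * measurableTypeR R)%type.
Context (mu : probability plane R) (K : set C) (KD : K `<=` D)
  (mK : measurable (pt @^-1` K)) (muK : probability_on K mu).

(** The Green kernel exceeds the positive part of the logarithmic kernel by at most
[ln 2] on the disk.  The energy of the logarithmic kernel is an iterated
integral of a function of variable sign; its negative parts [Y] (inner) and
[A^-] (outer) are at most [ln 2], so that both positive parts are finite. *)
Lemma finite_green_energy (f : plane * plane -> \bar R) : measurable_fun setT f ->
  (forall r, (0 <= f r)%E) ->
  (forall r, K (pt r.1) -> K (pt r.2) -> f r = green (pt r.1) (pt r.2)) ->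
  (energy log_kernel mu < +oo)%E -> (\int[mu \x mu]_r f r < +oo)%E.
Proof.
move=> mf f0 fgreen; have l20 := @ln2_ge0 R.
pose lkp := (@log_kernel2 R)^\+%E; pose lkn := (@log_kernel2 R)^\-%E.
have mlk := @measurable_log_kernel2 R.
have mlkp : measurable_fun setT lkp by exact: measurable_funepos.
have mlkn : measurable_fun setT lkn by exact: measurable_funeneg.
have lkp0 r : (0 <= lkp r)%E by exact: funepos_ge0.
have lkn0 r : (0 <= lkn r)%E by exact: funeneg_ge0.
pose X := fubini_F mu lkp; pose Y := fubini_F mu lkn.
have mX : measurable_fun setT X by exact: measurable_fun_fubini_tonelli_F.
have mY : measurable_fun setT Y by exact: measurable_fun_fubini_tonelli_F.
have X0 p : (0 <= X p)%E by exact: integral_ge0.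
have Y0 p : (0 <= Y p)%E by exact: integral_ge0.
have sec (g : plane * plane -> \bar R) p : measurable_fun setT g ->
  measurable_fun setT (fun q => g (p, q)).
  by move=> mg; apply: measurableT_comp => //; exact: measurable_pair1.
pose A p := (X p - Y p)%E.
have mA : measurable_fun setT A by exact: emeasurable_funB.
have innerE p : (\int[mu]_q log_kernel (pt p) (pt q) = A p)%E.
  rewrite integralE; congr (_ - _)%E; apply: eq_integral => q _.
    by rewrite /= /lkp !funeposE.
  by rewrite /= /lkn !funenegE.
have Yle p : K (pt p) -> (Y p <= (ln 2)%:E)%E.
  move=> Kp; apply: (integral_full_le mK muK); first exact: sec.
    by [].
  move=> q Kq; rewrite /lkn funenegE ge_max lee_fin l20 andbT leeNl.
  by apply: log_kernel_ge; exact: KD.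
have Ale p : K (pt p) -> (X p <= A^\+%E p + (ln 2)%:E)%E.
  move=> Kp; have Yf : Y p \is a fin_num by rewrite ge0_fin_numE// (le_lt_trans (Yle _ Kp))// ltry.
  rewrite -[leLHS](subeK _ Yf); apply: leeD; last exact: Yle.
  by rewrite funeposE le_max lexx.
have An p : K (pt p) -> (A^\-%E p <= (ln 2)%:E)%E.
  move=> Kp; rewrite funenegE ge_max lee_fin l20 andbT leeNl.
  apply: (@le_trans _ _ (- Y p)%E); first by rewrite leeN2 Yle.
  by rewrite /A -[leLHS]add0e leeD2r.
rewrite /energy (eq_integral A); last by move=> p _; rewrite innerE.
rewrite integralE => Efin.
have mAn : measurable_fun setT A^\-%E by exact: measurable_funeneg.
have mAp : measurable_fun setT A^\+%E by exact: measurable_funepos.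
have Anfin : (\int[mu]_p A^\- p <= (ln 2)%:E)%E.
  by apply: (integral_full_le mK muK) => //; move=> p; exact: funeneg_ge0.
have Apfin : (\int[mu]_p A^\+ p < +oo)%E.
  rewrite ltNge leye_eq; apply/negP => /eqP E; move: Efin; rewrite E.
  have : (\int[mu]_p A^\- p \is a fin_num)%E.
    by rewrite ge0_fin_numE ?(le_lt_trans Anfin) ?ltry// integral_ge0.
  by move: (\int[mu]_p _)%E => [r| |].
rewrite fubini_tonelli1//.
have mF : measurable_fun setT (fubini_F mu f) by exact: measurable_fun_fubini_tonelli_F.
rewrite (integral_full mK muK)//; last by move=> p; exact: integral_ge0.
have inner p : K (pt p) -> (fubini_F mu f p <= A^\+ p + (ln 2 + ln 2)%:E)%E.
  move=> Kp; rewrite /fubini_F (integral_full mK muK)//; last exact: sec.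
  apply: (@le_trans _ _ (\int[mu]_(q in pt @^-1` K) (lkp (p, q) + (ln 2)%:E))%E).
    apply: le_integral_nomeasure => q Kq; rewrite fgreen//= /lkp funeposE.
    by apply: green_le_log_kernel; exact: KD.
  rewrite ge0_integralD//; last first.
    by apply: measurable_funS (sec _ p mlkp).
  rewrite integral_cst// [X in (_ + _ * X)%E]muK mule1 EFinD addeA leeD2r//.
  by rewrite -(integral_full mK muK) ?Ale//; exact: sec.
apply: (@le_lt_trans _ _ (\int[mu]_(p in pt @^-1` K) (A^\+ p + (ln 2 + ln 2)%:E))%E).
  by apply: le_integral_nomeasure => p Kp; exact: inner.
rewrite ge0_integralD//; last 2 first.
- exact: measurable_funS mAp.
- by move=> p _; rewrite lee_fin addr_ge0.
rewrite integral_cst// [X in (_ + _ * X)%E]muK mule1 lte_add_pinfty ?ltry//.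
by rewrite -(integral_full mK muK)//; move=> p; exact: funepos_ge0.
Qed.
End LogEnergy.

(** * Transport of a measure along the flow *)

Section Transport.
Context {R : realType}.
Local Notation C := (Cplx R).
Local Notation D := (@disk R).
Local Notation plane := (measurableTypeR R * measurableTypeR R)%type.
Context (phi : R -> C -> C) (h : C -> C) (gamma : R -> C).
Context (hphi : holo_semigroup phi) (hkoe : koenigs phi h)
  (hback : backward_orbit phi gamma) (nreg : ~ regular_orbit gamma).
Local Notation L := (trajectory phi gamma).
Implicit Types (z : C) (s t a b : R) (p q : plane).
Let LD s : D (L s) := trajectory_disk hphi hback s.
Context (K : set C) (cK : compact K) (KL : forall z, K z -> exists s, z = L s).
Context (mu : probability plane R) (muK : probability_on K mu)
  (finE : (energy log_kernel mu < +oo)%E).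

Let KD : K `<=` D. Proof. by move=> z /KL[s ->]; exact: LD. Qed.
Let mK : measurable (pt @^-1` K). Proof. exact: compact_measurable_plane. Qed.

Let mD : measurable (pt @^-1` D : set plane).
Proof. exact: (open_measurable_plane (@open_disk R)). Qed.

(** The time parameter of a point of the petal, as a measurable function on the
whole plane. *)
Definition clock : plane -> R := (param h gamma \o pt) \_ (pt @^-1` D).

Lemma measurable_clock : measurable_fun setT clock.
Proof.
apply/measurable_restrict => //; rewrite setTI.
apply: (measurability _ (RGenOInfty.measurableE R)) => _ [_ [a ->] <-].
rewrite (_ : _ `&` _ = pt @^-1` [set z | D z /\ a < param h gamma z]).
  apply: open_measurable_plane; rewrite openE => z [Dz az].
  apply: filterI; first by apply: open_nbhs_nbhs; split => //; exact: open_disk.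
  have d0 : 0 < (param h gamma z - a) / 2 by rewrite divr_gt0// subr_gt0.
  have /continuous_cmodP/(_ _ d0)[r r0 H] := param_continuous (gamma := gamma) hkoe Dz.
  apply/nbhs_cmodP; exists r => // w /H; rewrite ler_norml => /andP[]; lra.
by apply/seteqP; split=> x /= [Dx]; rewrite in_itv /= andbT.
Qed.

Lemma clock_trajectory p s : pt p = L s -> clock p = s.
Proof.
move=> ps; rewrite /clock patchE ifT; last by rewrite inE /= ps; exact: LD.
by rewrite /= ps (param_trajectory hkoe hback).
Qed.

(** The flow extended from the petal to a measurable map of the plane. *)
Definition transport t p : plane := (cRe (L (clock p + t)), cIm (L (clock p + t))).

Lemma pt_transport t p : pt (transport t p) = L (clock p + t).
Proof. by rewrite /pt /=; case: (L _). Qed.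

Lemma measurable_transport t : measurable_fun setT (transport t).
Proof.
have mc : measurable_fun setT (fun p => clock p + t : R).
  by apply: measurable_funD => //; exact: measurable_clock.
have cL := trajectory_continuous hphi hkoe hback.
have m1 : measurable_fun setT (fun s : R => cRe (L s) : R).
  by apply: continuous_measurable_fun => s; exact: (continuous_comp (cL s) (@continuous_Re _ _)).
have m2 : measurable_fun setT (fun s : R => cIm (L s) : R).
  by apply: continuous_measurable_fun => s; exact: (continuous_comp (cL s) (@continuous_Im _ _)).
by apply: measurable_fun_pair; [exact: (measurableT_comp m1 mc)|exact: (measurableT_comp m2 mc)].
Qed.

(** The Green kernel between the transported points. *)
Definition pulled_green t (r : plane * plane) : \bar R :=
  green2 (transport t r.1, transport t r.2).

Lemma pulled_greenE t r : pulled_green t r = green (L (clock r.1 + t)) (L (clock r.2 + t)).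
Proof. by rewrite /pulled_green green2E /= !pt_transport. Qed.

Lemma measurable_pulled_green t : measurable_fun setT (pulled_green t).
Proof.
apply: (measurableT_comp (@measurable_green2 R)); apply: measurable_fun_pair;
  by apply: measurableT_comp => //; exact: measurable_transport.
Qed.

Lemma pulled_green_ge0 t r : (0 <= pulled_green t r)%E.
Proof. exact: green2_ge0. Qed.

Lemma pulled_green_mono t t' r : t' <= t -> (pulled_green t' r <= pulled_green t r)%E.
Proof.
move=> tt'; rewrite !pulled_greenE.
have -> : t' = t - (t - t') by rewrite subKr.
rewrite !addrA; apply: (green_trajectory_mono hphi hkoe hback); by rewrite subr_ge0.
Qed.

(** The Green energy of the image of [mu] under [transport t]. *)
Definition flow_energy t : \bar R := (\int[mu \x mu]_r pulled_green t r)%E.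

Lemma flow_energy_mono t t' : t' <= t -> (flow_energy t' <= flow_energy t)%E.
Proof. by move=> tt'; apply: le_integral_nomeasure => r _; exact: pulled_green_mono. Qed.

Lemma flow_energy_fin : (flow_energy 0 < +oo)%E.
Proof.
apply: (finite_green_energy KD mK muK) => //; first exact: measurable_pulled_green.
  exact: pulled_green_ge0.
move=> r K1 K2; rewrite pulled_greenE !addr0.
have [s1 e1] := KL K1; have [s2 e2] := KL K2.
by rewrite (clock_trajectory e1) (clock_trajectory e2) e1 e2.
Qed.

Lemma pulled_green_integrable : (mu \x mu)%E.-integrable setT (pulled_green 0).
Proof.
apply/integrableP; split; first exact: measurable_pulled_green.
rewrite (eq_integral (pulled_green 0)); first exact: flow_energy_fin.
by move=> r _; rewrite gee0_abs// pulled_green_ge0.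
Qed.

(** On the square of a point of positive mass the Green kernel would be infinite on
a set of positive product measure. *)
Lemma singleton_null z : mu (pt @^-1` [set z]) = 0%E.
Proof.
have mz : measurable (pt @^-1` [set z] : set plane).
  by apply: compact_measurable_plane; exact: compact_set1.
have := integrable_ae measurableT pulled_green_integrable.
move=> [N [mN N0 sub]].
have : ((mu \x mu) (pt @^-1` [set z] `*` pt @^-1` [set z]) <= (mu \x mu) N)%E.
  apply: le_measure; rewrite ?inE//; first exact: measurableX.
  move=> [p q] [/= pz qz]; apply: sub => /(_ Logic.I).
  have -> : p = q.
    by move: qz; rewrite -pz; case: (p) (q) => [? ?] [? ?] [-> ->].
  by rewrite pulled_greenE /green eqxx.
rewrite N0 product_measure1E// => H.
have /eqP : (mu (pt @^-1` [set z]) * mu (pt @^-1` [set z]) = 0)%E.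
  by apply/eqP; rewrite eq_le H mule_ge0.
by rewrite mule_eq0 orbb => /eqP.
Qed.

(** A finite set has measure 0. *)
Lemma petal_compact_infinite (l : seq C) : exists2 z, K z & z \notin l.
Proof.
apply: contrapT => no.
have sub z : K z -> z \in l.
  by move=> Kz; apply/negPn/negP => zl; apply: no; exists z.
have nullU : mu (\big[setU/set0]_(z <- l) (pt @^-1` [set z])) = 0%E /\
    measurable (\big[setU/set0]_(z <- l) (pt @^-1` [set z]) : set plane).
  elim: l {no sub} => [|z l [ih1 ih2]]; first by rewrite big_nil measure0.
  have mz : measurable (pt @^-1` [set z] : set plane).
    by apply: compact_measurable_plane; exact: compact_set1.
  rewrite big_cons; split; last exact: measurableU.
  by apply: null_set_setU => //; exact: singleton_null.
have : (mu (pt @^-1` K) <= mu (\big[setU/set0]_(z <- l) (pt @^-1` [set z])))%E.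
  apply: le_measure; rewrite ?inE//; first by case: nullU.
  move=> p /sub; elim: (l) => [//|z l' ih]; rewrite inE big_cons => /orP[/eqP pz|/ih ?].
    by left.
  by right.
have -> : mu (pt @^-1` K) = 1%E by exact: muK.
by case: nullU => -> _; rewrite lee_fin ler10.
Qed.

(** Dominated convergence, with the kernel at time 0 as dominating function.  At
almost every pair of points this kernel is finite, so the two times differ and
the kernel tends to 0. *)
Lemma flow_energy_cvg : flow_energy (- n%:R) @[n --> \oo] --> 0%E.
Proof.
have := @dominated_convergence _ _ _ (mu \x mu)%E setT measurableT
  (fun n => pulled_green (- n%:R)) (cst 0%E) (pulled_green 0).
move=> /(_ _ _ _ pulled_green_integrable) H.
have [] := H.
- by move=> n; exact: measurable_pulled_green.
- exact: measurable_cst.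
- have := integrable_ae measurableT pulled_green_integrable.
  apply: filterS => r /(_ Logic.I) rfin _.
  have ab : clock r.1 <> clock r.2.
    by move=> E; move: rfin; rewrite pulled_greenE E /green eqxx.
  apply: cvge0_squeeze => e e0.
  have [T HT] := green_trajectory_small hphi hkoe hback nreg ab e0.
  near=> n; rewrite pulled_green_ge0 pulled_greenE HT// lerNl.
  by near: n; exact: nbhs_infty_ger.
- apply: aeW => r n _; rewrite gee0_abs ?pulled_green_ge0//.
  by apply: pulled_green_mono; rewrite oppr_le0.
by move=> _ _; rewrite integral0.
Unshelve. all: end_near. Qed.

(** Test the infimum on the image measure. *)
Lemma green_energy_flow_le t : (green_energy (flow phi t @` K) <= flow_energy t)%E.
Proof.
pose X : {mfun plane >-> plane} :=
  HB.pack (transport t) (isMeasurableFun.Build _ _ _ _ (transport t) (measurable_transport t)).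
pose nu : probability plane R := distribution mu X.
have mE := compact_measurable_plane (flow_compact hphi hkoe hback cK KL (t := t)).
have nuE : probability_on (flow phi t @` K) nu.
  apply/eqP; rewrite eq_le probability_le1//= -[leLHS](_ : mu (pt @^-1` K) = 1%E);
    last exact: muK.
  apply: le_measure; rewrite ?inE//; first by rewrite -[X in measurable X]setTI;
    exact: measurable_transport.
  move=> p Kp; rewrite /= -/(pt _) pt_transport; have [s ps] := KL Kp.
  apply/(flow_imageP hphi hkoe hback KL); exists s; first by rewrite -ps.
  by rewrite (clock_trajectory ps).
apply: (@le_trans _ _ (energy green nu)); first by apply: ereal_inf_lbound; exists nu.
apply: (@le_trans _ _ (\int[nu]_p \int[nu]_q green2 (p, q))%E).
  apply: le_integral_nomeasure => p _; apply: le_integral_nomeasure => q _.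
  exact: (green_le_green2 (p, q)).
have sec p : measurable_fun setT (fun q => green2 (p, q) : \bar R).
  by apply: (measurableT_comp (@measurable_green2 R)); exact: measurable_pair1.
have inner p : (\int[nu]_q green2 (p, q) = \int[mu]_q green2 (p, transport t q))%E.
  rewrite ge0_integral_pushforward//; last by move=> q _; exact: green2_ge0.
pose f (r : plane * plane) := green2 (r.1, transport t r.2).
have mf : measurable_fun setT f.
  apply: (measurableT_comp (@measurable_green2 R)); apply: measurable_fun_pair => //.
  by apply: measurableT_comp => //; exact: measurable_transport.
have f0 r : (0 <= f r)%E by exact: green2_ge0.
rewrite (eq_integral (fubini_F mu f)); last by move=> p _; rewrite inner.
rewrite ge0_integral_pushforward//; last 2 first.
- exact: measurable_fun_fubini_tonelli_F.
- by move=> p _; exact: integral_ge0.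
rewrite /flow_energy fubini_tonelli1//; first exact: measurable_pulled_green.
exact: pulled_green_ge0.
Qed.

Lemma condenser_capacity_cvg : condenser_capacity (flow phi t @` K) @[t --> -oo] --> +oo%E.
Proof.
apply/cvgeyPge => A.
(* a positive lower bound to reach, so that e is a positive energy *)
pose B := Num.max 1 A; have B0 : 0 < B by rewrite lt_max ltr01.
have pi20 : 0 < 2 * pi :> R by rewrite mulr_gt0// pi_gt0.
pose e := 2 * pi / B; have e0 : 0 < e by rewrite divr_gt0.
have [n Hn] : exists n, (flow_energy (- n%:R) <= e%:E)%E.
  have /fine_cvgP[fin /cvgrPdist_le/(_ _ e0) H] := flow_energy_cvg.
  have [n [f1 f2]] := filter_ex (filterI fin H).
  exists n; rewrite -(fineK f1) lee_fin; move: f2.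
  by rewrite /= sub0r normrN => /(le_trans (ler_norm _)).
apply: (@near_ninfty_le _ _ (- n%:R)) => t tn.
have mE := compact_measurable_plane (flow_compact hphi hkoe hback cK KL (t := t)).
have V0 : (0 <= green_energy (flow phi t @` K))%E.
  apply: le_ereal_inf_tmp => _ [nu nuE <-]; apply: energy_ge0 nuE => //.
  by move=> z /(flow_imageP hphi hkoe hback KL)[s _ ->]; exact: LD.
have Ve : (green_energy (flow phi t @` K) <= e%:E)%E.
  by apply: le_trans (green_energy_flow_le t) _; apply: le_trans (flow_energy_mono tn) Hn.
rewrite /condenser_capacity; move: V0 Ve; case: (green_energy _) => [v| |]//.
rewrite !lee_fin => v0 ve; rewrite inver; case: eqP => [_|/eqP vn].
  by rewrite gt0_muley ?leey// lte_fin.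
have v1 : 0 < v by rewrite lt_neqAle eq_sym vn.
rewrite -EFinM lee_fin ler_pdivlMr//; apply: (@le_trans _ _ (B * v)).
  by rewrite ler_wpM2r// le_max lexx orbT.
by rewrite mulrC -ler_pdivlMr.
Qed.

Lemma prod_near1 (I : Type) (r : seq I) (P : pred I) (f : I -> R) (e : R) : 0 <= e ->
  (forall i, P i -> 0 <= f i /\ 1 - e <= f i <= 1) ->
  0 <= \prod_(i <- r | P i) f i /\ 1 - (size r)%:R * e <= \prod_(i <- r | P i) f i <= 1.
Proof.
move=> e0 H; elim: r => [|i r [ih0 /andP[ih1 ih2]]]; first by rewrite big_nil mul0r subr0 lexx.
rewrite big_cons -natr1 mulrDl mul1r; case: ifP => [/H [f0 /andP[f1 f2]]|_].
  by split; [rewrite mulr_ge0|apply/andP; split; nra].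
by split=> //; apply/andP; split; lra.
Qed.

Lemma prod_itv01 (I : Type) (r : seq I) (P : pred I) (f : I -> R) :
  (forall i, P i -> 0 <= f i <= 1) -> 0 <= \prod_(i <- r | P i) f i <= 1.
Proof.
move=> H; apply: (big_ind (fun x => 0 <= x <= 1)) => //; first by rewrite ler01 lexx.
by move=> a b /andP[a0 a1] /andP[b0 b1]; rewrite mulr_ge0//= mulr_ile1.
Qed.

Lemma exists_distinct n : exists2 s : seq R, uniq s & size s = n /\ forall i, i \in s -> K (L i).
Proof.
elim: n => [|n [s us [sn sK]]]; first by exists [::].
have [z Kz zl] := petal_compact_infinite (map L s); have [a za] := KL Kz.
exists (a :: s) => /=; first by rewrite us andbT; apply: contra zl => as1; rewrite za map_f.
by split=> [|i]; rewrite ?sn// inE => /orP[/eqP ->|/sK //]; rewrite -za.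
Qed.

(** Use [n] distinct points of [K]: each factor of their product tends to 1, as the
exponent [x = 2 / (n (n - 1))] is at most 1 and so the power of a number of the
unit interval is at least this number. *)
Lemma hyp_diameter_cvg n : (2 <= n)%N -> hyp_diameter n (flow phi t @` K) @[t --> -oo] --> 1%E.
Proof.
move=> n2; pose x : R := 2 / (n * (n - 1))%:R.
have nn : (2 <= n * (n - 1))%N by rewrite -[2%N]muln1 leq_mul// subn_gt0.
have nn0 : 0 < (n * (n - 1))%:R :> R by rewrite ltr0n (leq_trans _ nn).
have x0 : 0 <= x by rewrite divr_ge0.
have x1 : x <= 1 by rewrite ler_pdivrMr// mul1r ler_nat.
have powle1 (p : R) : 0 <= p -> p <= 1 -> p `^ x <= 1.
  by move=> p0 p1; have := ge0_ler_powR x0 _ _ p1; rewrite powR1; apply; rewrite nnegrE.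
have le1 t : (hyp_diameter n (flow phi t @` K) <= 1)%E.
  apply: ge_ereal_sup => _ [w wE <-]; rewrite lee_fin.
  have Dw i : D (w i) by have /(flow_imageP hphi hkoe hback KL)[s _ ->] := wE i; exact: LD.
  apply: (andP (prod_itv01 _ _)).2 => i _; apply: prod_itv01 => j _; rewrite powR_ge0/=.
  by apply: powle1; rewrite ?pseudo_ge0// ltW// pseudo_lt1.
have [s us [sn sK]] := exists_distinct n.
have near1 (e : R) : 0 < e -> \forall t \near -oo, forall i j : 'I_n, (i < j)%N ->
    1 - e <= pseudo_hyp_dist (L (nth 0 s i + t)) (L (nth 0 s j + t)).
  move=> e0; apply: filter_forall => i; apply: filter_forall => j.
  have [ij|ij] := boolP (i < j)%N; last by apply: nearW.
  have ab : nth 0 s i <> nth 0 s j.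
    by apply/eqP; rewrite nth_uniq ?sn// neq_ltn ij.
  have [T HT] := pseudo_trajectory_cvg1 hphi hkoe hback nreg ab e0.
  by apply: (@near_ninfty_le _ _ T) => t /HT.
apply/fine_cvgP; split.
  apply: nearW => t; rewrite ge0_fin_numE ?(le_lt_trans (le1 t)) ?ltry//.
  apply: (@le_trans _ _ (\prod_(i < n) \prod_(j < n | (i < j)%N)
      pseudo_hyp_dist (L (nth 0 s i + t)) (L (nth 0 s j + t)) `^ x)%:E).
    by rewrite lee_fin prodr_ge0// => i _; rewrite prodr_ge0// => j _; exact: powR_ge0.
  apply: ereal_sup_ubound; exists (fun i : 'I_n => L (nth 0 s i + t)) => // i.
  by apply/(flow_imageP hphi hkoe hback KL); exists (nth 0 s i) => //; apply: sK;
    rewrite mem_nth// sn.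
apply/cvgrPdist_le => e e0.
pose e' := Num.min 1 (e / (n%:R * n%:R)).
have n0 : 0 < n%:R :> R by rewrite ltr0n (leq_trans _ n2).
have e'0 : 0 < e' by rewrite lt_min ltr01 divr_gt0// mulr_gt0.
have e'1 : e' <= 1 by rewrite ge_min lexx.
have e'n : n%:R * (n%:R * e') <= e.
  by rewrite mulrA mulrC -ler_pdivlMr ?mulr_gt0// ge_min lexx orbT.
apply: filterS (near1 _ e'0) => t Ht.
have expands_at : ((1 - e)%:E <= hyp_diameter n (flow phi t @` K))%E.
  apply: (@le_trans _ _ (\prod_(i < n) \prod_(j < n | (i < j)%N)
      pseudo_hyp_dist (L (nth 0 s i + t)) (L (nth 0 s j + t)) `^ x)%:E); last first.
    apply: ereal_sup_ubound; exists (fun i : 'I_n => L (nth 0 s i + t)) => // i.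
    by apply/(flow_imageP hphi hkoe hback KL); exists (nth 0 s i) => //; apply: sK;
      rewrite mem_nth// sn.
  rewrite lee_fin.
  have szn : size (index_enum 'I_n) = n by rewrite -[RHS](card_ord n) cardE enumT.
  have inner (i : 'I_n) : 0 <= \prod_(j < n | (i < j)%N)
      pseudo_hyp_dist (L (nth 0 s i + t)) (L (nth 0 s j + t)) `^ x /\
      1 - n%:R * e' <= \prod_(j < n | (i < j)%N)
      pseudo_hyp_dist (L (nth 0 s i + t)) (L (nth 0 s j + t)) `^ x <= 1.
    rewrite -[in n%:R]szn; apply: prod_near1; first exact: ltW.
    move=> j ij; rewrite powR_ge0; split => //.
    have P0 : 0 < pseudo_hyp_dist (L (nth 0 s i + t)) (L (nth 0 s j + t)).
      apply: pseudo_gt0 => // /(trajectory_inj hkoe hback)/addIr/eqP.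
      by rewrite nth_uniq ?sn// => /eqP ij'; move: ij; rewrite ij' ltnn.
    have P1 := ltW (pseudo_lt1 (LD (nth 0 s i + t)) (LD (nth 0 s j + t))).
    apply/andP; split; last by apply: powle1; rewrite ?pseudo_ge0.
    apply: le_trans (Ht i j ij) _; rewrite -[leLHS]powRr1 ?pseudo_ge0//.
    by apply: ger_powR => //; rewrite P0.
  have [_ /andP[+ _]] := @prod_near1 _ (index_enum 'I_n) predT _ (n%:R * e')
    (mulr_ge0 (ltW n0) (ltW e'0)) (fun i _ => inner i).
  by apply: le_trans; rewrite szn; lra.
have fin : hyp_diameter n (flow phi t @` K) \is a fin_num.
  by rewrite fin_numElt (lt_le_trans _ expands_at) ?ltNyr// (le_lt_trans (le1 t)) ?ltry.
move: expands_at (le1 t); rewrite /= -(fineK fin) !lee_fin /= => a b.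
by rewrite ler_norml; apply/andP; split; lra.
Qed.
End Transport.

Theorem theorem1p7 (R : realType) (phi : R -> Cplx R -> Cplx R)
    (h : Cplx R -> Cplx R) (Delta K : set (Cplx R)) :
  holo_semigroup phi -> non_elliptic phi -> koenigs phi h ->
  degenerate_petal phi h Delta ->
  compact K -> ~ polar K -> K `<=` Delta ->
  (forall z, (Delta `\` K) z ->
     harmonic_measure (flow phi t z) (flow phi t @` K) @[t --> -oo] --> 0%E) /\
  (forall z, Delta z ->
     hyp_density (flow phi t z) @[t --> -oo] --> +oo) /\
  (forall z w, Delta z -> Delta w -> z <> w ->
     hyp_dist (flow phi t z) (flow phi t w) @[t --> -oo] --> +oo) /\
  (forall z w, Delta z -> Delta w -> z <> w ->
     green (flow phi t z) (flow phi t w) @[t --> -oo] --> 0%E) /\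
  (hyp_area (flow phi t @` K) @[t --> -oo] --> 0%E) /\
  (forall n : nat, (2 <= n)%N ->
     hyp_diameter n (flow phi t @` K) @[t --> -oo] --> 1%E) /\
  (condenser_capacity (flow phi t @` K) @[t --> -oo] --> +oo%E).
Proof.
move=> hphi _ hkoe [gamma [hback nreg DD hD]] cK npol KDelta.
have DL z : Delta z -> exists s, z = trajectory phi gamma s.
  exact: (petal_trajectory hphi hkoe hback DD hD).
have KL z : K z -> exists s, z = trajectory phi gamma s by move=> /KDelta/DL.
have [mu muK finE] := nonpolar_finite_energy npol.
have flowE a t : flow phi t (trajectory phi gamma a) = trajectory phi gamma (a + t).
  exact: (flow_trajectory hphi hkoe hback).
split; [|split; [|split; [|split; [|split; [|split]]]]].
- move=> z [/DL[a ->] nKa]; under eq_fun do rewrite flowE.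
  exact: (harmonic_measure_cvg hphi hkoe hback nreg cK KL nKa).
- move=> z /DL[a ->]; under eq_fun do rewrite flowE.
  exact: (density_cvg hphi hkoe hback).
- move=> z w /DL[a ->] /DL[b ->] zw; under eq_fun do rewrite !flowE.
  by apply: (hyp_dist_cvg hphi hkoe hback nreg) => ab; apply: zw; rewrite ab.
- move=> z w /DL[a ->] /DL[b ->] zw; under eq_fun do rewrite !flowE.
  by apply: (green_cvg hphi hkoe hback nreg) => ab; apply: zw; rewrite ab.
- under eq_fun do rewrite (hyp_area_flow hphi hkoe hback cK KL).
  exact: cvg_cst.
- move=> n n2; exact: (hyp_diameter_cvg hphi hkoe hback nreg cK KL muK finE n2).
- exact: (condenser_capacity_cvg hphi hkoe hback nreg cK KL muK finE).
Qed.
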